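(* Let $N\ge2$, $0<s<1$ and $1<p\le\frac{N+s}{N-s}$. Assume that $u\in C^{2}(\mathbb{R}^{N}_{+})\cap\overline{\mathcal{L}_{s}}$ is a nonnegative (classical, pointwise) solution of $$\begin{cases}-\mathcal{I}u\ge u^{p}&\text{in }\mathbb{R}^{N}_{+},\\ u\ge0&\text{in }\mathbb{R}^{N}\setminus\mathbb{R}^{N}_{+}.\end{cases}$$ Then $u\equiv0$.
   Context: $\mathbb{R}^{N}_{+}=\{x\in\mathbb{R}^{N}:x_{N}>0\}$, and $e_1,\dots,e_N$ is the standard orthonormal basis of $\mathbb{R}^N$. The operator is $\mathcal{I}u=\sum_{i=1}^{N}\mathcal{I}_iu$, where $$\mathcal{I}_{i}u(x)=\frac{C_{s}}{2}\int_{\mathbb{R}}\frac{u(x+te_{i})+u(x-te_{i})-2u(x)}{|t|^{1+2s}}\,dt,\qquad C_{s}=\left(\int_{\mathbb{R}}\frac{1-\cos x}{|x|^{1+2s}}\,dx\right)^{-1}.$$ The space $\overline{\mathcal{L}_s}$ is $$\overline{\mathcal{L}_{s}}=\left\{u\in L^{1}_{loc}(\mathbb{R}^{N}):\limsup_{|x|\to+\infty}\frac{|u(x)|}{|x|^{2s-N+1-\delta_{2}}}<+\infty\text{ for some }\delta_{2}>0\right\}.$$ Since $u$ is only an $L^1_{loc}$ function outside $\mathbb{R}^N_+$, the conclusion $u\equiv0$ is understood as $u=0$ everywhere in $\mathbb{R}^N_+$ and $u=0$ almost everywhere in $\mathbb{R}^N\setminus\mathbb{R}^N_+$. *)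

(* Defs.v *)
From HB Require Import structures.
From mathcomp Require Import all_boot all_order all_algebra.
From mathcomp Require Import all_classical all_reals all_analysis.

Set Implicit Arguments.
Unset Strict Implicit.
Unset Printing Implicit Defensive.

Import Order.TTheory GRing.Theory Num.Theory.
Import numFieldNormedType.Exports.

Local Open Scope classical_set_scope.
Local Open Scope ring_scope.

Section tuple_measure.
Local Open Scope ereal_scope.
Context {R : realType} d (T : measurableType d).
Variable mu : {sigma_finite_measure set T -> \bar R}.

Definition cons_pair (N : nat) (q : T * N.-tuple T) : N.+1.-tuple T :=
  [the N.+1.-tuple T of q.1 :: q.2].

Lemma measurable_cons_pair (N : nat) :
  measurable_fun [set: T * N.-tuple T] (@cons_pair N).
Proof. exact: measurable_cons. Qed.

Section step.
Variables (N : nat) (m : {sigma_finite_measure set (N.-tuple T) -> \bar R}).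

Definition tuple_measure_step : set (N.+1.-tuple T) -> \bar R :=
  pushforward (mu \x m) (@cons_pair N).

Let step0 : tuple_measure_step set0 = 0.
Proof. by rewrite /tuple_measure_step /pushforward preimage_set0 measure0. Qed.

Let step_ge0 A : 0 <= tuple_measure_step A.
Proof. exact: (measure_ge0 (mu \x m)). Qed.

Let step_sigma_additive : semi_sigma_additive tuple_measure_step.
Proof.
move=> F mF tF mUF; rewrite /tuple_measure_step /pushforward preimage_bigcup.
apply: (@measure_semi_sigma_additive _ _ _ (mu \x m)).
- by move=> k; rewrite -[X in measurable X]setTI; exact: measurable_cons_pair.
- apply/trivIsetP => i j _ _ ij; rewrite -preimage_setI.
  by move/trivIsetP : tF => ->//; rewrite preimage_set0.
- rewrite -preimage_bigcup -[X in measurable X]setTI.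
  exact: measurable_cons_pair.
Qed.

HB.instance Definition _ := isMeasure.Build _ _ _ tuple_measure_step
  step0 step_ge0 step_sigma_additive.

Let step_sigma_finite : sigma_finite setT tuple_measure_step.
Proof.
have /sigma_finiteP[G [TG Gnd Gfin]] := sigma_finiteT m.
have /sigma_finiteP[F [TF Fnd Ffin]] := sigma_finiteT mu.
pose uncons (t : N.+1.-tuple T) : T * N.-tuple T :=
  (thead t, [tuple of behead t]).
have unconsK : cancel (@cons_pair N) uncons.
  by case=> a b; rewrite /uncons /cons_pair /= theadE; congr pair;
    exact: val_inj.
have muncons : measurable_fun setT uncons.
  by apply/measurable_fun_pair; [exact: measurable_tnth|exact: measurable_behead].
exists (fun k => uncons @^-1` (F k `*` G k)).
  rewrite -preimage_bigcup -[LHS](preimage_setT uncons); congr (_ @^-1` _).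
  apply/esym; rewrite -subTset => -[x y] _.
  have [i _ Fx] : (\bigcup_k F k) x by rewrite -TF.
  have [j _ Gy] : (\bigcup_k G k) y by rewrite -TG.
  exists (maxn i j) => //; split => /=.
  - by move: x Fx; exact/subsetPset/Fnd/leq_maxl.
  - by move: y Gy; exact/subsetPset/Gnd/leq_maxr.
move=> k; have [mF Foo] := Ffin k; have [mG Goo] := Gfin k; split.
  rewrite -[X in measurable X]setTI; apply: muncons => //.
  exact: measurableX.
rewrite /tuple_measure_step /pushforward -comp_preimage.
rewrite (_ : uncons \o _ = id); last by apply/funext => q /=; rewrite unconsK.
rewrite preimage_id product_measure1E// lte_mul_pinfty// ge0_fin_numE//.
Qed.

HB.instance Definition _ := Measure_isSigmaFinite.Build _ _ _
  tuple_measure_step step_sigma_finite.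

End step.

Fixpoint tuple_measure (N : nat) :
    {sigma_finite_measure set (N.-tuple T) -> \bar R} :=
  match N with
  | 0 => [the {sigma_finite_measure set _ -> \bar R} of dirac [tuple]]
  | N'.+1 => [the {sigma_finite_measure set _ -> \bar R} of
               tuple_measure_step (tuple_measure N')]
  end.

End tuple_measure.

(* Points of R^N are row vectors 'rV[R]_N, which carry the topology and the
   differential calculus; measurability and Lebesgue measure on R^N are those
   of N.-tuple R, and [row_of_tuple] identifies the two. *)
Section lebesgue_Rn.
Context {R : realType}.

Definition row_of_tuple (N : nat) (t : N.-tuple (measurableTypeR R)) :
  'rV[R]_N := \row_i tnth t i.

Definition lebesgue_tuple (N : nat) :
    {sigma_finite_measure set (N.-tuple (measurableTypeR R)) -> \bar R} :=
  tuple_measure (@lebesgue_measure R) N.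

Definition ae_Rn (N : nat) (P : 'rV[R]_N -> Prop) : Prop :=
  {ae lebesgue_tuple N, forall t, P (row_of_tuple t)}.

(* The locally integrable Borel functions; every class in L^1_loc has such a
   representative. *)
Definition borel_L1loc (N : nat) (g : 'rV[R]_N -> R) : Prop :=
  measurable_fun [set: N.-tuple (measurableTypeR R)] (g \o @row_of_tuple N) /\
  forall K : set 'rV[R]_N, compact K ->
    (\int[lebesgue_tuple N]_(t in @row_of_tuple N @^-1` K)
        `|g (row_of_tuple t)|%:E < +oo)%E.

End lebesgue_Rn.

Section operator.
Context {R : realType} (n : nat).
(* The dimension of the space is n.+1. *)
Implicit Types (u : 'rV[R]_n.+1 -> R) (x : 'rV[R]_n.+1) (s : R).

Definition basis (i : 'I_n.+1) : 'rV[R]_n.+1 := delta_mx 0 i.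

Definition half_space : set 'rV[R]_n.+1 := [set x | 0 < x 0 ord_max].

(* The library norm on 'rV[R]_n.+1 is the sup norm. *)
Definition eucl_norm x : R := Num.sqrt (\sum_i x 0 i ^+ 2).

Definition at_infinity : set_system 'rV[R]_n.+1 :=
  [set A | exists M : R, forall x, M < eucl_norm x -> A x].

(* As a subspace of L^1_loc this consists of classes of functions modulo
   almost everywhere equality, so the condition is on some representative. *)
Definition Ls_bar s u : Prop :=
  exists g : 'rV[R]_n.+1 -> R,
    [/\ ae_Rn (fun x => u x = g x), borel_L1loc g &
      exists2 delta2 : R, 0 < delta2 &
        (limf_esup (fun x => (`|g x| /
            eucl_norm x `^ (2 * s - n.+1%:R + 1 - delta2))%:E)
          at_infinity < +oo)%E].

Definition C2_on (A : set 'rV[R]_n.+1) u : Prop :=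
  forall x, A x ->
    [/\ {for x, continuous u},
        forall i, derivable u x (basis i) /\
                  {for x, continuous ('D_(basis i) u)} &
        forall i j, derivable ('D_(basis i) u) x (basis j) /\
                    {for x, continuous ('D_(basis j) ('D_(basis i) u))}].

Definition Cs s : R :=
  (\int[@lebesgue_measure R]_t ((1 - cos t) / `|t| `^ (1 + 2 * s)))^-1.

Definition I_integrand s i u x (t : R) : R :=
  (u (x + t *: basis i) + u (x - t *: basis i) - 2 * u x)
    / `|t| `^ (1 + 2 * s).

(* The measure is completed so that u need not be Borel along the line. *)
Definition I_dir_defined s i u x : Prop :=
  (@completed_lebesgue_measure R).-integrable setT
    (fun t => (I_integrand s i u x t)%:E).

Definition I_dir s i u x : R :=
  Cs s / 2 * \int[@completed_lebesgue_measure R]_t I_integrand s i u x t.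

Definition I_op s u x : R := \sum_(i < n.+1) I_dir s i u x.

(* Each integral is required to converge: its value is 0 by convention when it
   does not. *)
Definition pointwise_supersolution s p u : Prop :=
  forall x, half_space x ->
    (forall i, I_dir_defined s i u x) /\ u x `^ p <= - I_op s u x.

End operator.

(* Main.v *)
Require Import Defs.
From mathcomp Require Import all_boot all_order all_algebra.
From mathcomp Require Import all_classical all_reals all_analysis measurable_realfun.
From mathcomp Require Import ring lra.

(** Write q = p / (p - 1) and let J be the operator -I with each
    one-dimensional integral restricted to |t| > eta. On nonnegative functions
    J is a multiple of the identity minus an integral against a symmetric
    nonnegative kernel, so by Tonelli it can be moved from the supersolution
    onto a test function without any assumption on the behaviour at infinity
    ([far_part_sym]).

    Only one-sided information is needed on both sides. On the side of u, the
    C^2 regularity bounds the second difference near the pole from below by a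
    parabola, so discarding |t| <= eta costs O(eta^(2-2s)) on compact subsets
    of the half-space ([second_difference_le], [far_integral_le],
    [pointwise_far_le]). On the side of the test function, what is needed is
    J phi <= lam phi, an inequality that survives maxima, positive multiples,
    translations, dilations and products ([subeigen_at], [prod_test_subeigen]).
    Letting eta tend to 0 gives, with a constant C depending on N and s,
        int u^p phi <= C lam int u phi                      ([test_inequality]).

    The test function is a product of one-dimensional factors. The tangential
    ones are the positive bump of the cosine, for which the addition formula
    gives the inequality ([subeigen_cos_bump]). The normal one must behave like
    the s-harmonic function t_+^s at the boundary: t_+^s satisfies the
    inequality with lam = 0 ([subeigen_pos_pow]), and cutting it at t = 3 is
    compensated by a high cosine bump around 3 ([subeigen_half_profile]).
    Dilating by r gives a test function phi_r with lam of order r^(-2s), with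
    integral O(r^(N+s)), and comparable to the weight w(x) = (x_N - eps)_+^s on
    the cube of radius r; the shift by eps keeps the support of phi_r in a
    compact subset of the open half-space.

    For a parameter M > 0 Young's inequality is used in the form
        c z <= min (c z) (M z^p) + M^(-1/(p-1)) c^q             ([young_split]).
    With c of order r^(-2s), the error term contributes
    O(r^(N + s - 2 s q)), which is bounded exactly when p <= (N+s)/(N-s)
    ([critical_exponent_le]). Taking M = 1/2 absorbs the minimum and bounds
    int u^p phi_r uniformly in r, hence int w u^p is finite. Then, for fixed M,
    the minimum tends to 0 by dominated convergence as r grows, and what is left
    is M^(-1/(p-1)) times a constant; letting M grow gives int w u^p = 0, so u
    vanishes for x_N > eps ([ae_zero_above]). The critical case needs this
    second step, since there the error term does not decay in r.

    Once u = 0 in the half-space, -I u(x) >= 0 at an interior point says that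
    the nonnegative exterior values have zero integral on the lines through x;
    the vertical lines and the symmetry of the kernel give u = 0 almost
    everywhere outside ([ae_zero_of_half_space]). *)

Set Implicit Arguments.
Unset Strict Implicit.
Unset Printing Implicit Defensive.

Import Order.TTheory GRing.Theory Num.Theory.
Import numFieldNormedType.Exports.

Local Open Scope classical_set_scope.
Local Open Scope ring_scope.

(** * Changes of variables on the real line *)
Section affine.
Context {R : realType}.
Local Open Scope ereal_scope.
Local Notation mu := (@lebesgue_measure R).

Lemma measurable_affine (a b : R) :
  measurable_fun [set: R] ((fun x => a * x + b)%R : measurableTypeR R -> measurableTypeR R).
Proof. by apply: measurable_funD => //; exact: measurable_funM. Qed.

Lemma measurable_patch (D : set R) (f : R -> \bar R) :
  measurable D -> measurable_fun setT f -> measurable_fun setT (f \_ D).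
Proof.
by move=> mD mf; apply: (measurable_restrictT f mD).1; exact: measurable_funTS.
Qed.

Lemma ge0_integral_affine (a b : R) (f : R -> \bar R) : (0 < a)%R ->
  measurable_fun setT f -> (forall x, 0 <= f x) ->
  \int[mu]_x f x = a%:E * \int[mu]_x f (a * x + b)%R.
Proof.
move=> a0 mf f0.
pose phi : measurableTypeR R -> measurableTypeR R := (fun x => a * x + b)%R.
have mphi : measurable_fun setT phi by exact: measurable_affine.
have a0' : (0 <= a)%R by exact: ltW.
have -> : \int[mu]_x f (a * x + b)%R = \int[mu]_(x in phi @^-1` setT) (f \o phi) x.
  by rewrite preimage_setT.
rewrite -(ge0_integral_pushforward mphi)//.
rewrite -[a%:E]/((NngNum a0')%:num%:E) -ge0_integral_mscale//.
apply: eq_measure_integral => A mA _.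
apply: lebesgue_measure_unique => //= _ [[c d]] _ <-.
rewrite /mscale/= /pushforward.
have -> : phi @^-1` `]c, d] = `]((c - b) / a)%R, ((d - b) / a)%R]%classic.
  by apply/seteqP; split => x /=; rewrite /phi !in_itv/= ltr_pdivrMr//
    ler_pdivlMr// ltrBlDr lerBrDr (mulrC a).
rewrite !lebesgue_measure_itv/= !lte_fin ltr_pM2r ?invr_gt0// ltrD2r.
case: ifPn => // cd; last by rewrite mule0.
rewrite -!EFinB -EFinM; congr EFin; field.
by rewrite gt_eqF.
Qed.

Lemma ge0_integral_itv_split (a b : R) (f : R -> \bar R) : (a <= b)%R ->
  measurable_fun setT f -> (forall x, 0 <= f x) ->
  \int[mu]_(x in `]a, +oo[) f x =
  \int[mu]_(x in `]a, b]) f x + \int[mu]_(x in `]b, +oo[) f x.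
Proof.
move=> ab mf f0; rewrite -ge0_integral_setU//=.
- by rewrite -itv_bndbnd_setU ?bnd_simp.
- exact: measurable_funTS.
- apply/disj_setPS => t [] /=; rewrite !in_itv/= => /andP[_ tb] /andP[bt _].
  by move: (lt_le_trans bt tb); rewrite ltxx.
Qed.

Lemma ge0_integral_opp (f : R -> \bar R) :
  measurable_fun setT f -> (forall x, 0 <= f x) ->
  \int[mu]_x f x = \int[mu]_x f (- x)%R.
Proof.
move=> mf f0.
pose phi : measurableTypeR R -> measurableTypeR R := -%R.
have mphi : measurable_fun setT phi by exact: oppr_measurable.
have -> : \int[mu]_x f (- x)%R = \int[mu]_(x in phi @^-1` setT) (f \o phi) x.
  by rewrite preimage_setT.
rewrite -(ge0_integral_pushforward mphi)//.
by apply: eq_measure_integral => A mA _; exact/esym/lebesgue_measureN.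
Qed.

End affine.

(** * Integrals of powers *)
Section power_integrals.
Context {R : realType}.
Local Notation mu := (@lebesgue_measure R).
Implicit Types (a b al be t : R).

Lemma powR_continuous al t : 0 < t -> {for t, continuous (@powR R ^~ al)}.
Proof.
by move=> t0; apply/differentiable_continuous/derivable1_diffP; apply: derivable_powR;
  rewrite in_itv/= t0.
Qed.

Lemma continuous_within_itvcc (f : R -> R) a b :
  (forall t, a <= t <= b -> {for t, continuous f}) ->
  {within `[a, b], continuous f}.
Proof.
move=> cf; apply: continuous_in_subspaceT => t; rewrite inE/= in_itv/=.
exact: cf.
Qed.

Lemma powRN_cvgy al : 0 < al -> t `^ (- al) @[t --> +oo] --> (0 : R).
Proof.
move=> al0; apply/cvgrPdist_le => e e0.
near=> t.
have t0 : 0 < t by near: t; exact: nbhs_pinfty_gt.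
rewrite sub0r normrN ger0_norm ?powR_ge0//.
have -> : e = (e `^ (- al^-1)) `^ (- al).
  by rewrite -powRrM mulrNN mulVf ?gt_eqF// powRr1// ltW.
rewrite powRN [leRHS]powRN lef_pV2 ?posrE ?powR_gt0//.
have et : e `^ (- al^-1) < t by near: t; exact: nbhs_pinfty_gt.
by apply: ge0_ler_powR; rewrite ?nnegrE ?powR_ge0 ?(ltW al0) ?(ltW t0) ?(ltW et).
Unshelve. all: by end_near. Qed.

Lemma is_derive_powR_over al t : 0 < t -> al != 0 ->
  is_derive t 1 (fun x => x `^ al / al) (t `^ (al - 1)).
Proof.
move=> t0 al0.
have := is_derive1_powR al t0 => H.
rewrite (_ : (fun x : R => _) = al^-1 *: (@powR R ^~ al)); last first.
  by apply/funext => x; rewrite /= mulrC.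
apply: is_derive_eq; rewrite /GRing.scale/= mulrA mulVf// mul1r//.
Qed.

Lemma integral_powRy a al : 0 < a -> 0 < al ->
  (\int[mu]_(t in `]a, +oo[) (t `^ (- (1 + al)))%:E = (a `^ (- al) / al)%:E)%E.
Proof.
move=> a0 al0.
have dF t : 0 < t -> is_derive t 1 (fun x => x `^ (- al) / (- al)) (t `^ (- (1 + al))).
  move=> t0; rewrite (_ : - (1 + al) = - al - 1) ; last by rewrite opprD addrC.
  by apply: is_derive_powR_over; rewrite // oppr_eq0 gt_eqF.
rewrite integral_itv_obnd_cbnd; last first.
  by apply/measurable_funTS/measurable_EFinP; exact: measurable_powR.
rewrite (@ge0_continuous_FTC2y _ _ (fun x => x `^ (- al) / (- al)) _ 0).
- by rewrite sub0e -EFinN; congr EFin; rewrite invrN mulrN opprK.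
- by move=> *; exact: powR_ge0.
- apply: continuous_in_subspaceT => t; rewrite inE/= in_itv/= andbT => at_.
  by apply: powR_continuous; exact: lt_le_trans at_.
- rewrite -[X in _ --> X](mul0r (- al)^-1); apply: cvgMl; exact: powRN_cvgy.
- by move=> t at_; apply: (ex_derive (is_derive := dF t _)); exact: lt_trans at_.
- apply: cvg_at_right_filter.
  apply/(@differentiable_continuous _ _ _ a (fun x : R => x `^ (- al) / (- al))).
  by apply/derivable1_diffP; exact: (ex_derive (is_derive := dF a a0)).
- move=> t; rewrite in_itv/= andbT => at_; rewrite derive1E.
  exact: (derive_val (is_derive := dF t (lt_trans a0 at_))).
Qed.

Lemma integral_powRcc a b be : 0 < a -> a < b -> -1 < be ->
  (\int[mu]_(t in `[a, b]) (t `^ be)%:E =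
    (b `^ (be + 1) / (be + 1) - a `^ (be + 1) / (be + 1))%:E)%E.
Proof.
move=> a0 ab be1.
have be0 : be + 1 != 0 by rewrite gt_eqF//; lra.
have dF t : 0 < t -> is_derive t 1 (fun x => x `^ (be + 1) / (be + 1)) (t `^ be).
  by move=> t0; rewrite -[X in t `^ X](addrK 1); exact: is_derive_powR_over.
have cF t : 0 < t -> {for t, continuous (fun x : R => x `^ (be + 1) / (be + 1))}.
  move=> t0; apply: differentiable_continuous.
  by apply/derivable1_diffP; exact: (ex_derive (is_derive := dF t t0)).
rewrite (@continuous_FTC2 _ _ (fun x => x `^ (be + 1) / (be + 1))) ?EFinB//.
- by apply: continuous_within_itvcc => t /andP[? _]; apply: powR_continuous; lra.
- split.
  + move=> t; rewrite in_itv/= => /andP[? _].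
    by apply: (ex_derive (is_derive := dF t _)); lra.
  + by apply: cvg_at_right_filter; exact: cF.
  + by apply: cvg_at_left_filter; apply: cF; lra.
- move=> t; rewrite in_itv/= => /andP[? _]; rewrite derive1E.
  by apply: (derive_val (is_derive := dF t _)); lra.
Qed.

(** Monotone convergence over the intervals [b / (k + 2), b] reduces the
    singular endpoint to [integral_powRcc]. *)
Lemma integral_powR0_le b be : 0 < b -> -1 < be ->
  (\int[mu]_(t in `]0%R, b]) (t `^ be)%:E <= (b `^ (be + 1) / (be + 1))%:E)%E.
Proof.
move=> b0 be1.
pose F (k : nat) : set R := `[(b / k.+2%:R), b]%classic.
have -> : `]0, b]%classic = \bigcup_k F k.
  apply/seteqP; split => t /=; rewrite /F/= ?in_itv/=.
    move=> /andP[t0 tb].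
    exists (Num.truncn (b / t)) => //=; rewrite in_itv/= tb andbT.
    rewrite ler_pdivrMr// mulrC -ler_pdivrMr//.
    by rewrite (le_trans (ltW (truncnS_gt _)))// ler_nat.
  move=> [k _ /=]; rewrite in_itv/= => /andP[+ ->]; rewrite andbT.
  by apply: lt_le_trans; rewrite divr_gt0.
have Fk k : measurable (F k) by exact: measurable_itv.
have ndF : nondecreasing_seq F.
  move=> i j ij; rewrite subsetEset => t; rewrite /F/= !in_itv/= => /andP[h ->].
  by rewrite andbT (le_trans _ h)// ler_pM2l// lef_pV2 ?posrE// ler_nat !ltnS.
have mf k : measurable_fun (F k) (fun t => (t `^ be)%:E).
  by apply/measurable_funTS/measurable_EFinP; exact: measurable_powR.
have cvgF : ((\int[mu]_(t in F i) (t `^ be)%:E) @[i --> \oo] -->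
    (\int[mu]_(t in \bigcup_i F i) (t `^ be)%:E))%E.
  apply: ge0_nondecreasing_set_cvg_integral => //.
  by move=> i x _; rewrite lee_fin powR_ge0.
rewrite -(cvg_lim _ cvgF)//; apply: lime_le; first exact: (cvgP _ cvgF).
apply: nearW => k; rewrite integral_powRcc// ?divr_gt0//; last first.
  by rewrite ltr_pdivrMr// ltr_pMr// ltr1n.
by rewrite lee_fin gerBl divr_ge0 ?powR_ge0//; lra.
Qed.
End power_integrals.

(** * Sub-eigenfunctions of the truncated one-dimensional operator *)
Section kernel.
Context {R : realType}.
Local Notation mu := (@lebesgue_measure R).
Implicit Types (s a b t y lam eta : R) (chi : R -> R).

Definition kern s t : R := (`|t| `^ (1 + 2 * s))^-1.

Lemma kern_ge0 s t : 0 <= kern s t.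
Proof. by rewrite invr_ge0 powR_ge0. Qed.

Lemma measurable_kern s : measurable_fun setT (kern s).
Proof.
rewrite (_ : kern s = (fun t => `|t| `^ (- (1 + 2 * s)))).
  by apply: measurableT_comp (measurable_powR _) _; exact: normr_measurable.
by apply/funext => t; rewrite /kern powRN.
Qed.

Lemma measurable_EFin_kern s : measurable_fun setT (fun t => (kern s t)%:E).
Proof. by apply/measurable_EFinP; exact: measurable_kern. Qed.

Lemma kernE s t : 0 < t -> kern s t = t `^ (- (1 + 2 * s)).
Proof. by move=> t0; rewrite /kern gtr0_norm// -powRN. Qed.

Lemma kern_scale s a t : 0 < a -> kern s (a * t) = a `^ (- (1 + 2 * s)) * kern s t.
Proof.
by move=> a0; rewrite /kern normrM powRM// invfM (gtr0_norm a0) powRN.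
Qed.

Lemma integral_kern s eta : 0 < s -> 0 < eta ->
  (\int[mu]_(t in `]eta, +oo[) (kern s t)%:E =
    (eta `^ (- (2 * s)) / (2 * s))%:E)%E.
Proof.
move=> s0 eta0; rewrite -integral_powRy// ?mulr_gt0//.
apply: eq_integral => t; rewrite inE/= in_itv/= andbT => et.
by rewrite kernE// (lt_trans eta0).
Qed.

Lemma ge0_integral_scaley (a eta : R) (f : R -> \bar R) : 0 < a ->
  measurable_fun setT f -> (forall t, 0 <= f t)%E ->
  (\int[mu]_(t in `]eta, +oo[) (f t) =
    a%:E * \int[mu]_(t in `](eta / a)%R, +oo[) (f (a * t)%R))%E.
Proof.
move=> a0 mf f0; rewrite integral_mkcond (@ge0_integral_affine _ a 0)//; last 2 first.
- exact: (measurable_restrictT _ _).1 (measurable_funTS mf).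
- by move=> t; apply: erestrict_ge0.
congr (_ * _)%E; rewrite [RHS]integral_mkcond; apply: eq_integral => t _.
rewrite !patchE addr0 !mem_setE !in_itv/= !andbT.
by rewrite ltr_pdivrMr// mulrC.
Qed.

(** With K = int_eta^oo kern, this says that the truncated operator
    2 K chi - int_eta^oo (chi (y + t) + chi (y - t)) kern is at most lam chi at
    y. Keeping the two nonnegative integrals on opposite sides avoids
    differences of possibly infinite quantities. *)
Definition subeigen_at s chi lam eta y : Prop :=
  ((2 * chi y)%:E * \int[mu]_(t in `]eta, +oo[) (kern s t)%:E <=
   \int[mu]_(t in `]eta, +oo[) ((chi (y + t) + chi (y - t)) * kern s t)%:E
     + (lam * chi y)%:E)%E.

Lemma measurable_second_sum s chi y : measurable_fun setT chi ->
  measurable_fun setT (fun t => ((chi (y + t) + chi (y - t)) * kern s t)%:E).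
Proof.
move=> mchi; apply/measurable_EFinP/measurable_funM; last exact: measurable_kern.
apply: measurable_funD; apply: measurableT_comp mchi _.
  exact: measurable_funD.
exact: measurable_funB.
Qed.

Lemma measurable_comp_kern s (chi : R -> R) c d : measurable_fun setT chi ->
  measurable_fun setT (fun t : R => (chi (c + d * t) * kern s t)%:E).
Proof.
move=> mchi; apply/measurable_EFinP/measurable_funM; last exact: measurable_kern.
apply: (measurableT_comp mchi); exact: measurable_funD.
Qed.

Lemma second_sum_ge0 s chi y t : (forall y, 0 <= chi y) ->
  (0 <= ((chi (y + t) + chi (y - t)) * kern s t)%:E)%E.
Proof. by move=> chi0; rewrite lee_fin mulr_ge0 ?kern_ge0 ?addr_ge0. Qed.

(** The kernel is homogeneous of degree -(1 + 2 s), which fixes the power of a. *)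
Lemma subeigen_at_scale s chi lam a eta y : 0 < s -> 0 < a -> 0 < eta ->
  measurable_fun setT chi -> (forall y, 0 <= chi y) ->
  subeigen_at s chi lam (eta / a) (y / a) ->
  subeigen_at s (fun t => chi (t / a)) (a `^ (- (2 * s)) * lam) eta y.
Proof.
move=> s0 a0 eta0 mchi chi0; rewrite /subeigen_at => H.
have as0 : 0 < a `^ (- (2 * s)) by rewrite powR_gt0.
rewrite (@ge0_integral_scaley a)//; last 2 first.
- exact: measurable_EFin_kern.
- by move=> t; rewrite lee_fin kern_ge0.
rewrite [X in (_ <= X + _)%E](@ge0_integral_scaley a)//; last 2 first.
- apply: (@measurable_second_sum _ (fun t => chi (t / a))).
  by apply: (measurableT_comp mchi); exact: mulrr_measurable.
- by move=> t; exact: (@second_sum_ge0 _ (fun t => chi (t / a))).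
have e1 : a * a `^ (- (1 + 2 * s)) = a `^ (- (2 * s)).
  by rewrite -[X in X * _]powRr1 ?ltW// -powRD ?(gt_eqF a0) ?implybT//; congr powR; lra.
under eq_integral do rewrite kern_scale// EFinM.
rewrite ge0_integralZl//; last 3 first.
- by apply: measurable_funTS; exact: measurable_EFin_kern.
- by move=> t _; rewrite lee_fin kern_ge0.
- by rewrite lee_fin powR_ge0.
under [X in (_ <= _ * X + _)%E]eq_integral => t _.
  rewrite (mulrDl y) (mulrBl _ y) (mulrC a t) mulfK ?gt_eqF//.
  rewrite (mulrC t a) kern_scale// mulrCA EFinM.
  over.
rewrite ge0_integralZl//; last 3 first.
- by apply: measurable_funTS; exact: measurable_second_sum.
- by move=> t _; apply: second_sum_ge0.
- by rewrite lee_fin powR_ge0.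
rewrite !(muleA a%:E) -EFinM e1 muleCA -mulrA (EFinM (a `^ _)) -muleDr//; last first.
  exact: fin_num_adde_defl.
by rewrite lee_pmul2l// lte_fin.
Qed.

(** Raising chi away from y only increases the right-hand side, so a maximum of
    two sub-eigenfunctions is tested at y through the one that realizes it. *)
Lemma subeigen_at_le s chi chi' lam eta y : 0 <= lam ->
  measurable_fun setT chi -> measurable_fun setT chi' -> (forall y, 0 <= chi' y) ->
  (forall y, chi' y <= chi y) -> chi y = chi' y ->
  subeigen_at s chi' lam eta y -> subeigen_at s chi lam eta y.
Proof.
move=> lam0 mchi mchi' chi'0 le e; rewrite /subeigen_at e => H.
apply: (le_trans H); rewrite leeD2r//; apply: ge0_le_integral => //.
- by move=> t _; exact: second_sum_ge0.
- by apply: measurable_funTS; exact: measurable_second_sum.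
- by apply: measurable_funTS; exact: measurable_second_sum.
- by move=> t _; rewrite lee_fin ler_wpM2r ?kern_ge0// lerD.
Qed.

Lemma subeigen_at_mul s chi lam eta y c : 0 <= c ->
  measurable_fun setT chi -> (forall y, 0 <= chi y) ->
  subeigen_at s chi lam eta y -> subeigen_at s (fun t => c * chi t) lam eta y.
Proof.
move=> c0 mchi chi0; rewrite /subeigen_at => H.
under [X in (_ <= X + _)%E]eq_integral do rewrite -mulrDr -mulrA EFinM.
rewrite ge0_integralZl//; last 2 first.
- by apply: measurable_funTS; exact: measurable_second_sum.
- by move=> t _; apply: second_sum_ge0.
rewrite (mulrCA 2) (mulrCA lam) !(EFinM c) -muleA -muleDr//; last first.
  exact: fin_num_adde_defl.
by rewrite lee_wpmul2l.
Qed.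

End kernel.

(** * A local criterion for sub-eigenfunctions *)
Section local_criterion.
Context {R : realType}.
Local Notation mu := (@lebesgue_measure R).
Implicit Types (s t y eta : R) (chi : R -> R).

(** An upper bound for the defect 2 chi y - chi (y + t) - chi (y - t), relative to
    chi y: quadratic near the pole, and 2 elsewhere because chi is nonnegative. *)
Definition parab_cut t : R := if t <= 1 then t ^+ 2 else 2.

Lemma parab_cut_ge0 t : 0 <= parab_cut t.
Proof. by rewrite /parab_cut; case: ifP => // _; exact: sqr_ge0. Qed.

Lemma measurable_parab_cut : measurable_fun setT parab_cut.
Proof.
apply: measurable_fun_ifT => //.
by apply: measurable_fun_ler.
Qed.

Lemma measurable_parab_kern s :
  measurable_fun setT (fun t => (parab_cut t * kern s t)%:E).
Proof.
apply/measurable_EFinP/measurable_funM; last exact: measurable_kern.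
exact: measurable_parab_cut.
Qed.

(** The sum of int_0^1 t^2 kern and of int_1^oo 2 kern. *)
Definition eigen_cst s : R := (2 - 2 * s)^-1 + s^-1.

Lemma eigen_cst_ge0 s : 0 < s -> s < 1 -> 0 <= eigen_cst s.
Proof. by move=> s0 s1; rewrite addr_ge0// invr_ge0; lra. Qed.

Lemma integral_sqr_kern_le s b : 0 < s -> s < 1 -> 0 < b ->
  (\int[mu]_(t in `]0%R, b]) (t ^+ 2 * kern s t)%:E <=
    (b `^ (2 - 2 * s) / (2 - 2 * s))%:E)%E.
Proof.
move=> s0 s1 b0.
have -> : 2 - 2 * s = 1 - 2 * s + 1 by lra.
apply: le_trans (integral_powR0_le b0 _); last lra.
rewrite le_eqVlt; apply/orP; left; apply/eqP.
apply: eq_integral => t; rewrite inE/= in_itv/= => /andP[t0 _].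
congr EFin; rewrite kernE// -powR_mulrn ?ltW// -powRD; last first.
  by rewrite (gt_eqF t0) implybT.
by congr powR; lra.
Qed.

Lemma integral_parab_kern_le s : 0 < s -> s < 1 ->
  (\int[mu]_(t in `]0%R, +oo[) (parab_cut t * kern s t)%:E <= (eigen_cst s)%:E)%E.
Proof.
move=> s0 s1.
rewrite (@ge0_integral_itv_split _ 0 1)//; last 2 first.
- exact: measurable_parab_kern.
- by move=> t; rewrite lee_fin mulr_ge0 ?kern_ge0 ?parab_cut_ge0.
rewrite EFinD; apply: leeD.
  apply: (@le_trans _ _ (1 `^ (2 - 2 * s) / (2 - 2 * s))%:E).
    apply: le_trans (integral_sqr_kern_le s0 s1 ltr01).
    rewrite le_eqVlt; apply/orP; left; apply/eqP.
    apply: eq_integral => t; rewrite inE/= in_itv/= => /andP[_ t1].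
    by rewrite /parab_cut t1.
  by rewrite powR1 mul1r.
under eq_integral => t.
  rewrite inE/= in_itv/= andbT => t1; rewrite /parab_cut leNgt t1/= EFinM; over.
rewrite ge0_integralZl//; last 2 first.
- by apply: measurable_funTS; exact: measurable_EFin_kern.
- by move=> t _; rewrite lee_fin kern_ge0.
rewrite integral_kern// powR1 -EFinM lee_fin le_eqVlt; apply/orP; left; apply/eqP.
by field; rewrite gt_eqF.
Qed.

Lemma subeigen_at_local s chi eta y : 0 < s -> s < 1 -> 0 < eta ->
  measurable_fun setT chi -> (forall y, 0 <= chi y) ->
  (forall t, 0 < t -> t <= 1 ->
    2 * chi y <= chi (y + t) + chi (y - t) + t ^+ 2 * chi y) ->
  subeigen_at s chi (eigen_cst s) eta y.
Proof.
move=> s0 s1 eta0 mchi chi0 H; rewrite /subeigen_at.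
rewrite -ge0_integralZl//; last 3 first.
- by apply: measurable_funTS; exact: measurable_EFin_kern.
- by move=> t _; rewrite lee_fin kern_ge0.
- by rewrite lee_fin mulr_ge0.
have mP : measurable_fun `]eta, +oo[ (fun t => (chi y)%:E * (parab_cut t * kern s t)%:E)%E.
  by apply: measurable_funTS; apply: measurable_funeM; exact: measurable_parab_kern.
have P0 t : (0 <= (chi y)%:E * (parab_cut t * kern s t)%:E)%E.
  by rewrite -EFinM lee_fin !mulr_ge0 ?kern_ge0 ?parab_cut_ge0.
apply: (@le_trans _ _ (\int[mu]_(t in `]eta, +oo[)
   (((chi (y + t) + chi (y - t)) * kern s t)%:E +
    (chi y)%:E * (parab_cut t * kern s t)%:E))%E).
  apply: ge0_le_integral => //.
  - by move=> t _; rewrite -EFinM lee_fin !mulr_ge0 ?kern_ge0.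
  - by apply: measurable_funTS; apply: measurable_funeM; exact: measurable_EFin_kern.
  - apply: emeasurable_funD => //.
    by apply: measurable_funTS; exact: measurable_second_sum.
  - move=> t /=; rewrite in_itv/= andbT => et.
    rewrite -!EFinM -EFinD lee_fin mulrA -mulrDl ler_wpM2r ?kern_ge0//.
    rewrite /parab_cut; case: ifPn => t1.
      by rewrite (mulrC (chi y)); apply: H => //; exact: lt_trans et.
    by rewrite mulrC lerDr addr_ge0.
rewrite ge0_integralD//; last 2 first.
- by move=> t _; exact: second_sum_ge0.
- by apply: measurable_funTS; exact: measurable_second_sum.
rewrite leeD2l// ge0_integralZl//; last 3 first.
- by apply: measurable_funTS; exact: measurable_parab_kern.
- by move=> t _; rewrite lee_fin mulr_ge0 ?kern_ge0 ?parab_cut_ge0.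
- by rewrite lee_fin.
rewrite mulrC EFinM lee_wpmul2l ?lee_fin//.
apply: le_trans (integral_parab_kern_le s0 s1).
apply: ge0_subset_integral => //.
- by apply: measurable_funTS; exact: measurable_parab_kern.
- by move=> t _; rewrite lee_fin mulr_ge0 ?kern_ge0 ?parab_cut_ge0.
- by move=> t /=; rewrite !in_itv/= !andbT; exact: lt_trans.
Qed.
End local_criterion.

(** * The cosine bump *)
Section cosine_bump.
Context {R : realType}.
Implicit Types (s t y z eta : R).

Lemma sin_le_id (x : R) : 0 <= x -> `|sin x| <= x.
Proof.
rewrite le_eqVlt => /predU1P[<-|x0]; first by rewrite sin0 normr0.
have [|c _] := @MVT R sin cos 0 x x0 (fun y _ => is_derive_sin y).
  by apply: continuous_subspaceT => y; exact: continuous_sin.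
rewrite sin0 !subr0 => ->.
by rewrite normrM (gtr0_norm x0) ler_piMl ?cos_max// ltW.
Qed.

Lemma one_sub_cos_le t : 0 <= t -> 2 * (1 - cos t) <= t ^+ 2.
Proof.
move=> t0; have -> : t = (t / 2) *+ 2 by rewrite -mulr_natr divfK.
set x := t / 2.
have x0 : 0 <= x by rewrite divr_ge0.
rewrite cos_mulr2n cos2sin2.
have := sin_le_id x0; rewrite -ler_sqr ?nnegrE// real_normK ?num_real// => h.
lra.
Qed.

Definition cos_bump t : R := if `|t| <= pi / 2 then cos t else 0.

Lemma measurable_cos_bump : measurable_fun setT cos_bump.
Proof.
apply: measurable_fun_ifT => //.
- apply: measurable_fun_ler => //; exact: normr_measurable.
- by apply: continuous_measurable_fun; exact: continuous_cos.
Qed.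

Lemma cos_bump_ge0 t : 0 <= cos_bump t.
Proof.
by rewrite /cos_bump; case: ifPn => //; rewrite ler_norml => /cos_ge0_pihalf.
Qed.

Lemma cos_bump_le1 t : cos_bump t <= 1.
Proof. by rewrite /cos_bump; case: ifPn => // _; exact: cos_le1. Qed.

Lemma cos_bump_out t : 2 < `|t| -> cos_bump t = 0.
Proof.
move=> t2; rewrite /cos_bump leNgt (lt_trans _ t2)//.
by have /andP[_] := @pihalf_02 R.
Qed.

(** Between pi / 2 and pi the cosine is negative, so cutting it off to 0 raises
    it. *)
Lemma cos_bump_ge z : `|z| <= pi -> cos z <= cos_bump z.
Proof.
move=> zpi; rewrite /cos_bump; case: ifPn => //; rewrite -ltNge => zpi2.
rewrite -cos_norm -[X in cos X](subrK (pi / 2)) cosDpihalf oppr_le0.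
by apply: sin_ge0_pi; apply/andP; split; lra.
Qed.

(** On the support of the bump, cos (y + t) + cos (y - t) = 2 cos y cos t and
    cos t >= 1 - t^2 / 2; for t <= 1 both points stay in [-pi, pi], where the bump
    dominates the cosine. *)
Lemma subeigen_cos_bump s eta y : 0 < s -> s < 1 -> 0 < eta ->
  subeigen_at s cos_bump (eigen_cst s) eta y.
Proof.
move=> s0 s1 eta0; apply: subeigen_at_local => //.
- exact: measurable_cos_bump.
- exact: cos_bump_ge0.
move=> t t0 t1; have pi2 := @pi_ge2 R.
rewrite {1}/cos_bump; case: ifPn => ypi; last first.
  rewrite mulr0 {3}/cos_bump (negbTE ypi) mulr0 addr0.
  by rewrite addr_ge0 ?cos_bump_ge0.
have cy : cos_bump y = cos y by rewrite /cos_bump ypi.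
have h1 : cos (y + t) <= cos_bump (y + t).
  apply: cos_bump_ge; apply: le_trans (ler_normD _ _) _; rewrite (gtr0_norm t0); lra.
have h2 : cos (y - t) <= cos_bump (y - t).
  apply: cos_bump_ge; apply: le_trans (ler_normB _ _) _; rewrite (gtr0_norm t0); lra.
apply: le_trans (lerD (lerD h1 h2) (lexx _)).
rewrite cosD cosB cy.
have := one_sub_cos_le (ltW t0); have := cos_bump_ge0 y; rewrite cy.
nra.
Qed.
End cosine_bump.

(** * The power t_+^s: primitive and substitution *)
Section half_line_profile.
Context {R : realType}.
Local Notation mu := (@lebesgue_measure R).
Implicit Types (s t y eta : R).

(** The positive part is taken before the power because a real power of a
    negative base is 1. *)
Definition pos_pow s t : R := Num.max t 0 `^ s.

Lemma pos_pow_ge0 s t : 0 <= pos_pow s t. Proof. exact: powR_ge0. Qed.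

Lemma pos_powE s t : 0 <= t -> pos_pow s t = t `^ s.
Proof. by move=> t0; rewrite /pos_pow max_l. Qed.

Lemma pos_pow_le0 s t : 0 < s -> t <= 0 -> pos_pow s t = 0.
Proof. by move=> s0 t0; rewrite /pos_pow max_r// powR0// gt_eqF. Qed.

Lemma pos_pow_homo s t y : 0 <= s -> t <= y -> pos_pow s t <= pos_pow s y.
Proof.
move=> s0 ty; apply: ge0_ler_powR => //; last by rewrite ge_max !le_max ty lexx orbT.
  by rewrite nnegrE le_max lexx orbT.
by rewrite nnegrE le_max lexx orbT.
Qed.

Lemma measurable_pos_pow s : measurable_fun setT (pos_pow s).
Proof.
apply: (measurableT_comp (measurable_powR s)); exact: measurable_maxr.
Qed.

Lemma pos_pow_scale s a t : 0 < a -> pos_pow s t = a `^ s * pos_pow s (t / a).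
Proof.
move=> a0; rewrite /pos_pow -(powRM s (ltW a0)); last first.
  by rewrite le_max lexx orbT.
by rewrite maxr_pMr ?ltW// mulr0 mulrC divfK ?gt_eqF.
Qed.

(** Young's inequality with exponents 1 / s and 1 / (1 - s), applied to t^s and
    1. *)
Lemma powR_le_tangent s t : 0 < s -> s < 1 -> 0 <= t -> t `^ s <= s * t + (1 - s).
Proof.
move=> s0 s1 t0.
have := @conjugate_powR R (t `^ s) 1 s^-1 (1 - s)^-1 (powR_ge0 _ _) ler01.
rewrite -powRrM divff ?gt_eqF// powRr1// powR1 !invrK mulr1 mul1r mulrC.
by apply; rewrite ?invr_gt0//; lra.
Qed.

Lemma second_sum_pos_pow_le2 s t : 0 < s -> s < 1 -> 0 <= t -> t <= 1 ->
  pos_pow s (1 + t) + pos_pow s (1 - t) <= 2.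
Proof.
move=> s0 s1 t0 t1; rewrite !pos_powE; try lra.
have := @powR_le_tangent s (1 + t) s0 s1; have := @powR_le_tangent s (1 - t) s0 s1.
lra.
Qed.

(** A primitive of [harm_dens] that tends to 0 as x tends to 1, so that the
    second sum of t_+^s reduces to its value near 0. *)
Definition harm_prim s (x : R) : R :=
  ((1 - x) `^ (2 * s) - 2 * (1 - x) `^ s) * x `^ (- (2 * s)) / (2 * s).

Definition harm_dens s (x : R) : R :=
  ((1 - x) `^ (s - 1) - (1 - x) `^ (2 * s - 1) + (1 - x) `^ s) * x `^ (- (1 + 2 * s)).

Lemma is_derive_powR_onem al (x : R) : x < 1 ->
  is_derive x 1 (fun y => (1 - y) `^ al) (- (al * (1 - x) `^ (al - 1))).
Proof.
move=> x1.
have h : is_derive x 1 (fun y : R => 1 - y) (-1).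
  have := is_deriveB (is_derive_cst (1 : R) x 1) (is_derive_id x (1 : R)).
  by rewrite sub0r; exact.
have h2 : is_derive (1 - x) 1 (@powR R ^~ al) (al * (1 - x) `^ (al - 1)).
  by apply: is_derive1_powR; rewrite subr_gt0.
have := @is_derive1_comp _ (@powR R ^~ al) (fun y => 1 - y) x _ _ h2 h.
by rewrite mulrN1; exact.
Qed.

Lemma is_derive_harm_prim s (x : R) : 0 < s -> 0 < x -> x < 1 ->
  is_derive x 1 (harm_prim s) (harm_dens s x).
Proof.
move=> s0 x0 x1.
have h1 := is_derive_powR_onem (2 * s) x1.
have h2 := is_derive_powR_onem s x1.
have h3 := is_derive1_powR (- (2 * s)) x0.
rewrite (_ : harm_prim s = fun y =>
  (2 * s)^-1 *: (((fun y => (1 - y) `^ (2 * s)) - 2 *: (fun y => (1 - y) `^ s))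
    * (@powR R ^~ (- (2 * s)))) y); last first.
  by apply/funext => y; rewrite /harm_prim /GRing.scale/= mulrC.
apply: is_derive_eq; rewrite /GRing.scale/= /harm_dens.
set a := 1 - x; have a0 : 0 < a by rewrite subr_gt0.
rewrite (_ : - (2 * s) - 1 = - (1 + 2 * s)); last lra.
have e1 (al : R) : 0 < al -> a `^ al = a * a `^ (al - 1).
  by move=> al0; rewrite mulr_powRB1// ltW.
have e2 : x `^ (- (2 * s)) = x * x `^ (- (1 + 2 * s)).
  rewrite (_ : - (2 * s) = 1 + - (1 + 2 * s)); last lra.
  by rewrite powRD ?powRr1 ?ltW// (gt_eqF x0) implybT.
rewrite -[X in X * (- _ * _)]/(a `^ (2 * s) - 2 * a `^ s) e2.
rewrite (e1 s)// (e1 (2 * s)) ?mulr_gt0//.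
rewrite (_ : x = 1 - a); last by rewrite /a; ring.
by field; rewrite gt_eqF.
Qed.

(** This is x / (1 - x). The point 1 + moebius x on the right of 1 is the
    inverse of the point 1 - x on its left, which is why it matches the two
    halves of the second sum of t_+^s at 1. *)
Definition moebius (x : R) : R := (1 - x)^-1 - 1.

Lemma is_derive_moebius (x : R) : x < 1 ->
  is_derive x 1 moebius ((1 - x) ^- 2).
Proof.
move=> x1; have a0 : 1 - x != 0 by rewrite subr_eq0 gt_eqF.
have h := is_deriveB (is_derive_cst (1 : R) x 1) (is_derive_id x (1 : R)).
have h2 := @is_deriveV _ (cst 1 - id) x _ _ a0 h.
have := is_deriveB h2 (is_derive_cst (1 : R) x 1).
rewrite subr0 sub0r /GRing.scale/= mulrN1 opprK; exact.
Qed.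

Lemma moebius_cvg (x : R) : x < 1 -> {for x, continuous moebius}.
Proof.
move=> x1; apply: differentiable_continuous; apply/derivable1_diffP.
exact: (ex_derive (is_derive := is_derive_moebius x1)).
Qed.

Lemma moebius_lt (x y : R) : x < y -> y < 1 -> moebius x < moebius y.
Proof.
by move=> xy y1; rewrite ltrD2r ltf_pV2 ?posrE ?subr_gt0 ?(lt_trans xy)// ltrD2l ltrN2.
Qed.

Lemma moebius_gt (x : R) : 0 < x -> x < 1 -> x < moebius x.
Proof.
move=> x0 x1; rewrite /moebius ltrBrDr.
rewrite -[ltRHS]mul1r ltr_pdivlMr ?subr_gt0//. nra.
Qed.

Lemma harm_substitution s (a b : R) : 0 < s -> 0 < a -> a < b -> b < 1 ->
  (\int[mu]_(t in `[moebius a, moebius b]) (((1 + t) `^ s - 1) * kern s t)%:E =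
   \int[mu]_(x in `[a, b]) (((1 - x) `^ (s - 1) - (1 - x) `^ (2 * s - 1))
      * x `^ (- (1 + 2 * s)))%:E)%E.
Proof.
move=> s0 a0 ab b1.
have der (x : R) : x < 1 -> derive1 moebius x = (1 - x) ^- 2.
  by move=> x1; rewrite derive1E (derive_val (is_derive := is_derive_moebius x1)).
have cder (x : R) : x < 1 -> derive1 moebius y @[y --> x] --> derive1 moebius x.
  move=> x1; rewrite der//.
  have : (1 - y) ^- 2 @[y --> x] --> (1 - x) ^- 2.
    under eq_fun do rewrite expr2; rewrite expr2.
    apply: cvgV; first by rewrite mulf_eq0 subr_eq0 gt_eqF.
    by apply: cvgM; apply: cvgB; [exact: cvg_cst|exact: cvg_id|exact: cvg_cst|exact: cvg_id].
  apply: cvg_trans; apply: near_eq_cvg; near=> y; rewrite der//.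
  by near: y; exact: lt_nbhsl.
rewrite (@integration_by_substitution_increasing _ moebius)//.
- apply: eq_integral => x; rewrite inE/= in_itv/= => /andP[ax xb].
  congr EFin; rewrite /= fctE /= der; last lra.
  have x0 : 0 < x by lra.
  have c0 : 0 < 1 - x by lra.
  have -> : 1 + moebius x = (1 - x)^-1 by rewrite /moebius; ring.
  have -> : moebius x = (1 - x)^-1 * x.
    by rewrite /moebius; field; rewrite gt_eqF.
  rewrite kern_scale ?invr_gt0// kernE//.
  set c := 1 - x in c0 *.
  have ci al : c^-1 `^ al = c `^ (- al) by rewrite -powR_inv1 ?ltW// -powRrM mulN1r.
  rewrite !ci opprK.
  have -> : c `^ (1 + 2 * s) = c ^+ 2 * c `^ (2 * s - 1).
    rewrite -powR_mulrn ?ltW// -powRD ?(gt_eqF c0) ?implybT//.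
    by congr powR; lra.
  have -> : c `^ (s - 1) = c `^ (- s) * c `^ (2 * s - 1).
    by rewrite -powRD ?(gt_eqF c0) ?implybT//; congr powR; lra.
  by field; rewrite gt_eqF.
- exact: ltW.
- by move=> x y _; rewrite in_itv/= => /andP[_ yb] xy; apply: moebius_lt; lra.
- by move=> x; rewrite in_itv/= => /andP[_ xb]; apply: cder; lra.
- apply/cvg_ex; exists (derive1 moebius a).
  by apply: cvg_at_right_filter; apply: cder; lra.
- apply/cvg_ex; exists (derive1 moebius b).
  by apply: cvg_at_left_filter; apply: cder; lra.
- split.
  + move=> x; rewrite in_itv/= => /andP[_ xb].
    by apply: (ex_derive (is_derive := is_derive_moebius _)); lra.
  + by apply: cvg_at_right_filter; apply: moebius_cvg; lra.
  + by apply: cvg_at_left_filter; apply: moebius_cvg; lra.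
- apply: continuous_within_itvcc => t /andP[at_ _].
  have t0 : 0 < t by apply: lt_le_trans at_; apply: lt_trans (moebius_gt _ _); lra.
  apply: cvgM.
    apply: cvgB; last exact: cvg_cst.
    apply: (@continuous_comp _ _ _ (fun t => 1 + t) (@powR R ^~ s)).
      by apply: cvgD; [exact: cvg_cst|exact: cvg_id].
    by apply: powR_continuous; lra.
  apply: (@cvg_trans _ ((y `^ (- (1 + 2 * s))) @[y --> t])).
    apply: near_eq_cvg; near=> y; rewrite kernE//; near: y; exact: lt_nbhsr.
  by rewrite kernE//; exact: powR_continuous.
Unshelve. all: by end_near. Qed.

End half_line_profile.

(** * The second sum of t_+^s *)
Section half_line_harmonic.
Context {R : realType}.
Local Notation mu := (@lebesgue_measure R).
Implicit Types (s t y eta : R).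

(** Used in place of a limit: c can be taken small enough to make an error term
    in c^al smaller than e. *)
Lemma exists_powR_le (al c1 e : R) : 0 < al -> 0 < c1 -> 0 < e ->
  exists c, [/\ 0 < c, c <= c1 & c `^ al <= e].
Proof.
move=> al0 c10 e0; exists (Num.min c1 (e `^ al^-1)); split.
- by rewrite lt_min c10 powR_gt0.
- by rewrite ge_min lexx.
- apply: (@le_trans _ _ ((e `^ al^-1) `^ al)).
    apply: ge0_ler_powR; rewrite ?nnegrE ?powR_ge0//; first exact: ltW.
      by rewrite le_min (ltW c10) powR_ge0.
    by rewrite ge_min lexx orbT.
  by rewrite -powRrM mulVf ?gt_eqF// powRr1// ltW.
Qed.

Lemma harm_dens_continuous s (x : R) : 0 < x -> x < 1 ->
  {for x, continuous (harm_dens s)}.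
Proof.
move=> x0 x1.
have cont al : {for x, continuous (fun y : R => (1 - y) `^ al)}.
  apply: differentiable_continuous; apply/derivable1_diffP.
  exact: (ex_derive (is_derive := is_derive_powR_onem al x1)).
apply: cvgM; last exact: powR_continuous.
by apply: cvgD; [apply: cvgB|]; exact: cont.
Qed.

Lemma integral_harm_dens s (a b : R) : 0 < s -> 0 < a -> a < b -> b < 1 ->
  (\int[mu]_(x in `[a, b]) (harm_dens s x)%:E =
   (harm_prim s b - harm_prim s a)%:E)%E.
Proof.
move=> s0 a0 ab b1.
have D (x : R) : 0 < x -> x < 1 -> is_derive x 1 (harm_prim s) (harm_dens s x).
  by move=> x0 x1; exact: is_derive_harm_prim.
have C (x : R) : 0 < x -> x < 1 -> {for x, continuous (harm_prim s)}.
  move=> x0 x1; apply: differentiable_continuous; apply/derivable1_diffP.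
  exact: (ex_derive (is_derive := D _ x0 x1)).
rewrite (@continuous_FTC2 _ _ (harm_prim s)) ?EFinB//.
- by apply: continuous_within_itvcc => t /andP[? ?]; apply: harm_dens_continuous; lra.
- split.
  + move=> t; rewrite in_itv/= => /andP[? ?].
    by apply: (ex_derive (is_derive := D t _ _)); lra.
  + by apply: cvg_at_right_filter; apply: C; lra.
  + by apply: cvg_at_left_filter; apply: C; lra.
- move=> t; rewrite in_itv/= => /andP[? ?]; rewrite derive1E.
  by apply: (derive_val (is_derive := D t _ _)); lra.
Qed.

(** The Moebius substitution brings (1 + t)^s - 1 to the interval on which
    (1 - t)^s lives, and there the two add up to [harm_dens], which has an
    explicit primitive. The inequality comes from dropping nonnegative pieces:
    the image of [eta, b] is only a part of the half-line. *)
Lemma pos_pow_second_sum_ge s eta b : 0 < s -> s < 1 ->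
  0 < eta -> eta < b -> b < 1 ->
  ((eta `^ (- (2 * s)) / (2 * s) + (harm_prim s b - harm_prim s eta))%:E <=
   \int[mu]_(t in `]eta, +oo[)
     ((pos_pow s (1 + t) + pos_pow s (1 - t)) * kern s t)%:E)%E.
Proof.
move=> s0 s1 e0 eb b1.
have m1 : measurable_fun setT (fun t => (pos_pow s (1 + t) * kern s t)%:E).
  by have := measurable_comp_kern s 1 1 (measurable_pos_pow s); under eq_fun do rewrite mul1r.
have m2 : measurable_fun setT (fun t => (pos_pow s (1 - t) * kern s t)%:E).
  by have := measurable_comp_kern s 1 (-1) (measurable_pos_pow s); under eq_fun do rewrite mulN1r.
have p0 t u : (0 <= (pos_pow s t * kern s u)%:E)%E.
  by rewrite lee_fin mulr_ge0 ?kern_ge0 ?pos_pow_ge0.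
under eq_integral do rewrite mulrDl EFinD.
rewrite ge0_integralD//; [|exact: measurable_funTS..].
rewrite EFinD -integral_harm_dens// -integral_kern//.
have m3 : measurable_fun setT (fun t => ((pos_pow s (1 + t) - 1) * kern s t)%:E).
  apply/measurable_EFinP/measurable_funM; last exact: measurable_kern.
  apply: measurable_funB => //; apply: (measurableT_comp (measurable_pos_pow s)).
  exact: measurable_funD.
have ge1 t : 0 <= t -> 0 <= pos_pow s (1 + t) - 1.
  move=> t0; rewrite subr_ge0 pos_powE; last lra.
  apply: (@le_trans _ _ (1 `^ s)); first by rewrite powR1.
  by apply: ge0_ler_powR; rewrite ?nnegrE; lra.
have H1 : (\int[mu]_(t in `]eta, +oo[) (kern s t)%:E +
   \int[mu]_(x in `[eta, b]) (((1 - x) `^ (s - 1) - (1 - x) `^ (2 * s - 1))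
      * x `^ (- (1 + 2 * s)))%:E <=
   \int[mu]_(t in `]eta, +oo[) (pos_pow s (1 + t) * kern s t)%:E)%E.
  rewrite -harm_substitution//.
  have -> : (\int[mu]_(t in `]eta, +oo[) (pos_pow s (1 + t) * kern s t)%:E =
     \int[mu]_(t in `]eta, +oo[) (kern s t)%:E +
     \int[mu]_(t in `]eta, +oo[) ((pos_pow s (1 + t) - 1) * kern s t)%:E)%E.
    rewrite -ge0_integralD//.
    - by apply: eq_integral => t _; rewrite -EFinD; congr EFin; ring.
    - by move=> t _; rewrite lee_fin kern_ge0.
    - by apply: measurable_funTS; exact: measurable_EFin_kern.
    - move=> t /=; rewrite in_itv/= andbT => et.
      by rewrite lee_fin mulr_ge0 ?kern_ge0// ge1//; lra.
    - exact: measurable_funTS.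
  apply: leeD2l.
  have -> : (\int[mu]_(t in `[moebius eta, moebius b])
       (((1 + t) `^ s - 1) * kern s t)%:E = \int[mu]_(t in `[moebius eta, moebius b])
       ((pos_pow s (1 + t) - 1) * kern s t)%:E)%E.
    apply: eq_integral => t; rewrite inE/= in_itv/= => /andP[et _].
    by rewrite pos_powE//; have := @moebius_gt R eta e0 (lt_trans eb b1); lra.
  apply: ge0_subset_integral => //.
  - exact: measurable_funTS.
  - move=> t /=; rewrite in_itv/= andbT => et.
    by rewrite lee_fin mulr_ge0 ?kern_ge0// ge1//; lra.
  - move=> t /=; rewrite !in_itv/= andbT => /andP[et _].
    by apply: lt_le_trans et; apply: moebius_gt; lra.
have H2 : (\int[mu]_(x in `[eta, b]) ((1 - x) `^ s * x `^ (- (1 + 2 * s)))%:E <=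
   \int[mu]_(t in `]eta, +oo[) (pos_pow s (1 - t) * kern s t)%:E)%E.
  have -> : (\int[mu]_(x in `[eta, b]) ((1 - x) `^ s * x `^ (- (1 + 2 * s)))%:E =
     \int[mu]_(t in `[eta, b]) (pos_pow s (1 - t) * kern s t)%:E)%E.
    apply: eq_integral => t; rewrite inE/= in_itv/= => /andP[et tb].
    by rewrite pos_powE ?kernE//; lra.
  rewrite -integral_itv_obnd_cbnd; last exact: measurable_funTS.
  apply: ge0_subset_integral => //.
  - exact: measurable_funTS.
  - by move=> t /=; rewrite !in_itv/= andbT => /andP[et _].
apply: le_trans (leeD H1 H2).
rewrite -[leRHS]addeA leeD2l// -ge0_integralD//.
- rewrite le_eqVlt; apply/orP; left; apply/eqP; apply: eq_integral => t _.
  by rewrite -EFinD -mulrDl.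
- move=> t /=; rewrite in_itv/= => /andP[et tb].
  rewrite lee_fin mulr_ge0 ?powR_ge0// subr_ge0.
  by apply: ger_powR; lra.
- apply/measurable_EFinP/measurable_funTS/measurable_funM; last exact: measurable_powR.
  by apply: measurable_funB; apply: (measurableT_comp (measurable_powR _)); exact: measurable_funB.
- by move=> t _; rewrite lee_fin mulr_ge0 ?powR_ge0.
- apply/measurable_EFinP/measurable_funTS/measurable_funM; last exact: measurable_powR.
  by apply: (measurableT_comp (measurable_powR _)); exact: measurable_funB.
Qed.

End half_line_harmonic.

(** * The power t_+^s as a sub-eigenfunction *)
Section half_line_subeigen.
Context {R : realType}.
Local Notation mu := (@lebesgue_measure R).
Implicit Types (s t y eta : R).

(** Letting b tend to 1 in [pos_pow_second_sum_ge]: harm_prim vanishes at 1, and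
    its value at eta is close to - eta^(-2s) / (2 s). The main term
    eta^(-2s) / s is then 2 int_eta^oo kern, as for an s-harmonic function. *)
Lemma pos_pow_second_sum_ge2 s eta : 0 < s -> s < 1 -> 0 < eta -> eta < 1 ->
  ((eta `^ (- (2 * s)) / s - eta `^ (2 - 2 * s) / (2 * s))%:E <=
   \int[mu]_(t in `]eta, +oo[)
     ((pos_pow s (1 + t) + pos_pow s (1 - t)) * kern s t)%:E)%E.
Proof.
move=> s0 s1 e0 e1; apply/lee_addgt0Pr => e epos.
set P := eta `^ (- (2 * s)).
have P0 : 0 < P by rewrite powR_gt0.
(* b = 1 - c, with c so small that harm_prim s b >= - e. *)
have [c [c0 ce cs]] := @exists_powR_le R s ((1 - eta) / 2) (e * s / P) s0
  (ltac:(lra)) (ltac:(by rewrite divr_gt0// mulr_gt0)).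
have b0 : eta < 1 - c by lra.
have /(le_trans _) := leeD (pos_pow_second_sum_ge s0 s1 e0 b0 (ltac:(lra))) (lexx e%:E).
apply; rewrite -EFinD lee_fin.
have bP : (1 - c) `^ (- (2 * s)) <= P.
  rewrite /P powRN [leRHS]powRN lef_pV2 ?posrE ?powR_gt0//; last lra.
  by apply: ge0_ler_powR; rewrite ?nnegrE; lra.
have hb : - (e) <= harm_prim s (1 - c).
  rewrite /harm_prim subKr.
  have h1 : 0 <= c `^ (2 * s) by exact: powR_ge0.
  have h2 : 0 <= (1 - c) `^ (- (2 * s)) by exact: powR_ge0.
  have h3 : c `^ s * (1 - c) `^ (- (2 * s)) <= e * s.
    apply: (@le_trans _ _ (c `^ s * P)); first by rewrite ler_wpM2l ?powR_ge0.
    by rewrite -ler_pdivlMr.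
  rewrite ler_pdivlMr ?mulr_gt0//.
  have h4 : 0 <= c `^ (2 * s) * (1 - c) `^ (- (2 * s)) by exact: mulr_ge0.
  lra.
have he : harm_prim s eta <= eta `^ (2 - 2 * s) / (2 * s) - P / (2 * s).
  have -> : eta `^ (2 - 2 * s) = eta ^+ 2 * P.
    by rewrite -powR_mulrn ?ltW// -powRD ?(gt_eqF e0) ?implybT.
  rewrite /harm_prim -/P -mulrBl ler_pM2r ?invr_gt0 ?mulr_gt0//.
  rewrite -[in leRHS](mul1r P) mulrA mulr1 -mulrBl ler_pM2r//.
  have h1 : 1 - eta <= (1 - eta) `^ s.
    by apply: ger1_powR; lra.
  have h2 : (1 - eta) `^ s <= 1.
    apply: (@le_trans _ _ (1 `^ s)); last by rewrite powR1.
    by apply: ge0_ler_powR; rewrite ?nnegrE; lra.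
  have -> : (1 - eta) `^ (2 * s) = (1 - eta) `^ s ^+ 2.
    by rewrite -powR_mulrn ?powR_ge0// -powRrM mulrC.
  nra.
have -> : P / s = P / (2 * s) + P / (2 * s) by field; rewrite gt_eqF.
rewrite -/P; lra.
Qed.

(** The bound of [pos_pow_second_sum_ge2] at a height c < eta has an error which
    tends to 0 with c. Coming back from c to eta removes the integral over
    ]c, eta], which is harmless as long as the second sum of t_+^s is at most 2
    there. This fails only if eta >= 1 and (1 + eta)^s > 2, and then the second
    sum is at least 2 on the whole of ]eta, +oo[. *)
Lemma subeigen_pos_pow1 s eta : 0 < s -> s < 1 -> 0 < eta ->
  subeigen_at s (pos_pow s) 0 eta 1.
Proof.
move=> s0 s1 e0; rewrite /subeigen_at mul0r adde0 pos_powE// powR1 mulr1.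
set g := fun t => ((pos_pow s (1 + t) + pos_pow s (1 - t)) * kern s t)%:E.
have mg : measurable_fun setT g.
  by apply: measurable_second_sum; exact: measurable_pos_pow.
have g0 t : (0 <= g t)%E by apply: second_sum_ge0 => y; exact: pos_pow_ge0.
have mk := @measurable_EFin_kern R s.
have k0 t : (0 <= (kern s t)%:E)%E by rewrite lee_fin kern_ge0.
(* For t <= 1, concavity bounds the second sum by 2; for t > 1 only the increasing
   term (1 + t)^s is left. *)
have [big|small] : (1 <= eta /\ 2 <= pos_pow s (1 + eta)) \/
    (forall t, 0 < t -> t <= eta -> pos_pow s (1 + t) + pos_pow s (1 - t) <= 2).
  have [e1|e1] := ltP eta 1.
    by right => t t0 te; apply: second_sum_pos_pow_le2 => //; lra.
  have [h|h] := leP 2 (pos_pow s (1 + eta)); [by left|right => t t0 te].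
  have [t1|t1] := leP t 1; first by apply: second_sum_pos_pow_le2 => //; lra.
  rewrite (@pos_pow_le0 _ _ (1 - t))// ?addr0; last lra.
  by apply: le_trans (ltW h); apply: pos_pow_homo; lra.
- rewrite -ge0_integralZl//; last exact: measurable_funTS.
  apply: ge0_le_integral => //.
  + by move=> t _; rewrite -EFinM lee_fin mulr_ge0 ?kern_ge0.
  + by apply: measurable_funeM; exact: measurable_funTS.
  + exact: measurable_funTS.
  + move=> t /=; rewrite in_itv/= andbT => et.
    rewrite -EFinM lee_fin ler_wpM2r ?kern_ge0//.
    rewrite ler_wpDr ?pos_pow_ge0//; apply: (le_trans big.2).
    by apply: pos_pow_homo; lra.
- apply/lee_addgt0Pr => e epos.
  have [c [c0 ce cs]] := @exists_powR_le R (2 - 2 * s) (Num.min (eta / 2) 2^-1)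
    (e * (2 * s)) (ltac:(lra)) (ltac:(by rewrite lt_min divr_gt0//=)) (ltac:(by rewrite !mulr_gt0)).
  move: ce; rewrite le_min => /andP[ce1 ce2].
  have split_int f : measurable_fun setT f -> (forall t, 0 <= f t)%E ->
     (\int[mu]_(t in `]c, +oo[) f t = \int[mu]_(t in `]c, eta]) f t +
      \int[mu]_(t in `]eta, +oo[) f t)%E.
    by move=> mf f0; apply: ge0_integral_itv_split => //; lra.
  have I1 : (\int[mu]_(t in `]c, eta]) g t <= 2%:E * \int[mu]_(t in `]c, eta]) (kern s t)%:E)%E.
    rewrite -ge0_integralZl//; last exact: measurable_funTS.
    apply: ge0_le_integral => //.
    + exact: measurable_funTS.
    + by apply: measurable_funeM; exact: measurable_funTS.
    + move=> t /=; rewrite in_itv/= => /andP[ct te].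
      by rewrite -EFinM lee_fin ler_wpM2r ?kern_ge0// small//; lra.
  have := @pos_pow_second_sum_ge2 s c s0 s1 c0 (ltac:(lra)).
  rewrite -/(g _) (split_int g)//.
  have K1 := split_int _ mk k0; rewrite (integral_kern s0 c0) in K1.
  have Kfin : (\int[mu]_(t in `]c, eta]) (kern s t)%:E)%E \is a fin_num.
    rewrite ge0_fin_numE ?integral_ge0//.
    apply: (@le_lt_trans _ _ (c `^ (- (2 * s)) / (2 * s))%:E); last exact: ltry.
    by rewrite K1 leeDl// integral_ge0.
  have K2 : (\int[mu]_(t in `]eta, +oo[) (kern s t)%:E)%E \is a fin_num.
    by rewrite integral_kern.
  move: I1 K1; rewrite -(fineK Kfin) -(fineK K2).
  set A := (\int[mu]_(t in `]c, eta]) g t)%E; set B := (\int[mu]_(t in `]eta, +oo[) g t)%E.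
  set k1 := fine _; set k2 := fine _ => I1 [] K1 H.
  have A0 : (0 <= A)%E by exact: integral_ge0.
  have Afin : A \is a fin_num.
    by rewrite ge0_fin_numE//; apply: le_lt_trans I1 _; rewrite -EFinM ltry.
  have B0 : (0 <= B)%E by exact: integral_ge0.
  move: H; rewrite -EFinM; case: B B0 => [r| |//] _; last by rewrite leey.
  move: Afin I1; case: A A0 => [r'| |]// _ _.
  rewrite -EFinM -!EFinD !lee_fin => I1 H.
  have Hc : c `^ (2 - 2 * s) / (2 * s) <= e by rewrite ler_pdivrMr// mulr_gt0.
  have Hk : c `^ (- (2 * s)) / s = 2 * (k1 + k2) by rewrite -K1; field; rewrite gt_eqF.
  lra.
Qed.

(** Homogeneity reduces every y > 0 to y = 1. *)
Lemma subeigen_pos_pow s eta y : 0 < s -> s < 1 -> 0 < eta ->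
  subeigen_at s (pos_pow s) 0 eta y.
Proof.
move=> s0 s1 e0; have [y0|y0] := leP y 0.
  rewrite /subeigen_at pos_pow_le0// !mulr0 mul0e adde0 integral_ge0// => t _.
  by apply: second_sum_ge0 => z; exact: pos_pow_ge0.
have := @subeigen_at_scale R s (pos_pow s) 0 y eta y s0 y0 e0 (@measurable_pos_pow _ s)
  (@pos_pow_ge0 _ s).
rewrite divff ?gt_eqF// mulr0 => /(_ (subeigen_pos_pow1 s0 s1 (divr_gt0 e0 y0))).
move=> /(@subeigen_at_mul _ _ _ _ _ _ (y `^ s) (powR_ge0 _ _)).
have -> : (fun t => y `^ s * pos_pow s (t / y)) = pos_pow s.
  by apply/funext => t; rewrite -pos_pow_scale.
apply.
- apply: (measurableT_comp (measurable_pos_pow s)); exact: mulrr_measurable.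
- by move=> t; exact: pos_pow_ge0.
Qed.
End half_line_subeigen.

(** * A compactly supported profile for the half-line *)
Section profile.
Context {R : realType}.
Local Notation mu := (@lebesgue_measure R).
Implicit Types (s t y eta : R).

(** The height at which the bump around 3 gives back at least the mass 3 / s
    lost by cutting t_+^s: half of it, times the minimum 4^(-3) of the kernel on
    the relevant interval, is 3 / s. *)
Definition bump_height s : R := 384 / s.

(** The power t_+^s cut at t = 3, with the loss compensated by a bump centred at
    the cut. *)
Definition half_profile s t : R :=
  Num.max (if t <= 3 then pos_pow s t else 0) (bump_height s * cos_bump (t - 3)).

Lemma bump_height_ge s : 0 < s -> s < 1 -> 384 <= bump_height s.
Proof. by move=> s0 s1; rewrite /bump_height ler_pdivlMr//; nra. Qed.

Lemma cut_pos_pow_ge0 s t : 0 <= (if t <= 3 then pos_pow s t else 0).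
Proof. by case: ifP => // _; exact: pos_pow_ge0. Qed.

Lemma half_profile_ge0 s t : 0 <= half_profile s t.
Proof. by rewrite le_max cut_pos_pow_ge0. Qed.

Lemma measurable_half_profile s : measurable_fun setT (half_profile s).
Proof.
apply: measurable_maxr.
  apply: measurable_fun_ifT => //; last exact: measurable_pos_pow.
  exact: measurable_fun_ler.
apply: measurable_funM => //; apply: (measurableT_comp measurable_cos_bump).
exact: measurable_funB.
Qed.

Lemma half_profile_le s t : 0 < s -> s < 1 ->
  half_profile s t <= bump_height s * pos_pow s t.
Proof.
move=> s0 s1; have A1 := bump_height_ge s0 s1.
have w0 := pos_pow_ge0 s t.
rewrite ge_max; apply/andP; split.
  by case: ifP => _; nra.
have [t1|t1] := ltP t 1.
  rewrite cos_bump_out; first by rewrite mulr0 mulr_ge0//; lra.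
  by rewrite ltr0_norm; lra.
rewrite ler_wpM2l//; first lra.
apply: le_trans (cos_bump_le1 _) _.
rewrite -[leLHS](_ : pos_pow s 1 = 1); last by rewrite pos_powE// powR1.
by apply: pos_pow_homo; lra.
Qed.

Lemma half_profile_out s t : 5 < t -> half_profile s t = 0.
Proof.
move=> t5; rewrite /half_profile cos_bump_out ?mulr0; last by rewrite ger0_norm; lra.
by rewrite leNgt (_ : 3 < t) ?maxxx//; lra.
Qed.

Lemma half_profile_le0 s t : 0 < s -> s < 1 -> t <= 0 -> half_profile s t = 0.
Proof.
move=> s0 s1 t0; apply/eqP; rewrite eq_le half_profile_ge0 andbT.
by apply: le_trans (half_profile_le _ s0 s1) _; rewrite pos_pow_le0// mulr0.
Qed.

Lemma half_profile_small s t : t < 1 -> half_profile s t = pos_pow s t.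
Proof.
move=> t1; rewrite /half_profile cos_bump_out ?mulr0; last by rewrite ltr0_norm; lra.
by rewrite (_ : t <= 3) ?max_l ?pos_pow_ge0//; lra.
Qed.

Lemma subeigen_at_shift s (chi : R -> R) lam eta y c :
  subeigen_at s chi lam eta (y - c) ->
  subeigen_at s (fun t => chi (t - c)) lam eta y.
Proof.
rewrite /subeigen_at => /le_trans; apply; rewrite leeD2r// le_eqVlt; apply/orP; left.
apply/eqP; apply: eq_integral => t _.
by rewrite (addrAC y) (addrAC y (- t)).
Qed.

Lemma cos_bump_half t : `|t| <= 1 -> 1 / 2 <= cos_bump t.
Proof.
move=> t1; rewrite /cos_bump ifT; last by rewrite (le_trans t1)// pihalf_ge1.
have := one_sub_cos_le (normr_ge0 t); rewrite cos_norm.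
have : `|t| ^+ 2 <= 1 by rewrite expr_le1.
lra.
Qed.

(** For t >= T >= 1 and y <= 2 one has y + t <= 3 t. *)
Lemma far_pos_pow_le s (T : R) : 0 < s -> s < 1 -> 1 <= T ->
  forall y, 0 <= y -> y <= 2 ->
  (\int[mu]_(t in `]T, +oo[) (pos_pow s (y + t) * kern s t)%:E <= (3 / s)%:E)%E.
Proof.
move=> s0 s1 T1 y y0 y2.
apply: (@le_trans _ _ (\int[mu]_(t in `]T, +oo[) (3%:E * (t `^ (- (1 + s)))%:E))%E).
  apply: ge0_le_integral => //.
  - by move=> t _; rewrite lee_fin mulr_ge0 ?kern_ge0 ?pos_pow_ge0.
  - apply: measurable_funTS; have := @measurable_comp_kern _ s (pos_pow s) y 1 (@measurable_pos_pow _ s).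
    by under eq_fun do rewrite mul1r.
  - apply: measurable_funTS; apply: measurable_funeM; apply/measurable_EFinP.
    exact: measurable_powR.
  - move=> t /=; rewrite in_itv/= andbT => Tt.
    have t0 : 0 < t by lra.
    rewrite -EFinM lee_fin pos_powE; last lra.
    have -> : t `^ (- (1 + s)) = t `^ s * kern s t.
      rewrite kernE// -powRD ?(gt_eqF t0) ?implybT//; congr powR; lra.
    rewrite mulrA ler_wpM2r ?kern_ge0//.
    apply: (@le_trans _ _ ((3 * t) `^ s)).
      by apply: ge0_ler_powR; rewrite ?nnegrE; lra.
    rewrite powRM//; last lra.
    by rewrite ler_wpM2r ?powR_ge0// ler1_powR; lra.
rewrite ge0_integralZl//; last 2 first.
- by apply: measurable_funTS; apply/measurable_EFinP; exact: measurable_powR.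
- by move=> t _; rewrite lee_fin powR_ge0.
rewrite integral_powRy//; last lra.
rewrite -EFinM lee_fin ler_wpM2l//.
rewrite -[leRHS]mul1r; apply: ler_wpM2r; first by rewrite invr_ge0 ltW.
rewrite powRN invf_le1 ?powR_gt0//; last lra.
rewrite -(_ : 1 `^ s = 1); last by rewrite powR1.
by apply: ge0_ler_powR; rewrite ?nnegrE; lra.
Qed.

(** On an interval of length 1 contained in [1, 4] the kernel is at least
    4^(-(1 + 2s)) >= 1 / 64. *)
Lemma bump_mass_ge s (T : R) : 0 < s -> s < 1 -> 1 <= T -> T <= 3 ->
  ((3 / s)%:E <=
   \int[mu]_(t in `]T, (T + 1)%R]) ((bump_height s / 2) * kern s t)%:E)%E.
Proof.
move=> s0 s1 T1 T3.
have -> : 3 / s = bump_height s / 2 * (1 / 64).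
  by rewrite /bump_height; field; rewrite gt_eqF.
set C := bump_height s / 2 * (1 / 64).
have -> : C%:E = (\int[mu]_(t in `]T, (T + 1)%R]) C%:E)%E.
  rewrite integral_cst//= lebesgue_measure_itv/= lte_fin ltrDl ltr01.
  by rewrite -EFinB addrC addKr mule1.
have A := bump_height_ge s0 s1.
apply: ge0_le_integral => //.
- by move=> t _; rewrite lee_fin /C; lra.
- by apply: measurable_funTS; apply/measurable_EFinP/measurable_funM => //; exact: measurable_kern.
- move=> t /=; rewrite in_itv/= => /andP[Tt tT].
  rewrite lee_fin ler_wpM2l//; first lra.
  have t0 : 0 < t by lra.
  rewrite /kern gtr0_norm// div1r lef_pV2 ?posrE ?powR_gt0//.
  apply: (@le_trans _ _ (4 `^ (1 + 2 * s))).
    by apply: ge0_ler_powR; rewrite ?nnegrE; lra.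
  apply: (@le_trans _ _ (4 `^ 3%:R)).
    by apply: ler_powR; lra.
  by rewrite powR_mulrn//; lra.
Qed.

(** Where the bump realizes the maximum, its own inequality applies. Elsewhere
    y < 2, because on [2, 3] the bump is at least 192 / s and exceeds t_+^s; the
    comparison with t_+^s can then fail only at the points y + t > 3, and the
    integral lost there is smaller than what the bump contributes on
    ]3, 4]. *)
Lemma subeigen_half_profile s eta y : 0 < s -> s < 1 -> 0 < eta -> eta <= 1 ->
  subeigen_at s (half_profile s) (eigen_cst s) eta y.
Proof.
move=> s0 s1 e0 e1.
have A := bump_height_ge s0 s1.
have A0 : 0 <= bump_height s by lra.
have mcb : measurable_fun setT (fun t : R => cos_bump (t - 3)).
  by apply: (measurableT_comp measurable_cos_bump); exact: measurable_funB.
have [h|h] := leP (if y <= 3 then pos_pow s y else 0) (bump_height s * cos_bump (y - 3)).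
  apply: (@subeigen_at_le _ _ _ (fun t => bump_height s * cos_bump (t - 3))).
  - exact: eigen_cst_ge0.
  - exact: measurable_half_profile.
  - exact: measurable_funM.
  - by move=> t; rewrite mulr_ge0// cos_bump_ge0.
  - by move=> t; rewrite /half_profile le_max lexx orbT.
  - by rewrite /half_profile max_r.
  - apply: (@subeigen_at_mul _ _ (fun t => cos_bump (t - 3))) => //.
      by move=> t; exact: cos_bump_ge0.
    by apply: (@subeigen_at_shift _ cos_bump); exact: subeigen_cos_bump.
have b0 : 0 <= bump_height s * cos_bump (y - 3) by rewrite mulr_ge0 ?cos_bump_ge0.
have y3 : y <= 3 by move: h; case: ifP => // _; lra.
rewrite y3 in h.
have y0 : 0 < y.
  by rewrite ltNge; apply/negP => y0; move: h; rewrite pos_pow_le0//; lra.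
(* On [2, 3] the bump would win: it is at least 384 / (2 s), and y^s <= 3. *)
have y2 : y < 2.
  rewrite ltNge; apply/negP => y2; move: h; rewrite ltNge => /negP; apply.
  have : 1 / 2 <= cos_bump (y - 3) by apply: cos_bump_half; rewrite ler_norml; lra.
  have : pos_pow s y <= 3.
    rewrite pos_powE; last lra.
    apply: (@le_trans _ _ (3 `^ s)); first by apply: ge0_ler_powR; rewrite ?nnegrE; lra.
    by apply: ler1_powR; lra.
  nra.
have chiy : half_profile s y = pos_pow s y by rewrite /half_profile y3 max_l// ltW.
rewrite /subeigen_at chiy.
apply: (@le_trans _ _ (\int[mu]_(t in `]eta, +oo[)
     ((half_profile s (y + t) + half_profile s (y - t)) * kern s t)%:E)%E); last first.
  by rewrite leeDl// lee_fin mulr_ge0 ?pos_pow_ge0 ?eigen_cst_ge0.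
have := subeigen_pos_pow y s0 s1 e0; rewrite /subeigen_at mul0r adde0 => /le_trans; apply.
have mw := @measurable_comp_kern _ s (pos_pow s) y _ (@measurable_pos_pow _ s).
have mp := @measurable_comp_kern _ s (half_profile s) y _ (@measurable_half_profile s).
have w0 z t : (0 <= (pos_pow s z * kern s t)%:E)%E.
  by rewrite lee_fin mulr_ge0 ?kern_ge0 ?pos_pow_ge0.
have p0 z t : (0 <= (half_profile s z * kern s t)%:E)%E.
  by rewrite lee_fin mulr_ge0 ?kern_ge0 ?half_profile_ge0.
have := mw 1; under eq_fun do rewrite mul1r; move=> mw1.
have := mw (-1); under eq_fun do rewrite mulN1r; move=> mw2.
have := mp 1; under eq_fun do rewrite mul1r; move=> mp1.
have := mp (-1); under eq_fun do rewrite mulN1r; move=> mp2.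
under eq_integral do rewrite mulrDl EFinD.
under [X in (_ <= X)%E]eq_integral do rewrite mulrDl EFinD.
rewrite !ge0_integralD//; [|exact: measurable_funTS..].
have le_near t : y + t <= 3 -> pos_pow s (y + t) <= half_profile s (y + t).
  by move=> yt; rewrite /half_profile yt le_max lexx.
apply: leeD; last first.
  apply: ge0_le_integral => //; [exact: measurable_funTS..|].
  move=> t /=; rewrite in_itv/= andbT => et.
  rewrite lee_fin ler_wpM2r ?kern_ge0//.
  by rewrite /half_profile (_ : y - t <= 3) ?le_max ?lexx//; lra.
have split_int f : measurable_fun setT f -> (forall t, 0 <= f t)%E ->
   (\int[mu]_(t in `]eta, +oo[) f t = \int[mu]_(t in `]eta, (3 - y)%R]) f t +
    \int[mu]_(t in `](3 - y)%R, +oo[) f t)%E.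
  by move=> mf f0; apply: ge0_integral_itv_split => //; lra.
rewrite !split_int//; apply: leeD.
  apply: ge0_le_integral => //; [exact: measurable_funTS..|].
  move=> t /=; rewrite in_itv/= => /andP[et t3].
  by rewrite lee_fin ler_wpM2r ?kern_ge0// le_near//; lra.
(* The tail of t_+^s beyond the cut against the bump on the next unit interval. *)
apply: le_trans (far_pos_pow_le s0 s1 _ (ltW y0) (ltW y2)) _; first lra.
apply: le_trans (@bump_mass_ge s (3 - y) s0 s1 _ _) _; [lra|lra|].
apply: (@le_trans _ _ (\int[mu]_(t in `](3 - y)%R, (3 - y + 1)%R])
   (half_profile s (y + t) * kern s t)%:E)%E).
  apply: ge0_le_integral => //.
  - by move=> t _; rewrite lee_fin mulr_ge0 ?kern_ge0//; lra.
  - apply: measurable_funTS; apply/measurable_EFinP/measurable_funM => //.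
    exact: measurable_kern.
  - exact: measurable_funTS.
  - move=> t /=; rewrite in_itv/= => /andP[a b].
    rewrite lee_fin ler_wpM2r ?kern_ge0// /half_profile le_max; apply/orP; right.
    rewrite ler_wpM2l// -[leLHS]div1r cos_bump_half// ler_norml; lra.
apply: ge0_subset_integral => //.
- exact: measurable_funTS.
- by move=> t /=; rewrite !in_itv/= andbT => /andP[].
Qed.
End profile.

(** * Translations and Tonelli in R^N *)
Section tuple_shift.
Context {R : realType}.
Local Notation mu := (@lebesgue_measure R).
Local Notation T := (measurableTypeR R).
Local Notation lam N := (@lebesgue_tuple R N).

Definition tshift (N : nat) (i : 'I_N) (t : R) (x : N.-tuple T) : N.-tuple T :=
  [tuple tnth x j + (if j == i then t else 0) | j < N].

Lemma tnth_tshift (N : nat) (i j : 'I_N) (t : R) (x : N.-tuple T) :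
  tnth (tshift i t x) j = tnth x j + (if j == i then t else 0).
Proof. by rewrite tnth_mktuple. Qed.

Lemma tshiftK (N : nat) (i : 'I_N) (t : R) : cancel (tshift i t) (tshift i (- t)).
Proof.
move=> x; apply: eq_from_tnth => j; rewrite !tnth_tshift.
by case: ifP => _; rewrite ?addrK// !addr0.
Qed.

Lemma row_of_tshift (n : nat) (i : 'I_n.+1) (t : R) (x : n.+1.-tuple T) :
  row_of_tuple (tshift i t x) = row_of_tuple x + t *: Defs.basis i.
Proof.
apply/rowP => j; rewrite !mxE tnth_tshift eqxx/=.
by case: ifP => _; rewrite ?mulr1 ?mulr0.
Qed.

Lemma measurable_tshift2 (N : nat) (i : 'I_N) (c : R) :
  measurable_fun setT (fun q : T * N.-tuple T => tshift i (c * q.1) q.2).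
Proof.
apply/measurable_fun_tnthP => j.
rewrite (_ : _ \o _ = fun q : T * N.-tuple T =>
   (tnth q.2 j : R) + (if j == i then c * q.1 else 0)); last first.
  by apply/funext => q /=; rewrite tnth_tshift.
apply: measurable_funD.
  apply: (@measurableT_comp _ _ _ _ _ _ (fun x : N.-tuple T => tnth x j)) => //.
  exact: measurable_tnth.
case: (j == i) => //; exact: measurable_funM.
Qed.

Lemma measurable_tshift (N : nat) (i : 'I_N) (t : R) :
  measurable_fun setT (@tshift N i t).
Proof.
apply/measurable_fun_tnthP => j.
rewrite (_ : _ \o _ = fun x : N.-tuple T =>
   (tnth x j : R) + (if j == i then t else 0)); last first.
  by apply/funext => q /=; rewrite tnth_tshift.
by apply: measurable_funD => //; exact: measurable_tnth.
Qed.

Lemma tshift_cons0 (N : nat) (t a : R) (x : N.-tuple T) :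
  tshift ord0 t [tuple of a :: x] = [tuple of (a + t) :: x].
Proof.
apply: eq_from_tnth => j; rewrite tnth_tshift.
case: (unliftP ord0 j) => [k ->|->]; last by rewrite !tnth0.
by rewrite !tnthS eq_sym (negbTE (neq_lift _ _)) addr0.
Qed.

Lemma tshift_consS (N : nat) (i : 'I_N) (t a : R) (x : N.-tuple T) :
  tshift (lift ord0 i) t [tuple of a :: x] = [tuple of a :: tshift i t x].
Proof.
apply: eq_from_tnth => j; rewrite tnth_tshift.
case: (unliftP ord0 j) => [k ->|->]; last by rewrite !tnth0 (negbTE (neq_lift _ _)) addr0.
by rewrite !tnthS tnth_tshift (inj_eq lift_inj).
Qed.

Local Open Scope ereal_scope.

Lemma integral_lebesgue_tupleS (N : nat) (f : N.+1.-tuple T -> \bar R) :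
  measurable_fun setT f -> (forall x, 0 <= f x) ->
  \int[lam N.+1]_x f x = \int[mu]_a \int[lam N]_x f [tuple of a :: x].
Proof.
move=> mf f0.
have mc := @measurable_cons_pair _ T N.
transitivity (\int[mu \x lam N]_q (f \o @cons_pair _ T N) q).
  have := @ge0_integral_pushforward _ _ _ _ _ _ mc (mu \x lam N) setT f measurableT mf
    (fun y _ => f0 y).
  by rewrite preimage_setT.
rewrite fubini_tonelli1//; first exact: (measurableT_comp mf).
by move=> q; exact: f0.
Qed.

Lemma measurable_cons_tuple (N : nat) (f : N.+1.-tuple T -> \bar R) :
  measurable_fun setT f ->
  measurable_fun setT (fun q : T * N.-tuple T => f [tuple of q.1 :: q.2]).
Proof.
by move=> mf; apply: (measurableT_comp mf); exact: measurable_cons_pair.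
Qed.

Lemma integral_tshift (N : nat) (i : 'I_N) (t : R) (f : N.-tuple T -> \bar R) :
  measurable_fun setT f -> (forall x, 0 <= f x) ->
  \int[lam N]_x f (tshift i t x) = \int[lam N]_x f x.
Proof.
elim: N i f => [[]//|N IH] i f mf f0.
rewrite integral_lebesgue_tupleS//; last first.
  by apply: (measurableT_comp mf); exact: measurable_tshift.
apply: (etrans _ (esym (integral_lebesgue_tupleS mf f0))).
have mf2 := measurable_cons_tuple mf.
case: (unliftP ord0 i) => [k ->|->].
  apply: eq_integral => a _.
  rewrite -(IH k (fun x => f [tuple of a :: x]))//.
    by apply: eq_integral => x _; rewrite tshift_consS.
  exact: (measurable_fun_pair2 a mf2).
have mG := @measurable_fun_fubini_tonelli_F _ _ _ _ R (lam N) _ mf2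
  (fun q => f0 _).
rewrite [RHS](@ge0_integral_affine _ 1 t)//; last first.
  by move=> a; apply: integral_ge0.
rewrite mul1e; apply: eq_integral => a _; apply: eq_integral => x _.
by rewrite mul1r tshift_cons0.
Qed.

(** Tonelli, followed for each t by the translation x -> x - c t e_i. *)
Lemma integral_kernel_sym (N : nat) (i : 'I_N) (c : R) (D : set R) (k : R -> \bar R)
    (f g : N.-tuple T -> \bar R) : measurable D ->
  measurable_fun setT k -> (forall t, 0 <= k t) ->
  measurable_fun setT f -> (forall x, 0 <= f x) ->
  measurable_fun setT g -> (forall x, 0 <= g x) ->
  \int[lam N]_x (f x * \int[mu]_(t in D) (k t * g (tshift i (c * t) x))) =
  \int[lam N]_x (g x * \int[mu]_(t in D) (k t * f (tshift i (- (c * t)) x))).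
Proof.
move=> mD mk k0 mf f0 mg g0.
have mkx : measurable_fun setT (fun q : N.-tuple T * T => k q.2).
  exact: measurableT_comp.
have swapm (d : R) (h : N.-tuple T -> \bar R) : measurable_fun setT h ->
    measurable_fun setT (fun q : N.-tuple T * T => h (tshift i (d * q.2) q.1)).
  move=> mh; apply: (measurableT_comp mh).
  exact: (measurableT_comp (@measurable_tshift2 N i d) (@measurable_swap _ _ _ _)).
have key (d : R) (f' g' : N.-tuple T -> \bar R) :
   measurable_fun setT f' -> (forall x, 0 <= f' x) ->
   measurable_fun setT g' -> (forall x, 0 <= g' x) ->
   \int[lam N]_x (f' x * \int[mu]_(t in D) (k t * g' (tshift i (d * t) x))) =
   \int[mu]_(t in D) (k t * \int[lam N]_x (f' x * g' (tshift i (d * t) x))).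
  move=> mf' f'0 mg' g'0.
  have mF : measurable_fun setT (fun q : N.-tuple T * T =>
      f' q.1 * (k q.2 * g' (tshift i (d * q.2) q.1))).
    apply: emeasurable_funM; first exact: measurableT_comp.
    by apply: emeasurable_funM => //; exact: swapm.
  have mF2 : measurable_fun setT (fun q : N.-tuple T * T =>
      (f' q.1 * (k q.2 * g' (tshift i (d * q.2) q.1))) * (\1_D q.2)%:E).
    apply: emeasurable_funM => //; apply/measurable_EFinP.
    apply: (measurableT_comp (measurable_indic _)) => //.
  have ind0 (t : T) : 0 <= (\1_D t)%:E :> \bar R by rewrite lee_fin.
  transitivity (\int[lam N]_x \int[mu]_t
      ((f' x * (k t * g' (tshift i (d * t) x))) * (\1_D t)%:E)).
    apply: eq_integral => x _.
    rewrite -ge0_integralZl//; last 2 first.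
    - apply: measurable_funTS.
      exact: (measurable_fun_pair2 x (emeasurable_funM mkx (swapm d _ mg'))).
    - by move=> t _; rewrite mule_ge0.
    rewrite [LHS]integral_mkcond.
    apply: eq_integral => t _; rewrite patchE indicE.
    by case: ifP => _; rewrite ?mule1 ?mule0.
  rewrite (fubini_tonelli (fun q : N.-tuple T * T =>
      (f' q.1 * (k q.2 * g' (tshift i (d * q.2) q.1))) * (\1_D q.2)%:E))//; last first.
    by move=> q; rewrite !mule_ge0.
  rewrite [RHS]integral_mkcond; apply: eq_integral => t _.
  rewrite patchE; under eq_integral do rewrite /= indicE.
  case: ifP => _ /=.
    rewrite -ge0_integralZl//.
    - by apply: eq_integral => x _; rewrite mule1 muleCA.
    - apply: emeasurable_funM => //; apply: (measurableT_comp mg').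
      exact: measurable_tshift.
    - by move=> x _; rewrite mule_ge0.
  by under eq_integral do rewrite mule0; rewrite integral0.
apply: (etrans (key c f g mf f0 mg g0)).
have -> : \int[lam N]_x (g x * \int[mu]_(t in D) (k t * f (tshift i (- (c * t)) x))) =
   \int[lam N]_x (g x * \int[mu]_(t in D) (k t * f (tshift i (- c * t) x))).
  apply: eq_integral => x _; congr (_ * _); apply: eq_integral => t _.
  by rewrite mulNr.
apply: (etrans _ (esym (key (- c)%R g f mg g0 mf f0))).
apply: eq_integral => t _; congr (_ * _).
rewrite -(@integral_tshift N i (c * t) (fun x => g x * f (tshift i (- c * t) x))).
- by apply: eq_integral => x _; rewrite mulNr tshiftK muleC.
- apply: emeasurable_funM => //; apply: (measurableT_comp mf).
  exact: measurable_tshift.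
- by move=> x; rewrite mule_ge0.
Qed.

Lemma integral_prod_tuple (N : nat) (f : 'I_N -> R -> R) (c : 'I_N -> R) :
  (forall i, measurable_fun setT (f i)) -> (forall i t, (0 <= f i t)%R) ->
  (forall i, \int[mu]_t (f i t)%:E = (c i)%:E) ->
  \int[lam N]_x (\prod_(i < N) f i (tnth x i))%:E = (\prod_(i < N) c i)%:E.
Proof.
have mprod M (g : 'I_M -> R -> R) : (forall i, measurable_fun setT (g i)) ->
    measurable_fun setT (fun x : M.-tuple T => (\prod_(i < M) g i (tnth x i))%:E).
  move=> mg; apply/measurable_EFinP; apply: measurable_prod => i _.
  by apply: (measurableT_comp (mg i)); exact: measurable_tnth.
elim: N f c => [|N IH] f c mf f0 fc.
  rewrite [RHS](_ : _ = 1); last by rewrite big_ord0.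
  under eq_integral do rewrite big_ord0.
  rewrite integral_cst//= mul1e /lebesgue_tuple/= diracT//.
rewrite integral_lebesgue_tupleS//; last 2 first.
- exact: mprod.
- by move=> x; rewrite lee_fin prodr_ge0.
have E a : \int[lam N]_x (\prod_(i < N.+1) f i (tnth [tuple of a :: x] i))%:E =
    (f ord0 a)%:E * \int[lam N]_x (\prod_(i < N) f (lift ord0 i) (tnth x i))%:E.
  rewrite -ge0_integralZl//.
  - apply: eq_integral => x _; rewrite big_ord_recl tnth0 EFinM; congr (_ * _%:E).
    by apply: eq_bigr => i _; rewrite tnthS.
  - exact: (mprod _ (fun i => f (lift ord0 i))).
  - by move=> x _; rewrite lee_fin prodr_ge0.
  - by rewrite lee_fin.
under eq_integral do rewrite E.
rewrite (IH (fun i => f (lift ord0 i)) (fun i => c (lift ord0 i)))//.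
rewrite ge0_integralZr//; last 3 first.
- by apply/measurable_EFinP; exact: mf.
- by move=> a _; rewrite lee_fin.
- rewrite lee_fin; apply: prodr_ge0 => i _; rewrite -lee_fin -fc.
  by apply: integral_ge0 => t _; rewrite lee_fin.
by rewrite fc big_ord_recl EFinM.
Qed.
End tuple_shift.

(** * Integrals against the completed Lebesgue measure *)
Section transfer.
Local Open Scope ereal_scope.
Context {R : realType}.

Lemma integral_ae_transfer d1 d2 (T1 : measurableType d1) (T2 : measurableType d2)
    (m1 : {measure set T1 -> \bar R}) (m2 : {measure set T2 -> \bar R})
    (phi : T1 -> T2) (F : T1 -> \bar R) (h : T2 -> \bar R) :
  measurable_fun setT phi ->
  (forall A, measurable A -> m1 (phi @^-1` A) = m2 A) ->
  measurable_fun setT h -> m1.-integrable setT F ->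
  {ae m1, forall x, F x = h (phi x)} ->
  m2.-integrable setT h /\ \int[m1]_x F x = \int[m2]_x h x.
Proof.
move=> mphi m12 mh intF Fh.
have mF := measurable_int _ intF.
have mhphi : measurable_fun setT (h \o phi) by exact: measurableT_comp.
have aeF : ae_eq m1 setT F (h \o phi).
  by apply: filterS Fh => x H _.
have int_hphi : m1.-integrable setT (h \o phi).
  apply/integrableP; split => //.
  move/integrableP : intF => [_]; apply: le_lt_trans.
  rewrite le_eqVlt; apply/orP; left; apply/eqP; apply/esym.
  apply: ge0_ae_eq_integral => //; [exact: measurableT_comp..|].
  by apply: filterS Fh => x H _ /=; rewrite H.
have m2E f : \int[pushforward m1 phi]_x f x = \int[m2]_x f x.
  by apply: eq_measure_integral => A mA _; exact: m12.
split.
  have /integrableP[_] := integrable_pushforward mphi mh int_hphi measurableT.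
  by rewrite m2E => H; apply/integrableP.
rewrite (ae_eq_integral (h \o phi))//.
by rewrite -m2E (integral_pushforward mphi mh int_hphi).
Qed.

Local Notation mu := (@lebesgue_measure R).
Local Notation T := (measurableTypeR R).
Local Notation cmu := (@completed_lebesgue_measure R).

(** The identity map from the completed space to the Borel space preserves the
    measure, and F only has to agree with a Borel function off a null set. *)
Lemma integral_completed_transfer (F h : R -> R) (Z : set R) :
  measurable_fun setT h -> measurable Z -> mu Z = 0 ->
  (forall t, ~ Z t -> F t = h t) ->
  cmu.-integrable setT (EFin \o F) ->
  mu.-integrable setT (EFin \o h) /\
  \int[cmu]_t (F t)%:E = \int[mu]_t (h t)%:E.
Proof.
move=> mh mZ Z0 FhZ intF.
apply: (@integral_ae_transfer _ _ _ _ cmu mu id (EFin \o F) (EFin \o h)).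
- by move=> _ A mA; rewrite setTI; exact: sub_caratheodory.
- move=> A mA; exact: erefl.
- by apply/measurable_EFinP.
- exact: intF.
- exists Z; split; [exact: sub_caratheodory|exact: Z0|].
  by move=> t /= H; apply: contrapT => nZ; apply: H; rewrite FhZ.
Qed.
End transfer.

(** * Functions on lines *)
Section lines.
Context {R : realType}.
Local Notation mu := (@lebesgue_measure R).
Local Notation T := (measurableTypeR R).
Local Notation lam N := (@lebesgue_tuple R N).
Local Open Scope ereal_scope.

Lemma measurable_tshift_line (N : nat) (i : 'I_N) (c : R) (x : N.-tuple T) :
  measurable_fun setT (fun t : T => tshift i (c * t) x).
Proof.
exact: (measurable_fun_pair1 x (@measurable_tshift2 R N i c)).
Qed.

(** Applying [integral_kernel_sym] to 1 and to the indicator of Z: the measures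
    of the sections of a null set along the lines have integral 0. *)
Lemma ae_line (N : nat) (i : 'I_N) (c : R) (Z : set (N.-tuple T)) :
  measurable Z -> lam N Z = 0 ->
  {ae lam N, forall x, mu [set t | Z (tshift i (c * t) x)] = 0}.
Proof.
move=> mZ Z0.
have mIZ : measurable_fun setT (fun x : N.-tuple T => (\1_Z x)%:E : \bar R).
  by apply/measurable_EFinP.
have IZ0 (x : N.-tuple T) : 0 <= (\1_Z x)%:E :> \bar R by rewrite lee_fin.
pose G (x : N.-tuple T) : \bar R := \int[mu]_(t in setT) (cst 1 t * (\1_Z (tshift i (c * t) x))%:E).
have GE x : G x = mu [set t | Z (tshift i (c * t) x)].
  have mE : measurable [set t : T | Z (tshift i (c * t) x)].
    by have := measurable_tshift_line i c x measurableT mZ; rewrite setTI.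
  transitivity (\int[mu]_t (\1_[set t | Z (tshift i (c * t) x)] t)%:E).
    by apply: eq_integral => t _; rewrite mul1e.
  by rewrite integral_indic// setIT.
have := @integral_kernel_sym R N i c setT (cst 1) (cst 1) (fun x => (\1_Z x)%:E)
  measurableT (measurable_cst _) (fun=> lee01) (measurable_cst _) (fun=> lee01) mIZ IZ0.
under eq_integral do rewrite mul1e -/(G _).
rewrite [X in _ = X -> _](_ : _ = 0); last first.
  transitivity (\int[lam N]_x ((\1_Z x)%:E * \int[mu]_t (cst 1 t))).
    apply: eq_integral => x _; congr (_ * _); apply: eq_integral => t _.
    by rewrite mule1.
  rewrite ge0_integralZr//; last by apply: integral_ge0.
  by rewrite integral_indic// setIT [X in X * _]Z0 mul0e.
have mG : measurable_fun setT G.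
  have mF : measurable_fun setT (fun q : N.-tuple T * T =>
      cst 1 q.2 * (\1_Z (tshift i (c * q.2) q.1))%:E : \bar R).
    apply: emeasurable_funM => //; apply: (measurableT_comp mIZ).
    exact: (measurableT_comp (@measurable_tshift2 R N i c) (@measurable_swap _ _ _ _)).
  apply: (measurable_fun_fubini_tonelli_F _ mF) => q.
  by rewrite mule_ge0// lee_fin.
have G0 x : 0 <= G x by apply: integral_ge0 => t _; rewrite mule_ge0.
move=> H; have : ae_eq (lam N) setT G (cst 0).
  apply/(ae_eq_integral_abs _ measurableT mG).
  by rewrite -[RHS]H; apply: eq_integral => x _; rewrite gee0_abs.
by apply: filterS => x /(_ I); rewrite GE.
Qed.

Lemma ge0_integral_even (f : R -> \bar R) :
  measurable_fun setT f -> (forall t, 0 <= f t) -> (forall t, f (- t)%R = f t) ->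
  \int[mu]_t f t = 2%:E * \int[mu]_(t in `]0%R, +oo[) f t.
Proof.
move=> mf f0 fe.
have mfD (D : set T) : measurable_fun D f by exact: measurable_funTS.
have -> : [set: R] = `]-oo, 0%R[ `|` `[0%R, +oo[.
  by rewrite -itv_bndbnd_setU//= set_itvE.
rewrite ge0_integral_setU//=; last first.
  apply/disj_setPS => t [] /=; rewrite !in_itv/= andbT => a b.
  by move: (lt_le_trans a b); rewrite ltxx.
rewrite -[X in _ + X]integral_itv_obnd_cbnd; last exact: mfD.
have -> : \int[mu]_(t in `]-oo, 0%R[) f t = \int[mu]_(t in `]0%R, +oo[) f t.
  rewrite [LHS]integral_mkcond [LHS]ge0_integral_opp.
  - rewrite [RHS]integral_mkcond; apply: eq_integral => t _.
    by rewrite !patchE !mem_setE !in_itv/= andbT oppr_lt0 fe.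
  - exact: measurable_patch.
  - by move=> t; apply: erestrict_ge0.
by rewrite mule_natl mule2n.
Qed.

Lemma integral_even (h : R -> R) :
  mu.-integrable setT (EFin \o h) -> (forall t, h (- t) = h t)%R ->
  \int[mu]_t (h t)%:E = 2%:E * \int[mu]_(t in `]0%R, +oo[) (h t)%:E.
Proof.
move=> ih he; have mh := measurable_int _ ih.
have mhE : measurable_fun setT (fun t => (h t)%:E) by [].
have ih' : mu.-integrable `]0%R, +oo[ (EFin \o h).
  exact: (integrableS measurableT).
set D := `]0%R, +oo[%classic.
have E1 : \int[mu]_t (EFin \o h)^\+ t = 2%:E * \int[mu]_(t in D) (EFin \o h)^\+ t.
  apply: ge0_integral_even => //; first exact: measurable_funepos.
  by move=> t; rewrite !funeposE /= he.
have E2 : \int[mu]_t (EFin \o h)^\- t = 2%:E * \int[mu]_(t in D) (EFin \o h)^\- t.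
  apply: ge0_integral_even => //; first exact: measurable_funeneg.
  by move=> t; rewrite !funenegE /= he.
rewrite integralE E1 E2 [in RHS]integralE -muleBr//.
apply: fin_num_adde_defl; rewrite fin_numN.
exact: (integrable_neg_fin_num _ ih').
Qed.

(** The integrand (a - c) kern over |t| <= eta is bounded below by the parabola
    - M t^2 kern, so the part over |t| > eta is at most the whole integral plus
    the integral of that parabola. Absolute convergence of the whole integral
    is what makes the far part finite. *)
Lemma far_integral_le (s : R) (a : R -> R) (c M eta : R) (Z : set R) :
  (0 < s)%R -> (s < 1)%R -> (0 < eta)%R -> (0 <= c)%R -> (0 <= M)%R ->
  measurable_fun setT a -> (forall t, 0 <= a t)%R -> (forall t, a (- t) = a t)%R ->
  mu.-integrable setT (fun t => ((a t - c) * kern s t)%:E) ->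
  measurable Z -> mu Z = 0 ->
  (forall t, 0 < t -> t <= eta -> ~ Z t -> c - a t <= M * t ^+ 2)%R ->
  \int[mu]_(t in `]eta, +oo[) (a t * kern s t)%:E <=
    (c * (eta `^ (- (2 * s)) / (2 * s))
     + (\int[mu]_t ((a t - c) * kern s t)) / 2
     + M * (eta `^ (2 - 2 * s) / (2 - 2 * s)))%:E.
Proof.
move=> s0 s1 eta0 c0 M0 ma a0 ae intH mZ Z0 HM.
set h := fun t => ((a t - c) * kern s t)%R.
have mk := @measurable_kern R s.
pose D : set R := `]0%R, +oo[%classic.
have mD : measurable D by exact: measurable_itv.
have he t : h (- t)%R = h t by rewrite /h ae /kern normrN.
have intD : mu.-integrable D (EFin \o h).
  by apply: (@integrableS _ _ _ mu setT); rewrite /D//.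
(* An integrable function with h + q >= 0 almost everywhere on D, and with
   h + q = a kern beyond eta. *)
pose q t := ((if (t <= eta)%R then M * t ^+ 2 else c) * kern s t)%R.
have q0 t : (0 <= q t)%R.
  by rewrite mulr_ge0 ?kern_ge0//; case: ifP => // _; rewrite mulr_ge0 ?sqr_ge0.
have mq : measurable_fun setT q.
  apply: measurable_funM => //; apply: measurable_fun_ifT => //.
    exact: measurable_fun_ler.
  exact: measurable_funM.
have intq_le : \int[mu]_(t in D) (q t)%:E <=
   (M * (eta `^ (2 - 2 * s) / (2 - 2 * s)) + c * (eta `^ (- (2 * s)) / (2 * s)))%:E.
  rewrite /D (ge0_integral_itv_split (ltW eta0)); last 2 first.
  - by apply/measurable_EFinP.
  - by move=> t; rewrite lee_fin.
  rewrite EFinD; apply: leeD.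
    under eq_integral => t.
      rewrite inE/= in_itv/= => /andP[_ te]; rewrite /q te -mulrA EFinM; over.
    rewrite ge0_integralZl//; last 2 first.
    - by apply: measurable_funTS; apply/measurable_EFinP; exact: measurable_funM.
    - by move=> t _; rewrite lee_fin mulr_ge0 ?sqr_ge0 ?kern_ge0.
    by rewrite EFinM lee_wpmul2l//; exact: integral_sqr_kern_le.
  under eq_integral => t.
    rewrite inE/= in_itv/= andbT => te; rewrite /q leNgt te EFinM; over.
  rewrite ge0_integralZl//; last 2 first.
  - by apply: measurable_funTS; exact: measurable_EFin_kern.
  - by move=> t _; rewrite lee_fin kern_ge0.
  by rewrite integral_kern// -EFinM.
have intq : mu.-integrable D (EFin \o q).
  apply/integrableP; split; first by apply: measurable_funTS; apply/measurable_EFinP.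
  under eq_integral do rewrite /= ger0_norm//.
  exact: (le_lt_trans intq_le (ltry _)).
have mh : measurable_fun setT h.
  by apply: measurable_funM => //; exact: measurable_funB.
have step1 : \int[mu]_(t in `]eta, +oo[) (a t * kern s t)%:E <=
    \int[mu]_(t in D) (Num.max (h t + q t) 0)%:E.
  apply: (@le_trans _ _ (\int[mu]_(t in `]eta, +oo[) (Num.max (h t + q t) 0)%:E)).
    apply: ge0_le_integral => //.
    - by move=> t _; rewrite lee_fin mulr_ge0 ?kern_ge0.
    - by apply: measurable_funTS; apply/measurable_EFinP; exact: measurable_funM.
    - apply: measurable_funTS; apply/measurable_EFinP; apply: measurable_maxr => //.
      exact: measurable_funD.
    - move=> t /=; rewrite in_itv/= andbT => te.
      by rewrite lee_fin le_max /h /q (leNgt t eta) te/= -mulrDl subrK lexx.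
  apply: ge0_subset_integral => //.
  - apply: measurable_funTS; apply/measurable_EFinP; apply: measurable_maxr => //.
    exact: measurable_funD.
  - by move=> t _; rewrite lee_fin le_max lexx orbT.
  - by move=> t /=; rewrite /D/= !in_itv/= !andbT; exact: lt_trans.
apply: (le_trans step1).
rewrite (@ae_eq_integral _ _ _ mu D (fun t => (h t)%:E + (q t)%:E))//; last 3 first.
- apply: measurable_funTS; apply/measurable_EFinP; apply: measurable_maxr => //.
  exact: measurable_funD.
- by apply: emeasurable_funD; apply: measurable_funTS; apply/measurable_EFinP.
- exists Z; split => // t /= H; apply: contrapT => nZ; apply: H => Dt.
  rewrite -EFinD; congr EFin; rewrite max_l// /h /q -mulrDl mulr_ge0 ?kern_ge0//.
  move: Dt; rewrite /D/= in_itv/= andbT => t0; case: ifPn => te.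
    by have := HM t t0 te nZ; lra.
  by rewrite subrK.
rewrite integralD//.
have -> : \int[mu]_(t in D) (h t)%:E = ((\int[mu]_t h t) / 2)%:E.
  have E := integral_even intH he.
  have fD : \int[mu]_(t in D) (h t)%:E \is a fin_num by exact: integrable_fin_num.
  rewrite /Rintegral [in RHS]E -/D -(fineK fD) -EFinM/=.
  by rewrite mulrC mulKf.
rewrite -[X in _ <= (X + _)%:E]addrC -addrA EFinD leeD2l//.
by rewrite addrC.
Qed.
End lines.

(** * Second differences of C^2 functions *)
Section second_difference.
Context {R : realType} (n : nat).
Local Notation V := 'rV[R]_n.+1.
Implicit Types (u : V -> R) (x y : V) (i j : 'I_n.+1).

(** The last coordinate stays above a, so that for a > 0 the box is a compact
    subset of the half-space. *)
Definition box (a L : R) : set V :=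
  [set x | forall j, `[(if j == ord_max then a else - L), L]%classic (x ord0 j)].

Lemma compact_box a L : compact (box a L).
Proof.
by apply: (@rV_compact R n.+1 (fun j => `[(if j == ord_max then a else - L), L]%classic)) => j;
  exact: segment_compact.
Qed.

Lemma box_half_space a L : 0 < a -> box a L `<=` @half_space R n.
Proof.
move=> a0 x /(_ ord_max) /=; rewrite eqxx in_itv/= => /andP[ax _].
exact: lt_le_trans ax.
Qed.

Lemma box_shift a L i t x : box a L x -> `|t| <= a / 2 ->
  box (a / 2) (L + a) (x + t *: Defs.basis i).
Proof.
move=> bx ta j; have := bx j; rewrite /= !in_itv/= !mxE eqxx/=.
have : `|t| <= a / 2 by [].
rewrite ler_norml => /andP[t1 t2].
by case: (j == ord_max); case: (j == i); rewrite ?mulr1 ?mulr0 => /andP[? ?]; lra.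
Qed.

Lemma bounded_on_compact (f : V -> R) (K : set V) : compact K ->
  (forall x, K x -> {for x, continuous f}) ->
  exists2 M, 0 <= M & forall x, K x -> `|f x| <= M.
Proof.
move=> cK cf.
have : {within K, continuous f}.
  by apply: continuous_in_subspaceT => x /set_mem; exact: cf.
move=> /continuous_compact /(_ cK) /compact_bounded [M [_ HM]].
exists (`|M| + 1); first by rewrite addr_ge0.
move=> x Kx; apply: (HM (`|M| + 1)); last by exists x.
by rewrite ltr_pwDr// ler_norm.
Qed.

Lemma is_derive_line u x i (t : R) :
  derivable u (x + t *: Defs.basis i) (Defs.basis i) ->
  is_derive t 1 (fun r : R => u (x + r *: Defs.basis i))
    ('D_(Defs.basis i) u (x + t *: Defs.basis i)).
Proof.
move=> du; set e := Defs.basis i.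
have E : (fun h : R => h^-1 *: (((fun r : R => u (x + r *: e)) \o shift t) (h *: 1) - u (x + t *: e))) =
  (fun h : R => h^-1 *: ((u \o shift (x + t *: e)) (h *: e) - u (x + t *: e))).
  apply/funext => h; congr (_ *: (u _ - _)).
  have -> : shift t (h *: 1) = h + t by rewrite /shift/= /GRing.scale/= mulr1.
  by rewrite /shift/= scalerDl addrCA.
split; first by rewrite /derivable E.
by rewrite /derive E.
Qed.

(** Two applications of the mean value theorem to r -> u (x + r e_i), whose second
    derivative is bounded on a slightly larger box. *)
Lemma second_difference_le u a L : 0 < a -> C2_on (@half_space R n) u ->
  exists2 M, 0 <= M & forall i x (t : R), box a L x -> 0 < t -> t <= a / 2 ->
    2 * u x - (u (x + t *: Defs.basis i) + u (x - t *: Defs.basis i)) <= M * t ^+ 2.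
Proof.
move=> a0 C2; set K := box (a / 2) (L + a).
have KH : K `<=` @half_space R n by apply: box_half_space; rewrite divr_gt0.
have /choice[M_ HM] : forall i, exists M, 0 <= M /\ forall x, K x ->
    `|'D_(Defs.basis i) ('D_(Defs.basis i) u) x| <= M.
  move=> i; have [M M0 HM] := @bounded_on_compact
    ('D_(Defs.basis i) ('D_(Defs.basis i) u)) K (@compact_box _ _)
    (fun x Kx => let: And3 _ _ h := C2 x (KH x Kx) in (h i i).2).
  by exists M; split.
(* The two increments of the mean value theorem have lengths t and at most 2 t. *)
exists (2 * \sum_i M_ i).
  by rewrite mulr_ge0// sumr_ge0// => i _; have [] := HM i.
move=> i x t bx t0 ta; set e := Defs.basis i.
have inK (r : R) : `|r| <= t -> K (x + r *: e).
  by move=> rt; apply: box_shift => //; exact: le_trans ta.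
have du (r : R) : `|r| <= t -> derivable u (x + r *: e) e.
  by move=> /inK /KH /C2[_ /(_ i)[]].
have ddu (r : R) : `|r| <= t -> derivable ('D_e u) (x + r *: e) e.
  by move=> /inK /KH /C2[_ _ /(_ i i)[]].
pose f (r : R) := u (x + r *: e); pose f1 (r : R) := 'D_e u (x + r *: e).
pose f2 (r : R) := 'D_e ('D_e u) (x + r *: e).
have df (r : R) : `|r| <= t -> is_derive r 1 f (f1 r).
  by move=> rt; apply: is_derive_line; exact: du.
have df1 (r : R) : `|r| <= t -> is_derive r 1 f1 (f2 r).
  by move=> rt; apply: (@is_derive_line ('D_e u)); exact: ddu.
have dfN (r : R) : `|r| <= t -> is_derive r 1 (fun r => f (- r)) (- f1 (- r)).
  move=> rt.
  have h : is_derive (- r) 1 f (f1 (- r)) by apply: df; rewrite normrN.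
  have := @is_derive1_comp _ f -%R r _ _ h (is_deriveN (is_derive_id r (1 : R))).
  by rewrite mulrN1; exact.
have [||r0 /[!in_itv]/= /andP[r00 r0t]] := @MVT_segment R (fun r => f r + f (- r))
    (fun r => f1 r - f1 (- r)) 0 t (ltW t0) _ _.
- move=> r; rewrite in_itv/= => /andP[r0 rt].
  have rt' : `|r| <= t by rewrite ger0_norm; lra.
  exact: (is_deriveD (df r rt') (dfN r rt')).
- apply: continuous_in_subspaceT => r /set_mem /=; rewrite in_itv/= => /andP[r0 rt].
  have rt' : `|r| <= t by rewrite ger0_norm; lra.
  apply: differentiable_continuous; apply/derivable1_diffP.
  exact: (ex_derive (is_derive := is_deriveD (df r rt') (dfN r rt'))).
rewrite oppr0 addr0 => E1.
have [|||r1 /[!in_itv]/= /andP[r10 r11]] := @MVT_segment R f1 f2 (- r0) r0 _ _ _.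
- lra.
- move=> r; rewrite in_itv/= => /andP[r1 r2].
  by apply: df1; rewrite ler_norml; lra.
- apply: continuous_in_subspaceT => r /set_mem /=; rewrite in_itv/= => /andP[r1 r2].
  have rt' : `|r| <= t by rewrite ler_norml; lra.
  apply: differentiable_continuous; apply/derivable1_diffP.
  exact: (ex_derive (is_derive := df1 r rt')).
move=> E2.
have f0 : f 0 = u x by rewrite /f scale0r addr0.
have fN : f (- t) = u (x - t *: e) by rewrite /f scaleNr.
have B : `|f2 r1| <= \sum_i M_ i.
  apply: (@le_trans _ _ (M_ i)).
    by apply: (HM i).2; apply: inK; rewrite ler_norml; lra.
  by rewrite (bigD1 i)//= lerDl sumr_ge0// => j _; have [] := HM j.
rewrite -fN -/(f t) -f0.
move: B; rewrite ler_norml => /andP[B1 B2].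
have S0 : 0 <= \sum_i M_ i by rewrite sumr_ge0// => j _; have [] := HM j.
rewrite E2 in E1.
have E3 : 2 * f 0 - (f t + f (- t)) = - (f2 r1 * (r0 - - r0) * t) by rewrite -E1; ring.
rewrite E3.
have r0t2 : r0 * t <= t ^+ 2 by rewrite expr2 ler_wpM2r// ltW.
have r0t0 : 0 <= r0 * t by rewrite mulr_ge0// ltW.
nra.
Qed.
End second_difference.

(** * Positivity of the normalizing constant *)
Section normalizing_constant.
Context {R : realType}.
Local Notation mu := (@lebesgue_measure R).

(** By the conventions of the real-valued integral and of the inverse, the
    constant would be 0 if the integral were 0 or infinite; both are excluded. *)
Lemma Cs_gt0 (s : R) : 0 < s -> s < 1 -> 0 < Cs s.
Proof.
move=> s0 s1; rewrite /Cs invr_gt0.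
pose f (t : R) := (1 - cos t) * kern s t.
have f0 t : 0 <= f t by rewrite mulr_ge0 ?kern_ge0// subr_ge0 cos_le1.
have mf : measurable_fun setT (EFin \o f).
  apply/measurable_EFinP/measurable_funM; last exact: measurable_kern.
  apply: measurable_funB => //; apply: continuous_measurable_fun.
  exact: continuous_cos.
rewrite /Rintegral fine_gt0//; apply/andP; split; last first.
  rewrite (@ge0_integral_even _ (EFin \o f))//; last first.
    by move=> t; rewrite /= /f cosN /kern normrN.
  apply: (@le_lt_trans _ _ (2%:E * (eigen_cst s)%:E)%E); last by rewrite -EFinM ltry.
  rewrite lee_wpmul2l//; apply: le_trans (integral_parab_kern_le s0 s1).
  apply: ge0_le_integral => //.
  - by move=> t _; rewrite lee_fin.
  - exact: measurable_funTS.
  - by apply: measurable_funTS; exact: measurable_parab_kern.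
  - move=> t /=; rewrite in_itv/= andbT => t0.
    rewrite lee_fin ler_wpM2r ?kern_ge0// /parab_cut; case: ifP => _.
      by have := one_sub_cos_le (ltW t0); have := cos_le1 t; nra.
    by have := cos_geN1 t; lra.
rewrite lt0e integral_ge0 ?andbT; last by move=> t _; rewrite lee_fin.
apply/eqP => I0.
have : ae_eq mu setT (EFin \o f) (cst 0).
  apply/(ae_eq_integral_abs mu measurableT mf).
  by rewrite -[RHS]I0; apply: eq_integral => t _; rewrite /= ger0_norm.
move=> [Z [mZ Z0 HZ]].
have : (mu `]0%R, 1%R[ <= mu Z)%E.
  apply: le_measure; rewrite ?inE//.
  move=> t /=; rewrite in_itv/= => /andP[t0 t1]; apply: HZ => /= /(_ I) [] /eqP.
  rewrite mulf_eq0 => /orP[|]; last first.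
    by rewrite gt_eqF// invr_gt0 powR_gt0// normr_gt0 gt_eqF.
  rewrite subr_eq0 => /eqP cost.
  have /sin2_gt0 : 0 < t < 2 by rewrite t0/= (lt_trans t1)// ltr1n.
  have := cos2Dsin2 t; rewrite -cost; nra.
by rewrite Z0 lebesgue_measure_itv/= lte_fin ltr01 leNgt oppr0 adde0 lte01.
Qed.
End normalizing_constant.

(** * Products of sub-eigenfunctions *)
Section product_test_function.
Context {R : realType}.
Local Notation mu := (@lebesgue_measure R).
Local Notation T := (measurableTypeR R).
Local Notation lam N := (@lebesgue_tuple R N).

Definition prod_test (N : nat) (chi : 'I_N -> R -> R) (x : N.-tuple T) : R :=
  \prod_(i < N) chi i (tnth x i).

Lemma prod_test_ge0 N (chi : 'I_N -> R -> R) x :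
  (forall i t, 0 <= chi i t) -> 0 <= prod_test chi x.
Proof. by move=> chi0; apply: prodr_ge0. Qed.

Lemma measurable_prod_test N (chi : 'I_N -> R -> R) :
  (forall i, measurable_fun setT (chi i)) -> measurable_fun setT (prod_test chi).
Proof.
move=> mchi; apply: measurable_prod => i _.
by apply: (measurableT_comp (mchi i)); exact: measurable_tnth.
Qed.

Lemma prod_test_tshift N (chi : 'I_N -> R -> R) i t x :
  prod_test chi (tshift i t x) =
  chi i (tnth x i + t) * \prod_(j < N | j != i) chi j (tnth x j).
Proof.
rewrite /prod_test (bigD1 i)//= tnth_tshift eqxx; congr (_ * _).
by apply: eq_bigr => j /negbTE ji; rewrite tnth_tshift ji addr0.
Qed.

Lemma prod_testE N (chi : 'I_N -> R -> R) (i : 'I_N) x :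
  prod_test chi x = chi i (tnth x i) * \prod_(j < N | j != i) chi j (tnth x j).
Proof. by rewrite /prod_test (bigD1 i). Qed.

(** Along the i-th coordinate line the other factors of a product are constant,
    so only the i-th factor is differentiated. *)
Lemma prod_test_subeigen N (chi : 'I_N -> R -> R) s lam_ eta (i : 'I_N) (x : N.-tuple T) :
  (forall i t, 0 <= chi i t) -> (forall i, measurable_fun setT (chi i)) ->
  subeigen_at s (chi i) lam_ eta (tnth x i) ->
  ((2 * prod_test chi x)%:E * \int[mu]_(t in `]eta, +oo[) (kern s t)%:E <=
   \int[mu]_(t in `]eta, +oo[)
     ((prod_test chi (tshift i t x) + prod_test chi (tshift i (- t) x)) * kern s t)%:E
   + (lam_ * prod_test chi x)%:E)%E.
Proof.
move=> chi0 mchi H; rewrite (prod_testE _ i).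
set P := \prod_(j < N | j != i) _.
have P0 : 0 <= P by rewrite prodr_ge0.
under [X in (_ <= X + _)%E]eq_integral => t _.
  rewrite !prod_test_tshift -/P -mulrDl mulrAC mulrC EFinM.
  over.
rewrite ge0_integralZl//; last 2 first.
- by apply: measurable_funTS; exact: measurable_second_sum.
- by move=> t _; apply: second_sum_ge0.
rewrite (mulrA 2) (mulrA lam_) !(mulrC _ P) !(EFinM P) -muleA -muleDr//; last first.
  exact: fin_num_adde_defl.
by rewrite lee_wpmul2l.
Qed.
End product_test_function.

(** * The truncated inequality at almost every point *)
Section pointwise.
Context {R : realType} (n : nat).
Local Notation mu := (@lebesgue_measure R).
Local Notation T := (measurableTypeR R).
Local Notation N := n.+1.
Local Notation lam := (@lebesgue_tuple R N).

Definition two_sided (v : N.-tuple T -> R) (i : 'I_N) (x : N.-tuple T) (t : R) : R :=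
  v (tshift i t x) + v (tshift i (- t) x).

Definition far_part s eta v i x : \bar R :=
  (\int[mu]_(t in `]eta, +oo[) (two_sided v i x t * kern s t)%:E)%E.

(** A point whose coordinate lines meet the null set Z in null sets: there the
    function u can be replaced by its Borel representative both at the point and
    inside the integrals. Both orientations are recorded because the integrand
    evaluates at +t and at -t. *)
Definition good_line (Z : set (N.-tuple T)) (x : N.-tuple T) : Prop :=
  ~ Z x /\ forall i, mu [set t | Z (tshift i (1 * t) x)] = 0%E /\
                     mu [set t | Z (tshift i (-1 * t) x)] = 0%E.

Lemma ae_good_line (Z : set (N.-tuple T)) :
  measurable Z -> lam Z = 0%E -> {ae lam, forall x, good_line Z x}.
Proof.
move=> mZ Z0.
have H0 : {ae lam, forall x, ~ Z x} by exists Z; split => // x /= /contrapT.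
have H1 i : {ae lam, forall x, mu [set t | Z (tshift i (1 * t) x)] = 0%E /\
                     mu [set t | Z (tshift i (-1 * t) x)] = 0%E}.
  by apply: filterS2 (ae_line i 1 mZ Z0) (ae_line i (-1) mZ Z0).
have H2 : {ae lam, forall x, forall i, mu [set t | Z (tshift i (1 * t) x)] = 0%E /\
                     mu [set t | Z (tshift i (-1 * t) x)] = 0%E}.
  by apply: filter_forall.
by apply: filterS2 H0 H2.
Qed.

Lemma measurable_two_sided v i x : measurable_fun setT v ->
  measurable_fun setT (two_sided v i x).
Proof.
move=> mv; apply: measurable_funD; apply: (measurableT_comp mv).
  by have := measurable_tshift_line i 1 x; under eq_fun do rewrite mul1r.
by have := measurable_tshift_line i (-1) x; under eq_fun do rewrite mulN1r.
Qed.

Variables (s p : R) (u : 'rV[R]_N -> R) (v : N.-tuple T -> R) (Z : set (N.-tuple T)).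
Hypotheses (s0 : 0 < s) (s1 : s < 1).
Hypotheses (mv : measurable_fun setT v) (v0 : forall x, 0 <= v x).
Hypotheses (mZ : measurable Z) (uv : forall x, ~ Z x -> u (row_of_tuple x) = v x).

Let bad_times i x := [set t | Z (tshift i (1 * t) x)] `|` [set t | Z (tshift i (-1 * t) x)].

Let measurable_bad_times i x : measurable (bad_times i x).
Proof.
have mZ1 c : measurable [set t | Z (tshift i (c * t) x)].
  by have := measurable_tshift_line i c x measurableT mZ; rewrite setTI.
exact: measurableU.
Qed.

Let bad_times0 i x : good_line Z x -> mu (bad_times i x) = 0%E.
Proof.
move=> gx; have mZ1 c : measurable [set t | Z (tshift i (c * t) x)].
  by have := measurable_tshift_line i c x measurableT mZ; rewrite setTI.
have [h1 h2] := gx.2 i.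
apply/eqP; rewrite -measure_le0; apply: (le_trans (measureU2 mu (mZ1 1) (mZ1 (-1)))).
by rewrite [X in (X + _)%E]h1 [X in (_ + X)%E]h2 adde0.
Qed.

Lemma good_line_transfer x i : good_line Z x -> I_dir_defined s i u (row_of_tuple x) ->
  mu.-integrable setT (fun t => ((two_sided v i x t - 2 * v x) * kern s t)%:E) /\
  I_dir s i u (row_of_tuple x) =
    Cs s / 2 * \int[mu]_t ((two_sided v i x t - 2 * v x) * kern s t).
Proof.
move=> gx Hdef; have nZx := gx.1.
have [||H1 H2] := @integral_completed_transfer R (I_integrand s i u (row_of_tuple x))
   (fun t => (two_sided v i x t - 2 * v x) * kern s t) (bad_times i x) _
   (measurable_bad_times i x) (bad_times0 i gx) _ Hdef.
- apply: measurable_funM; last exact: measurable_kern.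
  by apply: measurable_funB => //; exact: measurable_two_sided.
- move=> t /not_orP[/= n1 n2].
  rewrite /I_integrand -/(kern s t) /two_sided.
  rewrite mul1r in n1; rewrite mulN1r in n2.
  by rewrite -(uv n1) -(uv n2) -(uv nZx) !row_of_tshift scaleNr.
by split => //; rewrite /I_dir /Rintegral H2.
Qed.

(** At a good point of the box the supersolution inequality bounds the sum of the
    whole integrals; [far_integral_le] turns it into a bound on the far parts,
    uniformly over the box up to the factor v x. *)
Lemma pointwise_far_le x a L M eta : pointwise_supersolution s p u ->
  good_line Z x -> 0 < a -> box a L (row_of_tuple x) ->
  0 <= M -> 0 < eta -> eta <= a / 2 ->
  (forall i (y : 'rV[R]_N) (t : R), box a L y -> 0 < t -> t <= a / 2 ->
    2 * u y - (u (y + t *: Defs.basis i) + u (y - t *: Defs.basis i)) <= M * t ^+ 2) ->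
  ((v x `^ p)%:E + \sum_(i < N) (Cs s)%:E * far_part s eta v i x <=
   (Cs s * N%:R * (2 * v x * (eta `^ (- (2 * s)) / (2 * s)) +
      M * (eta `^ (2 - 2 * s) / (2 - 2 * s))))%:E)%E.
Proof.
move=> sol gx a0 bx M0 eta0 etaa HM.
have C0 := Cs_gt0 s0 s1.
have [Hdef Hsup] := sol _ (box_half_space a0 bx).
have nZx := gx.1.
pose J i := \int[mu]_t ((two_sided v i x t - 2 * v x) * kern s t).
set K := eta `^ (- (2 * s)) / (2 * s); set E := eta `^ (2 - 2 * s) / (2 - 2 * s).
have A i : (far_part s eta v i x <= (2 * v x * K + J i / 2 + M * E)%:E)%E.
  have [H1 H2] := good_line_transfer gx (Hdef i).
  apply: (@far_integral_le R s (two_sided v i x) (2 * v x) M eta (bad_times i x)) => //.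
  - by rewrite mulr_ge0.
  - exact: measurable_two_sided.
  - by move=> t; rewrite addr_ge0.
  - by move=> t; rewrite /two_sided opprK addrC.
  - exact: bad_times0.
  - move=> t t0 te /not_orP[/= n1 n2].
    rewrite mul1r in n1; rewrite mulN1r in n2.
    rewrite /two_sided -(uv n1) -(uv n2) -(uv nZx) !row_of_tshift scaleNr.
    by apply: HM => //; exact: le_trans etaa.
apply: (@le_trans _ _ ((v x `^ p)%:E + \sum_(i < N) (Cs s * (2 * v x * K + J i / 2 + M * E))%:E)%E).
  rewrite leeD2l//; apply: lee_sum => i _.
  by rewrite EFinM lee_wpmul2l// lee_fin ltW.
rewrite sumEFin -EFinD lee_fin.
have Iop : I_op s u (row_of_tuple x) = \sum_(i < N) Cs s / 2 * J i.
  by apply: eq_bigr => i _; rewrite (good_line_transfer gx (Hdef i)).2.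
rewrite (uv nZx) Iop in Hsup.
have -> : \sum_(i < N) Cs s * (2 * v x * K + J i / 2 + M * E) =
   \sum_(i < N) (Cs s * (2 * v x * K + M * E)) + \sum_(i < N) (Cs s / 2 * J i).
  by rewrite -big_split/=; apply: eq_bigr => i _; ring.
rewrite sumr_const card_ord -[_ *+ N]mulr_natr.
lra.
Qed.
End pointwise.

(** * Symmetry of the truncated form *)
Section symmetric_form.
Context {R : realType} (N : nat).
Local Notation mu := (@lebesgue_measure R).
Local Notation T := (measurableTypeR R).
Local Notation lam := (@lebesgue_tuple R N).
Local Open Scope ereal_scope.
Variables (s eta : R).
Implicit Types v : N.-tuple T -> R.

Definition far_half (c : R) (v : N.-tuple T -> R) (i : 'I_N) (x : N.-tuple T) : \bar R :=
  \int[mu]_(t in `]eta, +oo[) ((kern s t)%:E * (v (tshift i (c * t) x))%:E).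

Lemma far_half_ge0 c v i x : (forall x, 0 <= v x)%R -> 0 <= far_half c v i x.
Proof. by move=> v0; apply: integral_ge0 => t _; rewrite -EFinM lee_fin mulr_ge0 ?kern_ge0. Qed.

Lemma measurable_far_half c v i : measurable_fun setT v -> (forall x, 0 <= v x)%R ->
  measurable_fun setT (far_half c v i).
Proof.
move=> mv v0.
have mF : measurable_fun setT (fun q : N.-tuple T * T =>
    ((kern s q.2)%:E * (v (tshift i (c * q.2) q.1))%:E) * (\1_(`]eta, +oo[) q.2)%:E : \bar R).
  apply: emeasurable_funM; first apply: emeasurable_funM.
  - by apply: (measurableT_comp (@measurable_EFin_kern R s)).
  - apply/measurable_EFinP; apply: (measurableT_comp mv).
    exact: (measurableT_comp (@measurable_tshift2 R N i c) (@measurable_swap _ _ _ _)).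
  - apply/measurable_EFinP; apply: (measurableT_comp (measurable_indic _)) => //.
have F0 (q : N.-tuple T * T) : 0 <= ((kern s q.2)%:E * (v (tshift i (c * q.2) q.1))%:E) *
    (\1_(`]eta, +oo[) q.2)%:E.
  by rewrite -!EFinM lee_fin !mulr_ge0 ?kern_ge0.
have := measurable_fun_fubini_tonelli_F (m2 := mu) _ mF F0.
apply: eq_measurable_fun => x _; rewrite /far_half [RHS]integral_mkcond /fubini_F.
apply: eq_integral => t _; rewrite patchE /= indicE.
by case: ifP => _; rewrite ?mule1 ?mule0.
Qed.

Lemma far_half_sym c (f g : N.-tuple T -> R) i :
  measurable_fun setT f -> (forall x, 0 <= f x)%R ->
  measurable_fun setT g -> (forall x, 0 <= g x)%R ->
  \int[lam]_x ((f x)%:E * far_half c g i x) =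
  \int[lam]_x ((g x)%:E * far_half (- c) f i x).
Proof.
move=> mf f0 mg g0.
have mk : measurable_fun setT (fun t : R => (kern s t)%:E) by exact: measurable_EFin_kern.
have k0 t : 0 <= (kern s t)%:E by rewrite lee_fin kern_ge0.
have mf' : measurable_fun setT (fun x : N.-tuple T => (f x)%:E) by exact/measurable_EFinP.
have mg' : measurable_fun setT (fun x : N.-tuple T => (g x)%:E) by exact/measurable_EFinP.
have f0' x : 0 <= (f x)%:E by rewrite lee_fin.
have g0' x : 0 <= (g x)%:E by rewrite lee_fin.
have H := @integral_kernel_sym R N i c _ _ _ _ (measurable_itv `]eta, +oo[) mk k0 mf' f0' mg' g0'.
apply: (etrans H); apply: eq_integral => x _; congr (_ * _).
by apply: eq_integral => t _; rewrite mulNr.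
Qed.
End symmetric_form.

Section far_part_sym.
Context {R : realType} (n : nat).
Local Notation mu := (@lebesgue_measure R).
Local Notation T := (measurableTypeR R).
Local Notation N := n.+1.
Local Notation lam := (@lebesgue_tuple R N).
Local Open Scope ereal_scope.
Variables (s eta : R).
Implicit Types v f g : N.-tuple T -> R.

Lemma far_partE v i x : measurable_fun setT v -> (forall x, 0 <= v x)%R ->
  far_part s eta v i x = far_half s eta 1 v i x + far_half s eta (-1) v i x.
Proof.
move=> mv v0; rewrite /far_part /far_half -ge0_integralD//.
- apply: eq_integral => t _; rewrite -!EFinM -EFinD mul1r mulN1r /two_sided.
  by congr EFin; ring.
- by move=> t _; rewrite -EFinM lee_fin mulr_ge0 ?kern_ge0.
- apply: measurable_funTS; apply: emeasurable_funM; first exact: measurable_EFin_kern.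
  by apply/measurable_EFinP; apply: (measurableT_comp mv); exact: measurable_tshift_line.
- by move=> t _; rewrite -EFinM lee_fin mulr_ge0 ?kern_ge0.
- apply: measurable_funTS; apply: emeasurable_funM; first exact: measurable_EFin_kern.
  by apply/measurable_EFinP; apply: (measurableT_comp mv); exact: measurable_tshift_line.
Qed.

Lemma far_part_ge0 v i x : (forall x, 0 <= v x)%R -> 0 <= far_part s eta v i x.
Proof.
by move=> v0; apply: integral_ge0 => t _; rewrite lee_fin mulr_ge0 ?kern_ge0 ?addr_ge0.
Qed.

Lemma measurable_far_part v i : measurable_fun setT v -> (forall x, 0 <= v x)%R ->
  measurable_fun setT (far_part s eta v i).
Proof.
move=> mv v0; rewrite (_ : far_part s eta v i =
  fun x => far_half s eta 1 v i x + far_half s eta (-1) v i x); last first.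
  by apply/funext => x; rewrite far_partE.
by apply: emeasurable_funD; exact: measurable_far_half.
Qed.

Lemma far_part_sym f g i :
  measurable_fun setT f -> (forall x, 0 <= f x)%R ->
  measurable_fun setT g -> (forall x, 0 <= g x)%R ->
  \int[lam]_x ((f x)%:E * far_part s eta g i x) =
  \int[lam]_x ((g x)%:E * far_part s eta f i x).
Proof.
have D (h k : N.-tuple T -> R) : measurable_fun setT h -> (forall x, 0 <= h x)%R ->
    measurable_fun setT k -> (forall x, 0 <= k x)%R ->
    \int[lam]_x ((h x)%:E * far_part s eta k i x) =
    \int[lam]_x ((h x)%:E * far_half s eta 1 k i x) +
    \int[lam]_x ((h x)%:E * far_half s eta (-1) k i x).
  move=> mh h0 mk k0; rewrite -ge0_integralD//.
  - apply: eq_integral => x _; rewrite far_partE// ge0_muleDr// far_half_ge0//.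
  - by move=> x _; apply: mule_ge0; [rewrite lee_fin|exact: far_half_ge0].
  - by apply: emeasurable_funM; [apply/measurable_EFinP|exact: measurable_far_half].
  - by move=> x _; apply: mule_ge0; [rewrite lee_fin|exact: far_half_ge0].
  - by apply: emeasurable_funM; [apply/measurable_EFinP|exact: measurable_far_half].
move=> mf f0 mg g0.
rewrite (D f g mf f0 mg g0) (D g f mg g0 mf f0).
have H1 := far_half_sym s eta 1 i mf f0 mg g0.
have H2 := far_half_sym s eta (-1) i mf f0 mg g0; rewrite opprK in H2.
exact: (etrans (congr2 adde H1 H2) (addeC _ _)).
Qed.
End far_part_sym.

(** * Testing the supersolution *)
Section test_inequality.
Context {R : realType} (n : nat).
Local Notation mu := (@lebesgue_measure R).
Local Notation T := (measurableTypeR R).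
Local Notation N := n.+1.
Local Notation lam := (@lebesgue_tuple R N).
Variables (s p : R) (u : 'rV[R]_N -> R) (v : N.-tuple T -> R) (Z : set (N.-tuple T)).
Hypotheses (s0 : 0 < s) (s1 : s < 1).
Hypotheses (mv : measurable_fun setT v) (v0 : forall x, 0 <= v x).
Hypotheses (mZ : measurable Z) (Z0 : lam Z = 0%E).
Hypothesis uv : forall x, ~ Z x -> u (row_of_tuple x) = v x.
Hypothesis C2 : C2_on (@half_space R n) u.
Hypothesis sol : pointwise_supersolution s p u.

Variables (chi : 'I_N -> R -> R) (ell a L : R).
Hypotheses (mchi : forall i, measurable_fun setT (chi i)) (chi0 : forall i t, 0 <= chi i t).
Hypotheses (ell0 : 0 <= ell) (a0 : 0 < a).
Hypothesis chi_sub : forall i eta y, 0 < eta -> eta <= 1 -> subeigen_at s (chi i) ell eta y.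
Let phi := prod_test chi.
Hypothesis supp : forall x, phi x != 0 -> box a L (row_of_tuple x).
Hypothesis fin_phi : (\int[lam]_x (phi x)%:E < +oo)%E.
Hypothesis fin_vphi : (\int[lam]_x (v x * phi x)%:E < +oo)%E.

Let s2 : 0 < 2 - 2 * s.
Proof. by have h := s1; lra. Qed.
Let phi0 x : 0 <= phi x. Proof. exact: prod_test_ge0. Qed.
Let mphi : measurable_fun setT phi. Proof. exact: measurable_prod_test. Qed.
Let X := (\int[lam]_x (v x `^ p * phi x)%:E)%E.
Let Y := (\int[lam]_x (v x * phi x)%:E)%E.
Let P := (\int[lam]_x (phi x)%:E)%E.
Let mvphi : measurable_fun setT (fun x => (v x * phi x)%:E).
Proof. by apply/measurable_EFinP; exact: measurable_funM. Qed.
Let mEphi : measurable_fun setT (fun x => (phi x)%:E).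
Proof. exact/measurable_EFinP. Qed.
Let vphi0 x : (0 <= (v x * phi x)%:E)%E. Proof. by rewrite lee_fin mulr_ge0. Qed.

Let kap eta := eta `^ (- (2 * s)) / (2 * s).

(** Here the operator is moved onto the test function. *)
Let far_lower eta i : 0 < eta -> eta <= 1 ->
  ((2 * kap eta)%:E * Y <=
    \int[lam]_x ((phi x)%:E * far_part s eta v i x) + ell%:E * Y)%E.
Proof.
move=> e0 e1; rewrite far_part_sym//.
have k0 : 0 <= kap eta by rewrite divr_ge0 ?powR_ge0// mulr_ge0// ltW.
have mfar := @measurable_far_part R n s eta phi i mphi phi0.
have mvfar : measurable_fun setT (fun x => (v x)%:E * far_part s eta phi i x)%E.
  by apply: emeasurable_funM => //; exact/measurable_EFinP.
have vfar0 x : (0 <= (v x)%:E * far_part s eta phi i x)%E.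
  by apply: mule_ge0; [rewrite lee_fin|exact: far_part_ge0].
rewrite -!ge0_integralZl//; last by rewrite lee_fin mulr_ge0.
rewrite -ge0_integralD//; last 2 first.
- by move=> x _; rewrite mule_ge0.
- exact: measurable_funeM.
apply: ge0_le_integral => //.
- by move=> x _; rewrite mule_ge0// lee_fin mulr_ge0.
- exact: measurable_funeM.
- by apply: emeasurable_funD => //; exact: measurable_funeM.
move=> x _.
have := @prod_test_subeigen R N chi s ell eta i x chi0 mchi (chi_sub i _ e0 e1).
rewrite integral_kern// -/phi -/(kap eta) => H.
have vx0 : (0 <= (v x)%:E)%E by rewrite lee_fin.
have := lee_wpmul2l vx0 H; rewrite -/(far_part s eta phi i x) muleDr//; last first.
  exact: fin_num_adde_defl.
rewrite -!EFinM (_ : v x * (2 * phi x * kap eta) = 2 * kap eta * (v x * phi x)); last ring.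
by rewrite (_ : v x * (ell * phi x) = ell * (v x * phi x))//; ring.
Qed.

(** The pointwise inequality multiplied by the test function and integrated. *)
Let far_upper eta M : 0 <= M -> 0 < eta -> eta <= a / 2 ->
  (forall i (y : 'rV[R]_N) (t : R), box a L y -> 0 < t -> t <= a / 2 ->
    2 * u y - (u (y + t *: Defs.basis i) + u (y - t *: Defs.basis i)) <= M * t ^+ 2) ->
  (X + \sum_(i < N) (Cs s)%:E * \int[lam]_x ((phi x)%:E * far_part s eta v i x) <=
   (Cs s * N%:R)%:E * ((2 * kap eta)%:E * Y +
     (M * (eta `^ (2 - 2 * s) / (2 - 2 * s)))%:E * P))%E.
Proof.
move=> M0 e0 ea HM.
have C0 := Cs_gt0 s0 s1.
have k0 : 0 <= kap eta by rewrite divr_ge0 ?powR_ge0// mulr_ge0// ltW.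
set E := eta `^ (2 - 2 * s) / (2 - 2 * s).
have E0 : 0 <= E by rewrite divr_ge0 ?powR_ge0 ?(ltW s2).
have k20 : 0 <= 2 * kap eta by apply: mulr_ge0.
have ME0 : 0 <= M * E by apply: mulr_ge0.
have CN0 : 0 <= Cs s * N%:R by apply: mulr_ge0 => //; exact: ltW.
have rhs0 x : 0 <= 2 * kap eta * (v x * phi x) + M * E * phi x.
  by apply: addr_ge0; apply: mulr_ge0 => //; exact: mulr_ge0.
have t10 x : (0 <= (2 * kap eta)%:E * (v x * phi x)%:E)%E.
  by rewrite -EFinM lee_fin; apply: mulr_ge0 => //; exact: mulr_ge0.
have t20 x : (0 <= (M * E)%:E * (phi x)%:E)%E.
  by rewrite -EFinM lee_fin; exact: mulr_ge0.
have mfar i := @measurable_far_part R n s eta v i mv v0.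
have far0 i x : (0 <= far_part s eta v i x)%E by exact: far_part_ge0.
have mphifar i : measurable_fun setT (fun x => (phi x)%:E * far_part s eta v i x)%E.
  by apply: emeasurable_funM.
have phifar0 i x : (0 <= (phi x)%:E * far_part s eta v i x)%E.
  by apply: mule_ge0; [rewrite lee_fin|exact: far_part_ge0].
have mX : measurable_fun setT (fun x => (v x `^ p * phi x)%:E).
  apply/measurable_EFinP; apply: measurable_funM => //.
  exact: (measurableT_comp (measurable_powR p)).
have X0 x : (0 <= (v x `^ p * phi x)%:E)%E by rewrite lee_fin mulr_ge0 ?powR_ge0.
have -> : (X + \sum_(i < N) (Cs s)%:E * \int[lam]_x ((phi x)%:E * far_part s eta v i x) =
  \int[lam]_x ((v x `^ p * phi x)%:E +
     \sum_(i < N) (Cs s)%:E * ((phi x)%:E * far_part s eta v i x)))%E.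
  rewrite ge0_integralD//; last 2 first.
  - by move=> x _; apply: sume_ge0 => i _; rewrite mule_ge0// lee_fin ltW.
  - by apply: emeasurable_sum => i; exact: measurable_funeM.
  congr (_ + _)%E; rewrite ge0_integral_sum//; last 2 first.
  - by move=> i; exact: measurable_funeM.
  - by move=> i x _; rewrite mule_ge0// lee_fin ltW.
  by apply: eq_bigr => i _; rewrite ge0_integralZl// lee_fin ltW.
have -> : ((Cs s * N%:R)%:E * ((2 * kap eta)%:E * Y + (M * E)%:E * P) =
  \int[lam]_x ((Cs s * N%:R)%:E * ((2 * kap eta)%:E * (v x * phi x)%:E + (M * E)%:E * (phi x)%:E)))%E.
  rewrite ge0_integralZl//; last 2 first.
  - by apply: emeasurable_funD; exact: measurable_funeM.
  - by move=> x _; rewrite -!EFinM -EFinD lee_fin.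
  congr (_ * _)%E; rewrite ge0_integralD//; last 2 first.
  - exact: measurable_funeM.
  - exact: measurable_funeM.
  by congr (_ + _)%E; rewrite ge0_integralZl// => x _; rewrite lee_fin.
apply: ae_ge0_le_integral => //.
- move=> x _; rewrite adde_ge0//; apply: sume_ge0 => i _.
  by rewrite mule_ge0// lee_fin ltW.
- by apply: emeasurable_funD => //; apply: emeasurable_sum => i; exact: measurable_funeM.
- by move=> x _; apply: mule_ge0; [rewrite lee_fin|apply: adde_ge0].
- by apply: measurable_funeM; apply: emeasurable_funD; exact: measurable_funeM.
apply: filterS (ae_good_line mZ Z0) => x gx _.
have [phix0|phix0] := eqVneq (phi x) 0.
  rewrite phix0 !mulr0 !mule0 adde0 mule0 add0e big1// => i _.
  by rewrite mul0e mule0.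
have H := @pointwise_far_le R n s p u v Z s0 s1 mv v0 mZ uv x a L M eta sol gx a0 (supp phix0) M0 e0 ea HM.
have px0 : (0 <= (phi x)%:E)%E by rewrite lee_fin.
move/(lee_wpmul2l px0) : H; rewrite -/(kap eta) -/E ge0_muleDr//; last 2 first.
- by rewrite lee_fin powR_ge0.
- by apply: sume_ge0 => i _; rewrite mule_ge0// lee_fin ltW.
rewrite ge0_sume_distrr; last by move=> i _; rewrite mule_ge0// lee_fin ltW.
rewrite -EFinM (mulrC (phi x)) => H.
under eq_bigr do rewrite muleCA.
apply: (le_trans H).
rewrite [leRHS](_ : _ = (Cs s * N%:R *
  (2 * kap eta * (v x * phi x) + M * E * phi x))%:E)//.
rewrite -EFinM lee_fin le_eqVlt; apply/orP; left.
by apply/eqP; ring.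
Qed.

(** Both [far_lower] and [far_upper] contain the term 2 kap eta Y, which blows up
    as eta tends to 0 but is finite and cancels; the remaining error is of order
    eta^(2 - 2s). *)
Lemma test_inequality : (X <= (Cs s * N%:R * ell)%:E * Y)%E.
Proof.
have C0 := Cs_gt0 s0 s1.
have [M M0 HM] := second_difference_le L a0 C2.
have Y0 : (0 <= Y)%E by exact: integral_ge0.
have P0 : (0 <= P)%E by apply: integral_ge0 => x _; rewrite lee_fin.
have X0 : (0 <= X)%E.
  by apply: integral_ge0 => x _; rewrite lee_fin mulr_ge0 ?powR_ge0.
have Yfin : Y \is a fin_num by rewrite ge0_fin_numE.
have Pfin : P \is a fin_num by rewrite ge0_fin_numE.
pose y := fine Y; pose q := fine P.
have y0 : 0 <= y by exact: fine_ge0.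
have q0 : 0 <= q by exact: fine_ge0.
have YE : Y = y%:E by rewrite fineK.
have PE : P = q%:E by rewrite fineK.
rewrite YE -EFinM; apply/lee_addgt0Pr => e epos.
(* eta is chosen so that the error B eta^(2 - 2s) is at most e. *)
set B := Cs s * N%:R * M * q / (2 - 2 * s).
have B0 : 0 <= B by rewrite divr_ge0 ?(ltW s2)// !mulr_ge0// ltW.
have [eta [e0 em ep]] := @exists_powR_le R (2 - 2 * s) (Num.min 1 (a / 2)) (e / (B + 1))
  s2 (ltac:(by rewrite lt_min ltr01 divr_gt0)) (ltac:(by rewrite divr_gt0//; lra)).
move: em; rewrite le_min => /andP[e1 ea].
have U := far_upper M0 e0 ea HM.
have D i := far_lower i e0 e1.
pose S i := (\int[lam]_x ((phi x)%:E * far_part s eta v i x))%E.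
have S0 i : (0 <= S i)%E.
  by apply: integral_ge0 => x _; rewrite mule_ge0 ?lee_fin//; exact: far_part_ge0.
have {}U : (X + \sum_(i < N) (Cs s)%:E * S i <= (Cs s * N%:R * (2 * kap eta * y +
    M * (eta `^ (2 - 2 * s) / (2 - 2 * s)) * q))%:E)%E.
  by move: U; rewrite YE PE.
have SS0 : (0 <= \sum_(i < N) (Cs s)%:E * S i)%E.
  by apply: sume_ge0 => i _; rewrite mule_ge0// lee_fin ltW.
have Xfin : X \is a fin_num.
  by rewrite ge0_fin_numE//; apply: le_lt_trans (le_lt_trans U (ltry _)); rewrite leeDl.
have Sfin i : S i \is a fin_num.
  have : ((Cs s)%:E * S i < +oo)%E.
    apply: le_lt_trans (le_lt_trans U (ltry _)).
    rewrite (bigD1 i)//= addeCA leeDl// adde_ge0//.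
    by apply: sume_ge0 => j _; rewrite mule_ge0// lee_fin ltW.
  rewrite ge0_fin_numE//; case: (S i) (S0 i) => [r| |]// _; first by move=> _; exact: ltry.
  by rewrite gt0_muley ?lte_fin.
have SE i : S i = (fine (S i))%:E by rewrite fineK.
have Dr i : 2 * kap eta * y <= fine (S i) + ell * y.
  by have := D i; rewrite -/(S i) YE SE -lee_fin.
move: U; under eq_bigr do rewrite SE -EFinM.
rewrite sumEFin -(fineK Xfin) -EFinD !lee_fin => U.
have Sum : Cs s * N%:R * (2 * kap eta * y - ell * y) <= \sum_(i < N) Cs s * fine (S i).
  rewrite -mulrA mulr_natl -[X in _ *+ X](card_ord N) -sumr_const mulr_sumr.
  apply: ler_sum => i _; rewrite ler_pM2l//.
  by have := Dr i; lra.
have He : B * eta `^ (2 - 2 * s) <= e.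
  apply: (@le_trans _ _ (B * (e / (B + 1)))); first by rewrite ler_wpM2l.
  rewrite mulrA ler_pdivrMr ?ltr_wpDl//; nra.
have BE : B * eta `^ (2 - 2 * s) = Cs s * N%:R * (M * (eta `^ (2 - 2 * s) / (2 - 2 * s)) * q).
  by rewrite /B; ring.
rewrite BE in He.
lra.
Qed.
End test_inequality.

(** * Dilated test functions in the half-space *)
Section test_family.
Context {R : realType} (n : nat).
Local Notation mu := (@lebesgue_measure R).
Local Notation T := (measurableTypeR R).
Local Notation N := n.+1.
Local Notation lam := (@lebesgue_tuple R N).
Implicit Types (s eps r t y : R).

(** The factor r^s makes the normal factor equal to (t - eps)_+^s near the
    boundary, independently of r. *)
Definition test_factor s eps r (i : 'I_N) (t : R) : R :=
  if i == ord_max then r `^ s * half_profile s ((t - eps) / r) else cos_bump (t / r).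

Definition depth_weight s eps (x : N.-tuple T) : R := pos_pow s (tnth x ord_max - eps).

Lemma test_factor_ge0 s eps r i t : 0 <= test_factor s eps r i t.
Proof.
rewrite /test_factor; case: ifP => _; last exact: cos_bump_ge0.
by rewrite mulr_ge0 ?powR_ge0 ?half_profile_ge0.
Qed.

Lemma measurable_test_factor s eps r i : measurable_fun setT (test_factor s eps r i).
Proof.
rewrite /test_factor; case: (i == ord_max).
  apply: measurable_funM => //; apply: (measurableT_comp (measurable_half_profile s)).
  by apply: measurable_funM => //; exact: measurable_funB.
by apply: (measurableT_comp measurable_cos_bump); exact: measurable_funM.
Qed.

Lemma subeigen_test_factor s eps r i eta y : 0 < s -> s < 1 -> 1 <= r ->
  0 < eta -> eta <= 1 ->
  subeigen_at s (test_factor s eps r i) (r `^ (- (2 * s)) * eigen_cst s) eta y.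
Proof.
move=> s0 s1 r1 e0 e1.
have r0 : 0 < r by lra.
have er : eta / r <= 1 by rewrite ler_pdivrMr// mul1r; lra.
have er0 : 0 < eta / r by rewrite divr_gt0.
rewrite /test_factor; case: (i == ord_max).
  apply: (@subeigen_at_mul _ _ (fun t => half_profile s ((t - eps) / r))).
  - exact: powR_ge0.
  - apply: (measurableT_comp (measurable_half_profile s)).
    by apply: measurable_funM => //; exact: measurable_funB.
  - by move=> t; exact: half_profile_ge0.
  - apply: (@subeigen_at_shift _ _ (fun t => half_profile s (t / r))).
    apply: subeigen_at_scale => //.
    + exact: measurable_half_profile.
    + exact: half_profile_ge0.
    + exact: subeigen_half_profile.
apply: subeigen_at_scale => //.
- exact: measurable_cos_bump.
- exact: cos_bump_ge0.
- exact: subeigen_cos_bump.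
Qed.

Lemma test_factor_other s eps r i t : 0 < r -> i != ord_max ->
  test_factor s eps r i t != 0 -> - (2 * r) <= t <= 2 * r.
Proof.
move=> r0 /negbTE im; rewrite /test_factor im => h.
have : `|t / r| <= 2.
  by rewrite leNgt; apply: contra h => h; rewrite cos_bump_out.
by rewrite ler_norml ler_pdivrMr// ler_pdivlMr// mulNr.
Qed.

Lemma test_factor_max s eps r t : 0 < s -> s < 1 -> 0 < r ->
  test_factor s eps r ord_max t != 0 -> eps <= t <= eps + 5 * r.
Proof.
move=> s0 s1 r0; rewrite /test_factor eqxx => h; apply/andP; split.
  rewrite leNgt; apply: contra h => h.
  by rewrite half_profile_le0 ?mulr0// pmulr_lle0 ?invr_gt0//; lra.
rewrite leNgt; apply: contra h => h.
by rewrite half_profile_out ?mulr0// ltr_pdivlMr//; lra.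
Qed.

Lemma test_support s eps r x : 0 < s -> s < 1 -> 0 < r -> 0 < eps ->
  prod_test (test_factor s eps r) x != 0 -> box eps (eps + 5 * r) (row_of_tuple x).
Proof.
move=> s0 s1 r0 e0 /prodf_neq0 h i; rewrite /= in_itv/= mxE.
have hi := h i isT; have [im|im] := eqVneq i ord_max.
  by move: hi; rewrite im; exact: test_factor_max.
have /andP[h1 h2] := test_factor_other r0 im hi; lra.
Qed.

Lemma integral_test_factor_other_le s eps r i : 0 < r -> i != ord_max ->
  (\int[mu]_t (test_factor s eps r i t)%:E <= (4 * r)%:E)%E.
Proof.
move=> r0 im.
apply: (@le_trans _ _ (\int[mu]_t (\1_(`[(- (2 * r))%R, (2 * r)%R]%classic) t)%:E)%E).
  apply: ge0_le_integral => //.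
  - by move=> t _; rewrite lee_fin test_factor_ge0.
  - by apply/measurable_EFinP; exact: measurable_test_factor.
  - by apply/measurable_EFinP; exact: measurable_indic.
  - move=> t _; rewrite lee_fin indicE.
    have [->|h] := eqVneq (test_factor s eps r i t) 0; first by case: (_ \in _).
    rewrite mem_set; last by rewrite /= in_itv/=; exact: test_factor_other h.
    by rewrite /test_factor (negbTE im) cos_bump_le1.
rewrite integral_indic//= setIT lebesgue_measure_itv/= lte_fin.
by case: ifPn => _; rewrite -?EFinB lee_fin; lra.
Qed.

(** The normal factor is supported in an interval of length 5 r, and at most
    r^s bump_height 5^s there, with 5^s <= 5. *)
Lemma integral_test_factor_max_le s eps r : 0 < s -> s < 1 -> 0 < r ->
  (\int[mu]_t (test_factor s eps r ord_max t)%:E <= (25 * bump_height s * r `^ (1 + s))%:E)%E.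
Proof.
move=> s0 s1 r0.
have A := bump_height_ge s0 s1.
pose c := r `^ s * (bump_height s * 5).
have c0 : 0 <= c by rewrite mulr_ge0 ?powR_ge0//; lra.
apply: (@le_trans _ _ (\int[mu]_t (c%:E * (\1_(`[eps, (eps + 5 * r)%R]%classic) t)%:E))%E).
  apply: ge0_le_integral => //.
  - by move=> t _; rewrite lee_fin test_factor_ge0.
  - by apply/measurable_EFinP; exact: measurable_test_factor.
  - by apply: measurable_funeM; apply/measurable_EFinP; exact: measurable_indic.
  - move=> t _; rewrite -EFinM lee_fin indicE.
    have [->|h] := eqVneq (test_factor s eps r ord_max t) 0.
      by rewrite mulr_ge0.
    have /andP[h1 h2] := test_factor_max s0 s1 r0 h.
    rewrite mem_set; last by rewrite /= in_itv/= h1.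
    rewrite mulr1 /test_factor eqxx ler_wpM2l ?powR_ge0//.
    apply: (le_trans (half_profile_le _ s0 s1)); rewrite ler_wpM2l//; first lra.
    apply: (@le_trans _ _ (pos_pow s 5)).
      by apply: pos_pow_homo; [exact: ltW|rewrite ler_pdivrMr//; lra].
    by rewrite pos_powE// ler1_powR//; lra.
rewrite ge0_integralZl//; last first.
  by apply/measurable_EFinP; exact: measurable_indic.
rewrite integral_indic//= setIT lebesgue_measure_itv/= lte_fin.
rewrite ifT; last by lra.
rewrite -EFinB -EFinM lee_fin /c powRD ?(gt_eqF r0) ?implybT// powRr1; last lra.
by rewrite le_eqVlt; apply/orP; left; apply/eqP; ring.
Qed.

Lemma integral_test_le s eps r : 0 < s -> s < 1 -> 1 <= r ->
  (\int[lam]_x (prod_test (test_factor s eps r) x)%:E <=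
     (4 ^+ n * (25 * bump_height s) * r `^ (N%:R + s))%:E)%E.
Proof.
move=> s0 s1 r1; have r0 : 0 < r by lra.
have A := bump_height_ge s0 s1.
pose c i := fine (\int[mu]_t (test_factor s eps r i t)%:E)%E.
have I0 i : (0 <= \int[mu]_t (test_factor s eps r i t)%:E)%E.
  by apply: integral_ge0 => t _; rewrite lee_fin test_factor_ge0.
have cE i : (\int[mu]_t (test_factor s eps r i t)%:E)%E = (c i)%:E.
  rewrite fineK// ge0_fin_numE//; have [->|im] := eqVneq i ord_max.
    exact: (le_lt_trans (integral_test_factor_max_le _ s0 s1 r0) (ltry _)).
  exact: (le_lt_trans (integral_test_factor_other_le _ _ r0 im) (ltry _)).
rewrite /prod_test (integral_prod_tuple _ _ cE)//; last 2 first.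
- by move=> i; exact: measurable_test_factor.
- by move=> i t; exact: test_factor_ge0.
have c0 i : 0 <= c i by exact: fine_ge0.
rewrite lee_fin big_ord_recr/=.
have -> : 4 ^+ n * (25 * bump_height s) * r `^ (N%:R + s) =
    (4 * r) ^+ n * (25 * bump_height s * r `^ (1 + s)).
  rewrite exprMn (_ : N%:R + s = n%:R + (1 + s)); last by rewrite -addn1 natrD; ring.
  by rewrite powRD ?(gt_eqF r0) ?implybT// powR_mulrn ?ltW//; ring.
apply: ler_pM => //.
- by apply: prodr_ge0.
- apply: (@le_trans _ _ (\prod_(i < n) (4 * r))); last by rewrite prodr_const card_ord.
  apply: ler_prod => i _; rewrite c0/= -lee_fin -cE.
  apply: integral_test_factor_other_le => //.
  by apply/eqP => /(congr1 val)/= h; have := ltn_ord i; rewrite h ltnn.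
- by rewrite -lee_fin -cE; exact: integral_test_factor_max_le.
Qed.

Lemma test_le_weight s eps r x : 0 < s -> s < 1 -> 0 < r ->
  prod_test (test_factor s eps r) x <= bump_height s * depth_weight s eps x.
Proof.
move=> s0 s1 r0; have A := bump_height_ge s0 s1.
rewrite (prod_testE _ ord_max).
have h1 : test_factor s eps r ord_max (tnth x ord_max) <= bump_height s * depth_weight s eps x.
  rewrite /test_factor eqxx /depth_weight (@pos_pow_scale _ s r)// mulrCA.
  by rewrite ler_wpM2l ?powR_ge0// half_profile_le.
rewrite -[leRHS]mulr1; apply: ler_pM => //.
- exact: test_factor_ge0.
- by apply: prodr_ge0 => i _; exact: test_factor_ge0.
- apply: (@le_trans _ _ (\prod_(i < N | i != ord_max) 1)); last by rewrite big1.
  apply: ler_prod => i im; rewrite test_factor_ge0/=.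
  by rewrite /test_factor (negbTE im) cos_bump_le1.
Qed.

(** On the cube of radius r every cosine factor is at least 1 / 2, and the normal
    factor is the weight itself. *)
Lemma weight_le_test s eps r x : 0 < s -> s < 1 -> 0 < r -> 0 < eps ->
  (forall i, `|tnth x i| <= r) ->
  depth_weight s eps x <= 2 ^+ n * prod_test (test_factor s eps r) x.
Proof.
move=> s0 s1 r0 e0 xr.
rewrite /prod_test big_ord_recr/= {2}/test_factor eqxx.
rewrite half_profile_small; last first.
  by rewrite ltr_pdivrMr//; have := xr ord_max; rewrite ler_norml => /andP[_]; lra.
rewrite -pos_pow_scale// -/(depth_weight s eps x) mulrA.
rewrite -[leLHS]mul1r ler_wpM2r ?pos_pow_ge0//.
have -> : 2 ^+ n = \prod_(i < n) (2 : R) by rewrite prodr_const card_ord.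
rewrite -big_split/= -[leLHS](_ : \prod_(i < n) (1 : R) = 1); last by rewrite big1.
apply: ler_prod => i _; rewrite ler01/= /test_factor.
have /negbTE -> : widen_ord (leqnSn n) i != ord_max.
  by apply/eqP => /(congr1 val)/= h; have := ltn_ord i; rewrite h ltnn.
have : 1 / 2 <= cos_bump (tnth x (widen_ord (leqnSn n) i) / r).
  apply: cos_bump_half; rewrite normrM normfV (gtr0_norm r0) ler_pdivrMr// mul1r.
  exact: xr.
lra.
Qed.
End test_family.

(** * Scalar inequalities *)
Section scalar.
Context {R : realType}.

(** If M z^p < c z then z < (c / M)^(1 / (p - 1)), so that c z is at most the second
    term. *)
Lemma young_split (p M c z : R) : 1 < p -> 0 < M -> 0 < c -> 0 <= z ->
  c * z <= Num.min (c * z) (M * z `^ p) + M `^ (- (p - 1)^-1) * c `^ (p / (p - 1)).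
Proof.
move=> p1 M0 c0 z0.
have p10 : 0 < p - 1 by lra.
have D0 : 0 <= M `^ (- (p - 1)^-1) * c `^ (p / (p - 1)) by rewrite mulr_ge0 ?powR_ge0.
have [h|h] := leP (c * z) (M * z `^ p); first by rewrite lerDl.
have zpos : 0 < z.
  rewrite lt_neqAle z0 andbT; apply/eqP => zE; move: h.
  by rewrite -zE mulr0 powR0 ?mulr0 ?ltxx// gt_eqF//; lra.
have h1 : z `^ (p - 1) <= c / M.
  rewrite ler_pdivlMr// -(ler_pM2l zpos) mulrA mulr_powRB1//; last lra.
  by rewrite mulrC (mulrC z); exact: ltW.
have h2 : z <= (c / M) `^ (p - 1)^-1.
  rewrite -[leLHS](_ : (z `^ (p - 1)) `^ (p - 1)^-1 = z); last first.
    by rewrite -powRrM divff ?gt_eqF// powRr1.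
  apply: ge0_ler_powR => //; rewrite ?nnegrE ?powR_ge0 ?invr_ge0 ?ltW//.
  by rewrite divr_gt0.
apply: (@le_trans _ _ (M `^ (- (p - 1)^-1) * c `^ (p / (p - 1)))); last first.
  by rewrite lerDr mulr_ge0 ?powR_ge0// ltW.
have -> : M `^ (- (p - 1)^-1) * c `^ (p / (p - 1)) = c * (c / M) `^ (p - 1)^-1.
  rewrite powRM ?invr_ge0 ?ltW// -(powR_inv1 (ltW M0)) -powRrM mulN1r mulrA mulrC.
  congr (_ * _); have -> : p / (p - 1) = 1 + (p - 1)^-1 by field; rewrite gt_eqF.
  by rewrite powRD ?(gt_eqF c0) ?implybT// powRr1// ltW.
by rewrite ler_pM2l.
Qed.

(** The exponent of r in the error term of Young's inequality for test functions
    of mass r^(N + s) and eigenvalue r^(- 2 s). *)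
Lemma critical_exponent_le (s p N : R) : 0 < s -> s < N -> 1 < p ->
  p <= (N + s) / (N - s) -> N + s - 2 * s * (p / (p - 1)) <= 0.
Proof.
move=> s0 sN p1; rewrite ler_pdivlMr; last lra.
move=> hp; rewrite subr_le0 mulrA ler_pdivlMr; last lra.
nra.
Qed.
End scalar.

(** * Vanishing at positive depth *)
Section interior.
Context {R : realType} (n : nat).
Local Notation mu := (@lebesgue_measure R).
Local Notation T := (measurableTypeR R).
Local Notation N := n.+1.
Local Notation lam := (@lebesgue_tuple R N).
Variables (s p eps : R) (u : 'rV[R]_N -> R) (v : N.-tuple T -> R) (Z : set (N.-tuple T)).
Hypotheses (s0 : 0 < s) (s1 : s < 1) (p1 : 1 < p).
Hypothesis hp : p <= (N%:R + s) / (N%:R - s).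
Hypotheses (mv : measurable_fun setT v) (v0 : forall x, 0 <= v x).
Hypotheses (mZ : measurable Z) (Z0 : lam Z = 0%E).
Hypothesis uv : forall x, ~ Z x -> u (row_of_tuple x) = v x.
Hypothesis C2 : C2_on (@half_space R n) u.
Hypothesis sol : pointwise_supersolution s p u.
Hypothesis eps0 : 0 < eps.

Let r (k : nat) : R := k.+1%:R.
Let phi k := prod_test (test_factor s eps (r k) : 'I_N -> R -> R).
Let w := @depth_weight R n s eps.
Let X k := (\int[lam]_x (v x `^ p * phi k x)%:E)%E.
Let Lam := Cs s * N%:R * eigen_cst s.
Let c k := Lam * r k `^ (- (2 * s)).
Let A := bump_height s.

Let r1 k : 1 <= r k. Proof. by rewrite /r ler1n. Qed.
Let r0 k : 0 < r k. Proof. by rewrite /r ltr0n. Qed.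
Let A0 : 0 < A.
Proof. by have := bump_height_ge s0 s1; apply: lt_le_trans; rewrite ltr0n. Qed.
Let phi0 k x : 0 <= phi k x.
Proof. by apply: prod_test_ge0 => i t; exact: test_factor_ge0. Qed.
Let mphi k : measurable_fun setT (phi k).
Proof. by apply: measurable_prod_test => i; exact: measurable_test_factor. Qed.
Let w0 x : 0 <= w x. Proof. exact: pos_pow_ge0. Qed.
Let mw : measurable_fun setT w.
Proof.
apply: (measurableT_comp (measurable_pos_pow s)).
by apply: measurable_funB => //; exact: measurable_tnth.
Qed.
Let mvp : measurable_fun setT (fun x => v x `^ p).
Proof. exact: (measurableT_comp (measurable_powR p)). Qed.
Let Lam0 : 0 < Lam.
Proof.
rewrite /Lam mulr_gt0//; first by rewrite mulr_gt0 ?ltr0n// Cs_gt0.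
have h1 := s0; have h2 := s1.
by rewrite /eigen_cst addr_gt0// invr_gt0//; lra.
Qed.
Let c0 k : 0 < c k. Proof. by rewrite mulr_gt0 ?powR_gt0. Qed.

Let fin_vphi k : (\int[lam]_x (v x * phi k x)%:E < +oo)%E.
Proof.
have [M M0 HM] := @bounded_on_compact R n u _ (@compact_box R n eps (eps + 5 * r k))
   (fun x bx => let: And3 h _ _ := C2 (box_half_space eps0 bx) in h).
apply: (@le_lt_trans _ _ (\int[lam]_x (M%:E * (phi k x)%:E))%E).
  apply: ae_ge0_le_integral => //.
  - by move=> x _; rewrite lee_fin mulr_ge0.
  - by apply/measurable_EFinP; exact: measurable_funM.
  - by move=> x _; rewrite -EFinM lee_fin mulr_ge0.
  - by apply: measurable_funeM; apply/measurable_EFinP.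
  exists Z; split => // x /= H; apply: contrapT => nZ; apply: H => _.
  rewrite -EFinM lee_fin; have [->|h] := eqVneq (phi k x) 0; first by rewrite !mulr0.
  rewrite ler_wpM2r// -uv//; apply: le_trans (ler_norm _) _.
  by apply: HM; exact: (test_support s0 s1 (r0 k) eps0 h).
rewrite ge0_integralZl//; last 2 first.
- by apply/measurable_EFinP.
- by move=> x _; rewrite lee_fin.
have P := @integral_test_le R n s eps (r k) s0 s1 (r1 k).
apply: (@le_lt_trans _ _ (M%:E * (4 ^+ n * (25 * bump_height s) * r k `^ (N%:R + s))%:E)%E).
  by rewrite lee_wpmul2l.
by rewrite -EFinM ltry.
Qed.

Let X_le k : (X k <= (c k)%:E * \int[lam]_x (v x * phi k x)%:E)%E.
Proof.
have -> : c k = Cs s * N%:R * (r k `^ (- (2 * s)) * eigen_cst s).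
  by rewrite /c /Lam; ring.
have P := @integral_test_le R n s eps (r k) s0 s1 (r1 k).
apply: (test_inequality (a := eps) (L := eps + 5 * r k) s0 s1 mv v0 mZ Z0 uv C2 sol) => //.
- by move=> i; exact: measurable_test_factor.
- by move=> i t; exact: test_factor_ge0.
- by rewrite mulr_ge0 ?powR_ge0// eigen_cst_ge0.
- by move=> i eta y e0 e1; exact: subeigen_test_factor.
- by move=> x; exact: test_support.
- exact: (le_lt_trans P (ltry _)).
- exact: fin_vphi.
Qed.

Let C1 := Lam `^ (p / (p - 1)) * (4 ^+ n * (25 * A)).
Let C10 : 0 <= C1.
Proof. by rewrite mulr_ge0 ?powR_ge0// mulr_ge0 ?exprn_ge0// mulr_ge0// ltW. Qed.

Let error_le k : ((c k `^ (p / (p - 1)))%:E * \int[lam]_x (phi k x)%:E <= C1%:E)%E.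
Proof.
have P := @integral_test_le R n s eps (r k) s0 s1 (r1 k).
apply: (@le_trans _ _ ((c k `^ (p / (p - 1)))%:E * (4 ^+ n * (25 * A) * r k `^ (N%:R + s))%:E)%E).
  by rewrite lee_wpmul2l// lee_fin powR_ge0.
rewrite -EFinM lee_fin /c powRM ?powR_ge0 ?(ltW Lam0)// -powRrM.
set q := p / (p - 1).
have -> : Lam `^ q * r k `^ (- (2 * s) * q) * (4 ^+ n * (25 * A) * r k `^ (N%:R + s)) =
   C1 * (r k `^ (N%:R + s) * r k `^ (- (2 * s) * q)) by rewrite /C1; ring.
rewrite -powRD; last by rewrite (gt_eqF (r0 k)) implybT.
rewrite -[leRHS]mulr1 ler_wpM2l//.
rewrite -[leRHS](powRr0 (r k)) ler_powR//.
have N1 : (1 : R) <= N%:R by rewrite ler1n.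
have := critical_exponent_le s0 (lt_le_trans s1 N1) p1 hp.
by rewrite -/q; lra.
Qed.

Let g M k (x : N.-tuple T) : R := Num.min (c k * v x) (M * v x `^ p).

Let g0 M k x : 0 < M -> 0 <= g M k x.
Proof. by move=> M0; rewrite /g le_min; apply/andP; split; apply: mulr_ge0 => //; rewrite ?powR_ge0// ltW. Qed.

Let mg M k : measurable_fun setT (g M k).
Proof. by apply: measurable_minr; exact: measurable_funM. Qed.

(** [test_inequality] with the linear term split by [young_split]. *)
Let X_split M k : 0 < M ->
  (X k <= \int[lam]_x (g M k x * phi k x)%:E + (M `^ (- (p - 1)^-1) * C1)%:E)%E.
Proof.
move=> M0; set D := M `^ (- (p - 1)^-1).
have D0 : 0 <= D by exact: powR_ge0.
have ck0 := c0 k.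
apply: (le_trans (X_le k)).
have E0 : 0 <= D * c k `^ (p / (p - 1)) by rewrite mulr_ge0 ?powR_ge0.
rewrite -ge0_integralZl//; last 3 first.
- by apply/measurable_EFinP; exact: measurable_funM.
- by move=> x _; rewrite lee_fin mulr_ge0.
- by rewrite lee_fin ltW.
apply: (@le_trans _ _ (\int[lam]_x ((g M k x * phi k x)%:E +
   (D * c k `^ (p / (p - 1)))%:E * (phi k x)%:E))%E).
  apply: ge0_le_integral => //.
  - by move=> x _; rewrite -EFinM lee_fin; apply: mulr_ge0; [exact: ltW|exact: mulr_ge0].
  - by apply: measurable_funeM; apply/measurable_EFinP; exact: measurable_funM.
  - apply: emeasurable_funD; last by apply: measurable_funeM; apply/measurable_EFinP.
    by apply/measurable_EFinP; exact: measurable_funM.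
  - move=> x _; rewrite -!EFinM -EFinD lee_fin mulrA -mulrDl ler_wpM2r//.
    exact: young_split.
rewrite ge0_integralD//; last 4 first.
- by move=> x _; rewrite lee_fin mulr_ge0// g0.
- by apply/measurable_EFinP; exact: measurable_funM.
- by move=> x _; rewrite -EFinM lee_fin mulr_ge0.
- by apply: measurable_funeM; apply/measurable_EFinP.
rewrite leeD2l// ge0_integralZl//; last 2 first.
- by apply/measurable_EFinP.
- by move=> x _; rewrite lee_fin.
rewrite !EFinM -muleA lee_wpmul2l//; exact: error_le.
Qed.

Let X_sup := 2 * (2^-1 `^ (- (p - 1)^-1) * C1).

(** M = 1/2 bounds the integral of the minimum by half of X k, which is finite and
    can be absorbed. *)
Let X_bound k : (X k <= X_sup%:E)%E.
Proof.
have X0 : (0 <= X k)%E.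
  by apply: integral_ge0 => x _; rewrite lee_fin mulr_ge0 ?powR_ge0.
have Xfin : X k \is a fin_num.
  rewrite ge0_fin_numE//; apply: (le_lt_trans (X_le k)).
  have I0 : (0 <= \int[lam]_x (v x * phi k x)%:E)%E.
    by apply: integral_ge0 => x _; rewrite lee_fin mulr_ge0.
  have : (\int[lam]_x (v x * phi k x)%:E)%E \is a fin_num by rewrite ge0_fin_numE.
  by move=> h; rewrite -(fineK h) -EFinM ltry.
have h2 : 0 < (2^-1 : R) by rewrite invr_gt0.
have H := X_split k h2.
have : (\int[lam]_x (g 2^-1 k x * phi k x)%:E <= 2^-1%:E * X k)%E.
  rewrite -ge0_integralZl//; last 2 first.
  - by apply/measurable_EFinP; exact: measurable_funM.
  - by move=> x _; rewrite lee_fin mulr_ge0 ?powR_ge0.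
  apply: ge0_le_integral => //.
  - by move=> x _; rewrite lee_fin mulr_ge0// g0.
  - by apply/measurable_EFinP; exact: measurable_funM.
  - by apply: measurable_funeM; apply/measurable_EFinP; exact: measurable_funM.
  - by move=> x _; rewrite -EFinM lee_fin mulrA ler_wpM2r// /g ge_min lexx orbT.
move=> /(leeD) /(_ (lexx (2^-1 `^ (- (p - 1)^-1) * C1)%:E)) /(le_trans H).
rewrite -(fineK Xfin) -EFinM -EFinD !lee_fin /X_sup.
set a := fine (X k); set b := _ * C1; move: a b => a b h.
lra.
Qed.

Let cube (m : nat) : set (N.-tuple T) := [set x | forall i, `|tnth x i| <= m%:R].

Let mcube m : measurable (cube m).
Proof.
have -> : cube m = \bigcap_(i in [set: 'I_N]) [set x | `|tnth x i| <= m%:R].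
  by apply/seteqP; split => x /= h i; [move=> _|]; exact: h.
apply: fin_bigcap_measurable => // i _.
have mi : measurable_fun setT (fun x : N.-tuple T => `|tnth x i : R|).
  apply: (measurableT_comp (@normr_measurable R setT)); exact: measurable_tnth.
have := mi measurableT _ (measurable_itv `]-oo, (m%:R : R)]).
rewrite setTI; congr (measurable _); apply/seteqP; split => x /=; by rewrite in_itv.
Qed.

Let F x := (w x * v x `^ p)%:E.
Let F0 x : (0 <= F x)%E. Proof. by rewrite lee_fin mulr_ge0 ?powR_ge0. Qed.
Let mF : measurable_fun setT F.
Proof. by apply/measurable_EFinP; exact: measurable_funM. Qed.

Let cube_le m k : (m <= k)%N -> (\int[lam]_(x in cube m) F x <= (2 ^+ n)%:E * X k)%E.
Proof.
move=> mk; rewrite -ge0_integralZl//; last 2 first.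
- by apply/measurable_EFinP; exact: measurable_funM.
- by move=> x _; rewrite lee_fin mulr_ge0 ?powR_ge0.
apply: (@le_trans _ _ (\int[lam]_(x in cube m) ((2 ^+ n)%:E * (v x `^ p * phi k x)%:E))%E).
  apply: ge0_le_integral => //.
  - exact: measurable_funTS.
  - apply: measurable_funTS; apply: measurable_funeM; apply/measurable_EFinP.
    exact: measurable_funM.
  - move=> x xm; rewrite -EFinM lee_fin mulrCA mulrC ler_wpM2l ?powR_ge0//.
    apply: weight_le_test => // i; apply: le_trans (xm i) _.
    by rewrite ler_nat; apply: leq_trans mk _.
apply: ge0_subset_integral => //.
- by apply: measurable_funeM; apply/measurable_EFinP; exact: measurable_funM.
- by move=> x _; rewrite -EFinM lee_fin mulr_ge0 ?exprn_ge0// mulr_ge0 ?powR_ge0.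
Qed.

Let cube_lim : (\int[lam]_(x in cube m) F x @[m --> \oo] --> \int[lam]_x F x)%E.
Proof.
have -> : [set: N.-tuple T] = \bigcup_m cube m.
  apply/seteqP; split => // x _.
  exists (Num.truncn (\sum_i `|tnth x i : R|)).+1 => // i.
  apply: le_trans (ltW (truncnS_gt _)); rewrite (bigD1 i)//= lerDl.
  by rewrite sumr_ge0.
apply: ge0_nondecreasing_set_cvg_integral => //.
- move=> a b ab; rewrite subsetEset => x xa i; apply: le_trans (xa i) _.
  by rewrite ler_nat.
- by move=> m; exact: measurable_funTS.
Qed.

Let F_finite : (\int[lam]_x F x < +oo)%E.
Proof.
apply: (@le_lt_trans _ _ (2 ^+ n * X_sup)%:E); last exact: ltry.
rewrite -(cvg_lim _ cube_lim)//; apply: lime_le; first exact: (cvgP _ cube_lim).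
apply: nearW => m; apply: (le_trans (cube_le (leqnn m))).
by rewrite EFinM lee_wpmul2l ?X_bound// lee_fin exprn_ge0.
Qed.

Let c_cvg0 : c k @[k --> \oo] --> (0 : R).
Proof.
have h : (0 : R) < 2 * s by rewrite mulr_gt0.
have H := powRN_cvgy h.
rewrite -(mulr0 Lam); apply: cvgMr.
apply: (cvg_comp r _ _ H); rewrite /r.
by have := @cvgr_idn R; rewrite -(@cvg_shiftS _ (fun k => k%:R : R)).
Qed.

(** The minimum is at most c k v, which tends to 0, and at most M v^p, which is
    integrable against the weight. *)
Let g_cvg0 M : 0 < M ->
  (\int[lam]_x (g M k x * (A * w x))%:E @[k --> \oo] --> 0)%E.
Proof.
move=> M0.
have [|||||_ _] := @dominated_convergence _ _ R lam setT measurableT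
  (fun k x => (g M k x * (A * w x))%:E) (cst 0%E) (fun x => (M * A)%:E * F x)%E.
- move=> k; apply/measurable_EFinP; apply: measurable_funM => //.
  exact: measurable_funM.
- exact: measurable_cst.
- apply: aeW => x _; apply: cvg_EFin; first exact: nearW.
  rewrite -[X in _ --> X](mul0r (A * w x)); apply: cvgMl.
  apply: (@squeeze_cvgr _ _ _ _ (fun=> 0) (fun k => c k * v x)).
  + by apply: nearW => k; rewrite g0//= /g ge_min lexx.
  + exact: cvg_cst.
  + by rewrite -(mul0r (v x)); apply: cvgMl.
- apply/integrableP; split; first exact: measurable_funeM.
  have MA0 : (0 <= (M * A)%:E)%E by rewrite lee_fin; apply: mulr_ge0; exact: ltW.
  have e1 x : (`|(M * A)%:E * F x| = (M * A)%:E * F x)%E.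
    by rewrite gee0_abs// mule_ge0.
  under eq_integral do rewrite e1.
  rewrite ge0_integralZl//.
  have I0 : (0 <= \int[lam]_x F x)%E by exact: integral_ge0.
  have h : (\int[lam]_x F x)%E \is a fin_num by rewrite ge0_fin_numE.
  by rewrite -(fineK h) -EFinM ltry.
- apply: aeW => x k _.
  have gk := g0 k x M0.
  have Aw : 0 <= A * w x by rewrite mulr_ge0// ltW.
  rewrite gee0_abs; last by rewrite lee_fin mulr_ge0.
  rewrite /F -EFinM lee_fin.
  have -> : M * A * (w x * v x `^ p) = (M * v x `^ p) * (A * w x) by ring.
  by rewrite ler_wpM2r// /g ge_min lexx orbT.
by rewrite integral0.
Qed.

(** After k tends to infinity only the error M^(- 1 / (p - 1)) C1 is left, and M is
    chosen to make it small. *)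
Let F_zero : (\int[lam]_x F x = 0)%E.
Proof.
have cube0 m : (\int[lam]_(x in cube m) F x = 0)%E.
  apply/eqP; rewrite eq_le integral_ge0// andbT; apply/lee_addgt0Pr => e epos.
  rewrite add0e.
  set K := 2 ^+ n * C1 + 1.
  have K0 : 0 < K by rewrite ltr_wpDl// mulr_ge0// exprn_ge0.
  (* So that M^(- 1 / (p - 1)) = e / K. *)
  pose M := (e / K) `^ (- (p - 1)).
  have M0 : 0 < M by rewrite powR_gt0// divr_gt0.
  have p10 : 0 < p - 1 by rewrite subr_gt0.
  have ME : M `^ (- (p - 1)^-1) = e / K.
    rewrite /M -powRrM mulrNN divff ?gt_eqF// powRr1//.
    by rewrite divr_ge0// ltW.
  have H k : (m <= k)%N -> (\int[lam]_(x in cube m) F x <=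
     (2 ^+ n)%:E * \int[lam]_x (g M k x * (A * w x))%:E + e%:E)%E.
    move=> mk; apply: (le_trans (cube_le mk)).
    have t0 : (0 <= (2 ^+ n)%:E :> \bar R)%E by rewrite lee_fin exprn_ge0.
    apply: (le_trans (lee_wpmul2l t0 (X_split k M0))).
    rewrite muleDr//; last exact: fin_num_adde_defl.
    apply: leeD.
      rewrite lee_wpmul2l//; apply: ge0_le_integral => //.
      - by move=> x _; rewrite lee_fin mulr_ge0// g0.
      - by apply/measurable_EFinP; exact: measurable_funM.
      - by apply/measurable_EFinP; apply: measurable_funM => //; exact: measurable_funM.
      - move=> x _; rewrite lee_fin ler_wpM2l ?g0//.
        exact: test_le_weight.
    rewrite -EFinM lee_fin ME mulrCA mulrAC ler_pdivrMr// ler_pM2l//.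
    by rewrite /K lerDl.
  have L : ((2 ^+ n)%:E * \int[lam]_x (g M k x * (A * w x))%:E + e%:E @[k --> \oo] --> e%:E)%E.
    rewrite -[X in _ --> X]add0e; apply: cvgeD => //; last exact: cvg_cst.
    rewrite -(mule0 (2 ^+ n)%:E); apply: cvgeZl => //; exact: g_cvg0.
  rewrite -(cvg_lim _ L)//; apply: lime_ge; first exact: (cvgP _ L).
  by exists m => // k /= mk; exact: H.
have L := cube_lim.
rewrite -(cvg_lim _ L)//; under eq_fun do rewrite cube0.
exact: lim_cst.
Qed.

Lemma ae_zero_above : {ae lam, forall x, eps < tnth x ord_max -> v x = 0}.
Proof.
have : ae_eq lam setT F (cst 0%E).
  apply/(ae_eq_integral_abs lam measurableT mF).
  by rewrite -[RHS]F_zero; apply: eq_integral => x _; rewrite gee0_abs.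
apply: filterS => x /(_ I) [] /eqP; rewrite mulf_eq0 => /orP[/eqP h|/eqP /powR_eq0_eq0//] xe.
move: h; rewrite /w /depth_weight pos_powE; last by rewrite subr_ge0 ltW.
by move=> /powR_eq0_eq0 /eqP; rewrite subr_eq0 gt_eqF.
Qed.
End interior.

(** * Null sets and vanishing of the exterior values *)
Section conclusion.
Context {R : realType}.
Local Notation mu := (@lebesgue_measure R).
Local Notation T := (measurableTypeR R).

(** A cube of side 2 e has positive measure, so it is not contained in Z. *)
Lemma null_set_complement_dense (N : nat) (Z : set (N.-tuple T)) (y : N.-tuple T) (e : R) :
  measurable Z -> lebesgue_tuple N Z = 0%E -> 0 < e ->
  exists2 x, ~ Z x & forall i, `|tnth x i - tnth y i| < e.
Proof.
move=> mZ Z0 e0; apply: contrapT => H.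
pose B (i : 'I_N) : set R := `](tnth y i - e), (tnth y i + e)[%classic.
have mB i : measurable (B i) by exact: measurable_itv.
have cE i : (\int[mu]_t (\1_(B i) t)%:E)%E = (2 * e)%:E.
  rewrite integral_indic; [|exact: measurableT|exact: mB].
  rewrite setIT /B/= lebesgue_measure_itv/= lte_fin ifT; last lra.
  by rewrite -EFinB; congr EFin; ring.
have B0 : forall (i : 'I_N) (t : R), 0 <= (\1_(B i) t : R) by [].
have := @integral_prod_tuple R N (fun i => \1_(B i)) (fun=> 2 * e)
  (fun i => measurable_indic (mB i)) B0 cE.
apply/eqP; rewrite lt_eqF//.
apply: (@le_lt_trans _ _ 0%E); last by rewrite lte_fin prodr_gt0// => i _; lra.
rewrite -Z0 -[leRHS]/(lebesgue_tuple N Z).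
have -> : lebesgue_tuple N Z = (\int[lebesgue_tuple N]_x (\1_Z x)%:E)%E.
  by rewrite integral_indic// setIT.
apply: ge0_le_integral => //.
- by move=> x _; rewrite lee_fin prodr_ge0.
- apply/measurable_EFinP; apply: measurable_prod => i _.
  by apply: (measurableT_comp (measurable_indic (mB i))); exact: measurable_tnth.
- by apply/measurable_EFinP.
move=> x _; rewrite lee_fin.
have [/forallP xB|] := boolP [forall i, tnth x i \in B i]; last first.
  rewrite negb_forall => /existsP[i /negbTE xi].
  by rewrite (bigD1 i)//= indicE xi mul0r.
rewrite big1 ?indicE; last by move=> i _; rewrite indicE xB.
rewrite mem_set//; apply: contrapT => nZ; apply: H; exists x => // i.
have := set_mem (xB i); rewrite /B/= in_itv/= => /andP[h1 h2].
by rewrite ltr_norml; lra.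
Qed.

(** By symmetry, the integral over the half-space of the far part of v is the
    integral of v against the far part of the indicator of the half-space. The
    latter is positive everywhere, since every vertical line enters the
    half-space. *)
Lemma ae_zero_of_half_space (n : nat) (s : R) (v : n.+1.-tuple T -> R) :
  0 < s -> measurable_fun setT v -> (forall x, 0 <= v x) ->
  {ae lebesgue_tuple n.+1, forall x, 0 < tnth x ord_max ->
     far_part s 1%R v ord_max x = 0%E} ->
  {ae lebesgue_tuple n.+1, forall x, v x = 0}.
Proof.
move=> s0 mv v0 Hfar.
have [h [mh h0 h1 hz]] : exists h : n.+1.-tuple T -> R, [/\ measurable_fun setT h,
    forall x, 0 <= h x, forall x, 0 < tnth x ord_max -> h x = 1
    & forall x, tnth x ord_max <= 0 -> h x = 0].
  pose H : set (n.+1.-tuple T) := [set x | 0 < tnth x ord_max].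
  have mH : measurable H.
    have := (@measurable_tnth _ T n.+1 ord_max) measurableT _ (measurable_itv `]0, +oo[).
    by rewrite setTI; congr measurable; apply/seteqP; split => x /=; rewrite in_itv/= andbT.
  exists \1_H; split.
  - exact: measurable_indic.
  - by [].
  - by move=> x x0; rewrite indicE mem_set.
  - by move=> x x0; rewrite indicE memNset// /H/= ltNge x0.
have mfv := @measurable_far_part R n s 1 v ord_max mv v0.
have mfH := @measurable_far_part R n s 1 _ ord_max mh h0.
have mvf : measurable_fun setT (fun x => (v x)%:E * far_part s 1%R h ord_max x)%E.
  by apply: emeasurable_funM => //; apply/measurable_EFinP.
have L0 : (\int[lebesgue_tuple n.+1]_x ((h x)%:E * far_part s 1%R v ord_max x) = 0)%E.
  rewrite -(integral0 (@lebesgue_tuple R n.+1) setT); apply: ge0_ae_eq_integral => //.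
  - by apply: emeasurable_funM => //; apply/measurable_EFinP.
  - by move=> x _; apply: mule_ge0; [rewrite lee_fin|exact: far_part_ge0].
  move: Hfar; apply: (@filterS _ _ (ae_filter_ringOfSetsType (@lebesgue_tuple R n.+1))) => x hx _.
  have [x0|x0] := ltP 0 (tnth x ord_max); first by rewrite hx// mule0.
  by rewrite hz// mul0e.
have vf0 x : (0 <= (v x)%:E * far_part s 1%R h ord_max x)%E.
  by apply: mule_ge0; [rewrite lee_fin|exact: far_part_ge0].
have : ae_eq (@lebesgue_tuple R n.+1) setT (fun x => (v x)%:E * far_part s 1%R h ord_max x)%E (cst 0%E).
  apply/(ae_eq_integral_abs (@lebesgue_tuple R n.+1) measurableT mvf).
  by rewrite -[RHS]L0 (far_part_sym s 1 ord_max mh h0 mv v0); apply: eq_integral => x _; rewrite gee0_abs.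
apply: (@filterS _ _ (ae_filter_ringOfSetsType (@lebesgue_tuple R n.+1))) => x /(_ I) /= /eqP; rewrite mule_eq0 => /orP[/eqP[]//|/eqP far0].
exfalso.
(* Moving up by more than tau leads from x into the half-space. *)
pose tau : R := Num.max 1 `|tnth x ord_max|.
have tau0 : 0 < tau by rewrite lt_max ltr01.
have : (\int[mu]_(t in `]tau, +oo[) (kern s t)%:E <= far_part s 1%R h ord_max x)%E.
  apply: (@le_trans _ _ (\int[mu]_(t in `]tau, +oo[) (two_sided h ord_max x t * kern s t)%:E)%E).
    apply: ge0_le_integral => //.
    - by move=> t _; rewrite lee_fin kern_ge0.
    - by apply: measurable_funTS; exact: measurable_EFin_kern.
    - apply: measurable_funTS; apply/measurable_EFinP; apply: measurable_funM; last exact: measurable_kern.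
      exact: measurable_two_sided.
    move=> t /=; rewrite in_itv/= andbT /tau gt_max => /andP[t1 tx].
    rewrite lee_fin -[leLHS]mul1r ler_wpM2r ?kern_ge0// /two_sided.
    rewrite [X in X + _](_ : _ = 1) ?lerDl// h1//.
    rewrite tnth_tshift eqxx; move: tx; rewrite ltr_norml; lra.
  apply: ge0_subset_integral => //.
  - apply: measurable_funTS; apply/measurable_EFinP; apply: measurable_funM; last exact: measurable_kern.
    exact: measurable_two_sided.
  - by move=> t _; rewrite lee_fin mulr_ge0 ?kern_ge0// /two_sided addr_ge0.
  - move=> t /=; rewrite !in_itv/= !andbT; apply: le_lt_trans.
    by rewrite le_max lexx.
rewrite far0 integral_kern// lee_fin leNgt divr_gt0 ?powR_gt0//.
by rewrite mulr_gt0.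
Qed.
End conclusion.

(** * Borel representatives and the Liouville theorem *)
Section reduction.
Context {R : realType} (n : nat).
Local Notation mu := (@lebesgue_measure R).
Local Notation T := (measurableTypeR R).
Local Notation N := n.+1.

(** The representative is replaced by its positive part, which only changes it on
    a null set. *)
Lemma borel_representative (s : R) (u : 'rV[R]_N -> R) : Ls_bar s u ->
  (forall x, half_space x -> 0 <= u x) ->
  ae_Rn (fun x => ~ half_space x -> 0 <= u x) ->
  exists v : N.-tuple T -> R, exists Z : set (N.-tuple T),
    [/\ measurable_fun setT v, forall x, 0 <= v x, measurable Z,
        lebesgue_tuple N Z = 0%E & forall x, ~ Z x -> u (row_of_tuple x) = v x].
Proof.
move=> [g [[Z1 [mZ1 Z10 HZ1]] [mg _] _]] uin [Z2 [mZ2 Z20 HZ2]].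
exists (fun x => Num.max (g (row_of_tuple x)) 0), (Z1 `|` Z2); split.
- exact: measurable_maxr.
- by move=> x; rewrite le_max lexx orbT.
- exact: measurableU.
- apply/eqP; rewrite -measure_le0; apply: (le_trans (measureU2 _ mZ1 mZ2)).
  by rewrite [X in (X + _)%E]Z10 [X in (_ + X)%E]Z20 adde0.
move=> x /not_orP[n1 n2].
have ug : u (row_of_tuple x) = g (row_of_tuple x).
  by apply: contrapT => h; apply: n1; apply: HZ1.
rewrite -ug max_l//; have [h|h] := pselect (half_space (row_of_tuple x)).
  exact: uin.
by apply: contrapT => h2; apply: n2; apply: HZ2 => /= /(_ h).
Qed.

Definition tuple_of_row (y : 'rV[R]_N) : N.-tuple T := [tuple y ord0 i | i < N].

(** A continuous function that vanishes almost everywhere on an open set vanishes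
    there. *)
Lemma interior_zero (u : 'rV[R]_N -> R) (v : N.-tuple T -> R) (Z : set (N.-tuple T)) :
  measurable Z -> lebesgue_tuple N Z = 0%E ->
  (forall x, ~ Z x -> u (row_of_tuple x) = v x) ->
  (forall x, half_space x -> {for x, continuous u}) ->
  (forall eps, 0 < eps ->
    {ae lebesgue_tuple N, forall x, eps < tnth x ord_max -> v x = 0}) ->
  forall y, half_space y -> u y = 0.
Proof.
move=> mZ Z0 uv cu Hv y Hy; apply/eqP; apply: contrapT => /negP uy.
have [Z' [mZ' Z'0 HZ']] := Hv (y ord0 ord_max / 2) (divr_gt0 Hy (ltr0Sn _ _)).
have : \forall x \near y, u x != 0.
  have := cu _ Hy; move=> /cvgrPdist_lt /(_ `|u y|); rewrite normr_gt0 => /(_ uy).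
  apply: filterS => x; apply: contraTN => /eqP ->.
  by rewrite subr0 ltxx.
move=> /nbhs_ballP[e /= e0 He].
pose d := Num.min e (y ord0 ord_max / 2).
have d0 : 0 < d by rewrite lt_min e0 divr_gt0.
have mZZ : measurable (Z `|` Z') by exact: measurableU.
have ZZ0 : lebesgue_tuple N (Z `|` Z') = 0%E.
  apply/eqP; rewrite -measure_le0; apply: (le_trans (measureU2 _ mZ mZ')).
  by rewrite [X in (X + _)%E]Z0 [X in (_ + X)%E]Z'0 adde0.
have [x /not_orP[n1 n2] hx] :=
  @null_set_complement_dense R N _ (tuple_of_row y) d mZZ ZZ0 d0.
have xy i : `|tnth x i - y ord0 i| < d by have := hx i; rewrite tnth_mktuple.
have : u (row_of_tuple x) != 0.
  apply: He; split => // i j; rewrite /ball/= mxE (ord1 i) distrC.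
  by apply: lt_le_trans (xy j) _; rewrite /d ge_min lexx.
rewrite (uv _ n1) => /eqP; apply; apply: contrapT => h; apply: n2; apply: HZ' => /= h2.
apply: h; apply: h2.
have : `|tnth x ord_max - y ord0 ord_max| < y ord0 ord_max / 2.
  by apply: lt_le_trans (xy _) _; rewrite /d ge_min lexx orbT.
by rewrite ltr_norml => /andP[]; lra.
Qed.

(** If u vanishes in the half-space, each second difference at an interior point
    is nonnegative, while the supersolution inequality makes their integrals sum
    to at most 0. *)
Lemma far_part_zero (s p : R) (u : 'rV[R]_N -> R) (v : N.-tuple T -> R)
    (Z : set (N.-tuple T)) : 0 < s -> s < 1 -> p != 0 ->
  measurable_fun setT v -> (forall x, 0 <= v x) ->
  measurable Z -> lebesgue_tuple N Z = 0%E ->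
  (forall x, ~ Z x -> u (row_of_tuple x) = v x) ->
  pointwise_supersolution s p u -> (forall y, half_space y -> u y = 0) ->
  {ae lebesgue_tuple N, forall x, 0 < tnth x ord_max ->
     far_part s 1 v ord_max x = 0%E}.
Proof.
move=> s0 s1 p0 mv v0 mZ Z0 uv sol uH.
have C0 := Cs_gt0 s0 s1.
apply: filterS (ae_good_line mZ Z0) => x gx xH.
have xH' : half_space (row_of_tuple x) by rewrite /half_space/= mxE.
have [Hdef] := sol _ xH'.
rewrite uH// powR0// oppr_ge0 => Iop.
have vx : v x = 0 by rewrite -(uv _ gx.1) uH.
pose J i := \int[mu]_t (two_sided v i x t * kern s t).
have tr i : mu.-integrable setT (fun t => (two_sided v i x t * kern s t)%:E) /\
    I_dir s i u (row_of_tuple x) = Cs s / 2 * J i.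
  have := good_line_transfer mv mZ uv gx (Hdef i); rewrite vx mulr0.
  by under eq_fun do rewrite subr0; under eq_Rintegral do rewrite subr0.
have J0 i : 0 <= J i.
  apply: Rintegral_ge0 => t _; rewrite mulr_ge0 ?kern_ge0//.
  by rewrite /two_sided addr_ge0.
have Jm : J ord_max = 0.
  apply/eqP; rewrite eq_le J0 andbT.
  have : Cs s / 2 * J ord_max <= 0.
    apply: le_trans Iop; rewrite /I_op (bigD1 ord_max)//= (tr ord_max).2 lerDl.
    by apply: sumr_ge0 => i _; rewrite (tr i).2 mulr_ge0// divr_ge0// ltW.
  by rewrite pmulr_rle0// divr_gt0.
apply/eqP; rewrite eq_le far_part_ge0// andbT.
have fin : (\int[mu]_t (two_sided v ord_max x t * kern s t)%:E)%E \is a fin_num.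
  exact: integrable_fin_num (tr ord_max).1.
apply: (@le_trans _ _ (\int[mu]_t (two_sided v ord_max x t * kern s t)%:E)%E).
  apply: ge0_subset_integral => //.
  - exact: measurable_int (tr ord_max).1.
  - by move=> t _; rewrite lee_fin mulr_ge0 ?kern_ge0// /two_sided addr_ge0.
by rewrite -(fineK fin) lee_fin -[leLHS]/(J ord_max) Jm.
Qed.
End reduction.

Unset Implicit Arguments.

Theorem theorem1p6 (R : realType) (n : nat) (s p : R)
    (u : 'rV[R]_n.+1 -> R)
    (hN : (2 <= n.+1)%N) (hs0 : 0 < s) (hs1 : s < 1)
    (hp1 : 1 < p) (hp : p <= (n.+1%:R + s) / (n.+1%:R - s))
    (hC2 : C2_on (@half_space R n) u) (hL : Ls_bar s u)
    (hu_in : forall x, half_space x -> 0 <= u x)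
    (hsol : pointwise_supersolution s p u)
    (hu_out : ae_Rn (fun x => ~ half_space x -> 0 <= u x)) :
  (forall x, half_space x -> u x = 0) /\
  ae_Rn (fun x => ~ half_space x -> u x = 0).
Proof.
have [v [Z [mv v0 mZ Z0 uv]]] := borel_representative hL hu_in hu_out.
have uH : forall y, half_space y -> u y = 0.
  apply: (interior_zero mZ Z0 uv) => [x /hC2[]//|eps eps0].
  exact: (ae_zero_above hs0 hs1 hp1 hp mv v0 mZ Z0 uv hC2 hsol eps0).
split => //.
have p0 : p != 0 by rewrite gt_eqF// (lt_trans ltr01).
have [Z' [mZ' Z'0 HZ']] := ae_zero_of_half_space hs0 mv v0
  (far_part_zero hs0 hs1 p0 mv v0 mZ Z0 uv hsol uH).
exists (Z `|` Z'); split; first exact: measurableU.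
  apply/eqP; rewrite -measure_le0; apply: (le_trans (measureU2 _ mZ mZ')).
  by rewrite [X in (X + _)%E]Z0 [X in (_ + X)%E]Z'0 adde0.
move=> x /=; apply: contra_notP => /not_orP[n1 n2] _.
by rewrite uv//; apply: contrapT => h; apply: n2; apply: HZ'.
Qed.
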